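(* Let $\boldsymbol\theta_0\in\Theta_1$, let $\mathbb Q_0=\mathbb Q_{0,\beta,\mathbf A_n}$ be an Ising model and $\mathbf X^n\sim P_{\boldsymbol\theta_0,\mathbb Q_0}$, and assume $$\sup_{\boldsymbol\theta\in\Theta}\Big\|\mathbb E^{\mathbb Q_{\boldsymbol\theta}}\Big[\sum_{i=1}^n\mathbf X_iW_i\Big]-\sum_{i=1}^n\mathbf X_i\tanh(\boldsymbol\theta^\top\mathbf X_i)\Big\|=o_p(\sqrt n).\qquad(\ast)$$ For $\mathbf h\in\mathbb R^d$ let $\boldsymbol\theta_n=\boldsymbol\theta_0+\mathbf h/\sqrt n$. Then $$\log\frac{dP_{\boldsymbol\theta_n,\mathbb Q_0}}{dP_{\boldsymbol\theta_0,\mathbb Q_0}}(\mathbf X^n)=\mathbf h^\top\Delta_{n,\boldsymbol\theta_0}(\mathbf X^n)-\tfrac12\mathbf h^\top I_0(\boldsymbol\theta_0)\mathbf h+o_p(1),$$ where $\Delta_{n,\boldsymbol\theta_0}(\mathbf X^n)=\sqrt n\big(\frac1n\sum_i\mathbf X_i\tanh(\boldsymbol\theta_0^\top\mathbf X_i)-\boldsymbol\theta_0\big)\xrightarrow{d}N_d(0,I_0(\boldsymbol\theta_0))$ under $P_{\boldsymbol\theta_0,\mathbb Q_0}$. Hence $\{P_{\boldsymbol\theta,\mathbb Q_0}\}_{\boldsymbol\theta\in\Theta_1}$ is locally asymptotically normal at every $\boldsymbol\theta_0\in\Theta_1$ with precision matrix $I_0(\boldsymbol\theta_0)$.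
   Context: Model: $\mathbf Z^n\sim\mathbb Q_0$ on $\{-1,1\}^n$; conditionally on $\mathbf Z^n$ the $\mathbf X_i$ are independent $N_d(\boldsymbol\theta Z_i,\mathbf I_d)$; $P_{\boldsymbol\theta,\mathbb Q_0}$ is the law of $\mathbf X^n$. $\Theta=\mathbb R^d\setminus\{\mathbf 0\}$, $\Theta_1$ the lexicographically positive half-space. Ising model $\mathbb Q_{0,\beta,\mathbf A_n}(\mathbf z)\propto e^{\frac\beta2\mathbf z^\top\mathbf A_n\mathbf z}$ with $\mathbf A_n$ symmetric, nonnegative, zero diagonal, $\beta\ge 0$. $\mathbb Q_{\boldsymbol\theta}(\mathbf w)\propto\exp(\frac\beta2\mathbf w^\top\mathbf A_n\mathbf w+\boldsymbol\theta^\top\sum_i\mathbf X_iw_i)$ on $\{-1,1\}^n$ (given $\mathbf X^n$), and $\mathbb E^{\mathbb Q_{\boldsymbol\theta}}$ is expectation in $\mathbf W^n\sim\mathbb Q_{\boldsymbol\theta}$. $I_0(\boldsymbol\theta_0)=\mathbf I_d-\mathbb E_{\mathbf X\sim N_d(\boldsymbol\theta_0,\mathbf I_d)}\mathbf X\mathbf X^\top\operatorname{sech}^2(\boldsymbol\theta_0^\top\mathbf X)$. *)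

(* Defs.v *)
From HB Require Import structures.
From mathcomp Require Import all_boot all_order all_algebra.
From mathcomp Require Import all_classical all_reals all_analysis.
Set Implicit Arguments. Unset Strict Implicit. Unset Printing Implicit Defensive.
Import Order.TTheory GRing.Theory Num.Theory.
Import numFieldNormedType.Exports.
Local Open Scope classical_set_scope.
Local Open Scope ring_scope.

Section Defs.
Context {R : realType}.

(* spins: true <-> +1, false <-> -1 ; {-1,1}^n is encoded as {ffun 'I_n -> bool} *)
Definition spin (b : bool) : R := if b then 1 else -1.

Definition tanhR (t : R) : R := (expR t - expR (- t)) / (expR t + expR (- t)).
Definition sechR (t : R) : R := 2 / (expR t + expR (- t)).

Definition vnorm d (v : 'cV[R]_d) : R := Num.sqrt (\sum_(j < d) v j ord0 ^+ 2).

Definition dotrow n d (th : 'cV[R]_d) (x : 'M[R]_(n, d)) (i : 'I_n) : R :=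
  \sum_(j < d) th j ord0 * x i j.

Definition quadform n (A : 'M[R]_n) (z : {ffun 'I_n -> bool}) : R :=
  \sum_(i < n) \sum_(j < n) A i j * spin (z i) * spin (z j).
Definition ising_weight n (beta : R) (A : 'M[R]_n) (z : {ffun 'I_n -> bool}) : R :=
  expR (beta / 2 * quadform A z).
Definition isingQ n (beta : R) (A : 'M[R]_n) (z : {ffun 'I_n -> bool}) : R :=
  ising_weight beta A z / \sum_(w : {ffun 'I_n -> bool}) ising_weight beta A w.

(* Lebesgue density on R^{n x d} of P_{theta,Q0}:
   sum_z Q0(z) prod_i phi_d(x_i - theta z_i) *)
Definition mixdens n d (beta : R) (A : 'M[R]_n) (th : 'cV[R]_d) (x : 'M[R]_(n, d)) : R :=
  \sum_(z : {ffun 'I_n -> bool}) isingQ beta A z *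
    \prod_(i < n) \prod_(j < d) normal_pdf (th j ord0 * spin (z i)) 1 (x i j).

Definition loglik_ratio n d beta (A : 'M[R]_n) (th th' : 'cV[R]_d) (x : 'M[R]_(n, d)) : R :=
  ln (mixdens beta A th x) - ln (mixdens beta A th' x).

Definition post_weight n d beta (A : 'M[R]_n) (th : 'cV[R]_d) (x : 'M[R]_(n, d))
  (w : {ffun 'I_n -> bool}) : R :=
  expR (beta / 2 * quadform A w + \sum_(i < n) dotrow th x i * spin (w i)).

Definition postE n d beta (A : 'M[R]_n) (th : 'cV[R]_d) (x : 'M[R]_(n, d)) : 'cV[R]_d :=
  \col_(j < d) ((\sum_(w : {ffun 'I_n -> bool})
                   post_weight beta A th x w * \sum_(i < n) x i j * spin (w i))
                / \sum_(w : {ffun 'I_n -> bool}) post_weight beta A th x w).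

Definition tanh_sum n d (th : 'cV[R]_d) (x : 'M[R]_(n, d)) : 'cV[R]_d :=
  \col_(j < d) \sum_(i < n) x i j * tanhR (dotrow th x i).

Definition approx_err n d beta (A : 'M[R]_n) (x : 'M[R]_(n, d)) : R :=
  sup [set r | exists th : 'cV[R]_d, th != 0 /\
                r = vnorm (postE beta A th x - tanh_sum th x)].

Definition Delta n d (th0 : 'cV[R]_d) (x : 'M[R]_(n, d)) : 'cV[R]_d :=
  Num.sqrt n%:R *: ((n%:R)^-1 *: tanh_sum th0 x - th0).

Definition lexpos d (th : 'cV[R]_d) : Prop :=
  exists k : 'I_d, (forall j : 'I_d, (j < k)%N -> th j ord0 = 0) /\ 0 < th k ord0.

(* Expectation of F(Z_0,...,Z_{k-1}) for Z_i iid N(0,1), as an iterated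
   (Fubini) integral against the library's normal_prob 0 1. *)
Fixpoint stdgauss_iter (k : nat) (F : (nat -> R) -> R) (g : nat -> R) : R :=
  match k with
  | 0 => F g
  | k'.+1 => (\int[normal_prob 0 1]_(t in setT)
                stdgauss_iter k' F (fun j => if j == k' then t else g j))%R
  end.

Definition gaussE d (mu : 'cV[R]_d) (L : 'M[R]_d) (f : 'cV[R]_d -> R) : R :=
  stdgauss_iter d (fun g => f (mu + L *m \col_(i < d) g i)) (fun _ => 0).

(* expectation under N_d(0, Sigma): law of L Z for a (chosen) factor L L^T = Sigma *)
Definition normal_covE d (Sigma : 'M[R]_d) (f : 'cV[R]_d -> R) : R :=
  gaussE 0 (xget 0 [set L : 'M[R]_d | L *m L^T = Sigma]) f.

Definition fisher0 d (th0 : 'cV[R]_d) : 'M[R]_d :=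
  1%:M - \matrix_(i < d, j < d)
           gaussE th0 1%:M (fun v => v i ord0 * v j ord0 *
                                       sechR ((th0^T *m v) ord0 ord0) ^+ 2).

Definition cvg_in_prob (dd : measure_display) (Omega : nat -> measurableType dd)
  (P : forall n, probability (Omega n) R) (Y : forall n, Omega n -> R) : Prop :=
  forall eps : R, 0 < eps ->
    (fun n => fine (P n [set w | eps < `|Y n w|])) @ \oo --> (0 : R).

End Defs.

(* Main.v *)
(** Each row enters the mixture law only through the sign of its mean, so a product
    of even functions of the rows has the same expectation as under independent rows
    N_d(th0, I_d).  The summands X tanh(th0.X) - th0, (h.X)^2 sech^2(th0.X) and |h.X|^3
    are even; hence the central limit theorem for Delta and the law of large numbers are
    those of independent vectors, the dependence of the spins playing no role.
    A Cameron-Martin tilt gives E X tanh(th0.X) = th0, and then the covariance is I_0(th0).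

    Up to terms free of th, the log-likelihood is log Z(th) - n |th|^2 / 2, where Z
    normalises the posterior of the spins and grad log Z is the posterior mean of
    sum_i X_i W_i.  The gradient of sum_i log cosh(th.X_i) is sum_i X_i tanh(th.X_i), so
    by assumption (ast) and the mean value theorem on the segment from th0 to
    th0 + h / sqrt n one may replace log Z by sum_i log cosh(th.X_i), and a second-order
    expansion of log cosh gives the LAN expansion.

    The law is only known on rectangles.  Step functions give the expectations of
    products of functions of single coordinates; general bounded continuous functions of
    the rows are reached by tensor Bernstein polynomials in the variables
    (1 + sin(c v_j)) / 2.  These are trigonometric polynomials bounded by sup |f|, so
    they also turn convergence of characteristic functions into weak convergence. *)
Require Import Defs.
From HB Require Import structures.
From mathcomp Require Import all_boot all_order all_algebra.
From mathcomp Require Import all_classical all_reals all_analysis.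
From mathcomp Require Import measurable_realfun ring lra.
Set Implicit Arguments. Unset Strict Implicit. Unset Printing Implicit Defensive.
Import Order.TTheory GRing.Theory Num.Theory.
Import numFieldNormedType.Exports.
Local Open Scope classical_set_scope.
Local Open Scope ring_scope.

(** * Taylor bounds for sin, cos and log cosh *)

Section Calculus.
Context {R : realType}.
Implicit Types (f df : R -> R) (x y a b : R).

(** Integrability of the rows under [P n] is never established: the law is accessible through
    bounded functions only. Hence second moments occur as expectations of [Num.min M (S ^+ 2)], and
    unbounded summands are truncated by [clamp], which keeps them even but not centred; the centring
    returns only in the limit of the truncation level. [gaussE] is an iterated integral, so
    linearity, translation and dominated convergence pass through one coordinate at a time. This
    calls for integrands that are stable under partial integration: continuous functions of
    exponential growth. Characteristic functions are cosines with a phase; the addition formula then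
    peels off one row at a time and leaves only even functions of the rows. Three points need care
    with totalised operations: [sup] needs a bounded set, [xget] needs a nonempty set of factors of
    the Fisher information, and [P n] is monotone on measurable sets. They account for the crude
    bound on the posterior mean, the semidefinite Cholesky factorisation and the countable
    supremum. *)

Lemma is_derive_continuous f df : (forall x, is_derive x 1 f (df x)) ->
  continuous f.
Proof.
move=> fd x; apply: differentiable_continuous; apply/derivable1_diffP.
exact: ex_derive.
Qed.

Lemma MVT_any f df a b : (forall x, is_derive x 1 f (df x)) ->
  exists2 c, `|c - a| <= `|b - a| & f b - f a = df c * (b - a).
Proof.
move=> fd; have cf := is_derive_continuous fd.
have [ab|/ltW ba] := leP a b.
  have [c + ->] := @MVT_segment _ f df a b ab (fun x _ => fd x)
    (continuous_subspaceT cf).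
  rewrite in_itv /= => /andP[ac cb]; exists c => //.
  by rewrite !ger0_norm ?subr_ge0// lerD2r.
have [c + e] := @MVT_segment _ f df b a ba (fun x _ => fd x)
  (continuous_subspaceT cf).
rewrite in_itv /= => /andP[bc ca]; exists c.
  by rewrite !ler0_norm ?subr_le0// lerN2 lerD2r.
by rewrite -opprB e -mulrN opprB.
Qed.

(** The mean value theorem raises the exponent by one and keeps [C]. Chained along successive
    derivatives it gives Taylor bounds, with constants larger than the sharp ones. *)
Lemma norm_le_of_derive f df C k : 0 <= C -> f 0 = 0 ->
  (forall x, is_derive x 1 f (df x)) ->
  (forall x, `|df x| <= C * `|x| ^+ k) ->
  forall x, `|f x| <= C * `|x| ^+ k.+1.
Proof.
move=> C0 f0 fd dfC x; have [c] := MVT_any 0 x fd.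
rewrite !subr0 f0 subr0 => cx ->; rewrite normrM exprSr mulrA ler_wpM2r//.
by apply: (le_trans (dfC c)); rewrite ler_wpM2l// lerXn2r// nnegrE.
Qed.

Lemma norm_sin_le x : `|sin x| <= `|x|.
Proof.
rewrite -[leRHS]mul1r -[X in _ <= 1 * X]expr1.
apply: (@norm_le_of_derive sin cos) => //; first exact: sin0.
by move=> y; rewrite expr0 mulr1 cos_max.
Qed.

Lemma norm_cosB1_le x : `|cos x - 1| <= `|x| ^+ 2.
Proof.
rewrite -[leRHS]mul1r.
apply: (@norm_le_of_derive (fun x => cos x - 1) (fun x => - sin x)) => //.
- by rewrite cos0 subrr.
- by move=> y; apply: is_derive_eq; rewrite subr0.
- by move=> y; rewrite normrN mul1r norm_sin_le.
Qed.

Lemma norm_sinB_le x : `|sin x - x| <= `|x| ^+ 3.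
Proof.
rewrite -[leRHS]mul1r.
apply: (@norm_le_of_derive (fun x => sin x - x) (fun x => cos x - 1)) => //.
- by rewrite sin0 subrr.
- by move=> y; rewrite mul1r norm_cosB1_le.
Qed.

Lemma norm_cos_taylor2 x : `|cos x - 1 + x ^+ 2 / 2| <= `|x| ^+ 4.
Proof.
rewrite -[leRHS]mul1r.
apply: (@norm_le_of_derive (fun x => cos x - 1 + x ^+ 2 / 2)
  (fun x => x - sin x)) => //.
- by rewrite cos0 subrr expr0n mul0r addr0.
- move=> y; apply: is_derive_eq; rewrite /GRing.scale/=; lra.
- by move=> y; rewrite mul1r distrC norm_sinB_le.
Qed.

(** From e^-x (1 + x) <= 1 follows e^-x <= 1 - x e^-x, and e^-x >= 1 - x on the right turns this
    into 1 - x + x^2. *)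
Lemma expRN_taylor1 x : 0 <= x -> `|expR (- x) - (1 - x)| <= x ^+ 2.
Proof.
move=> x0; have h1 := expR_ge1Dx (- x).
have h2 : expR (- x) * (1 + x) <= 1.
  rewrite -[leRHS](expR0 R) -(subrr x) [in leRHS]addrC expRD.
  by rewrite ler_wpM2l ?expR_ge0// expR_ge1Dx.
have h3 : expR (- x) <= 1 by rewrite -[leRHS](expR0 R) ler_expR oppr_le0.
rewrite ger0_norm; last by lra.
have : 0 <= expR (- x) by exact: expR_ge0.
nra.
Qed.

(** This is log cosh plus ln 2; only differences of [lcosh] matter, so the constant cancels. *)
Definition lcosh x : R := ln (expR x + expR (- x)).

Lemma expRDN_gt0 x : 0 < expR x + expR (- x).
Proof. by rewrite addr_gt0 ?expR_gt0. Qed.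

Lemma is_derive_expRN x : is_derive x 1 (fun y : R => expR (- y)) (- expR (- x)).
Proof. by apply: is_derive_eq; rewrite /GRing.scale/= mulrN1. Qed.

Lemma is_derive_lcosh x : is_derive x 1 lcosh (tanhR x).
Proof.
have h : is_derive x 1 (fun y : R => expR y + expR (- y)) (expR x - expR (- x)).
  by apply: is_deriveD; exact: is_derive_expRN.
rewrite /lcosh.
have := @is_derive1_comp R (@ln R) (fun y => expR y + expR (- y)) x _ _
  (is_derive1_ln (expRDN_gt0 x)) h.
by move=> hh; apply: is_derive_eq => //; rewrite /tanhR mulrC.
Qed.

Lemma is_derive_tanhR x : is_derive x 1 (@tanhR R) (sechR x ^+ 2).
Proof.
have h0 : expR x + expR (- x) != 0 by rewrite gt_eqF ?expRDN_gt0.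
have h : is_derive x 1 (fun y : R => expR y + expR (- y)) (expR x - expR (- x)).
  by apply: is_deriveD; exact: is_derive_expRN.
have h' : is_derive x 1 (fun y : R => expR y - expR (- y)) (expR x + expR (- x)).
  have hN := is_derive_expRN x.
  by apply: is_derive_eq; rewrite opprK.
have hi := @is_deriveV _ (fun y : R => expR y + expR (- y)) _ _ _ h0 h.
rewrite /tanhR; apply: is_derive_eq.
rewrite /sechR /GRing.scale/= expr_div_n.
have : expR x * expR (- x) = 1 by rewrite -expRD subrr expR0.
by move: (expR x) (expR (- x)) h0 => u v h0 uv; field: uv.
Qed.

Lemma is_derive_sechR2 x :
  is_derive x 1 (fun y => sechR y ^+ 2 : R) (- 2 * sechR x ^+ 2 * tanhR x).
Proof.
have h0 : expR x + expR (- x) != 0 by rewrite gt_eqF ?expRDN_gt0.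
have h : is_derive x 1 (fun y : R => expR y + expR (- y)) (expR x - expR (- x)).
  by apply: is_deriveD; exact: is_derive_expRN.
have hi := @is_deriveV _ (fun y : R => expR y + expR (- y)) _ _ _ h0 h.
rewrite /sechR; apply: is_derive_eq.
rewrite /tanhR /GRing.scale/= ?expr1.
by move: (expR x) (expR (- x)) h0 => u v h0; field.
Qed.

Lemma norm_tanhR_le1 x : `|tanhR x| <= 1.
Proof.
rewrite /tanhR normrM normfV ler_pdivrMr ?normr_gt0 ?gt_eqF ?expRDN_gt0//.
rewrite mul1r (ger0_norm (ltW (expRDN_gt0 x))) ler_norml.
by have := expR_gt0 x; have := expR_gt0 (- x); lra.
Qed.

Lemma sechR_gt0 x : 0 < sechR x.
Proof. by rewrite /sechR divr_gt0 ?expRDN_gt0. Qed.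

Lemma sechR2E x : sechR x ^+ 2 = 1 - tanhR x ^+ 2.
Proof.
have h0 : expR x + expR (- x) != 0 by rewrite gt_eqF ?expRDN_gt0.
have : expR x * expR (- x) = 1 by rewrite -expRD subrr expR0.
rewrite /sechR /tanhR !expr_div_n.
by move: (expR x) (expR (- x)) h0 => u v h0 uv; field: uv.
Qed.

Lemma sechR2_le1 x : sechR x ^+ 2 <= 1.
Proof. by rewrite sechR2E gerBl sqr_ge0. Qed.

Lemma tanhRN x : tanhR (- x) = - tanhR x.
Proof. by rewrite /tanhR opprK [in X in _ / X]addrC -opprB mulNr. Qed.

Lemma sechRN x : sechR (- x) = sechR x.
Proof. by rewrite /sechR opprK addrC. Qed.

(** The third derivative -2 sech^2 tanh is bounded by 2; [norm_le_of_derive] carries this bound back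
    to log cosh, once per derivative. *)
Lemma lcosh_taylor2 a x :
  `|lcosh (a + x) - lcosh a - x * tanhR a - x ^+ 2 / 2 * sechR a ^+ 2|
    <= 2 * `|x| ^+ 3.
Proof.
have dshift (g dg : R -> R) (z : R) : (forall y, is_derive y 1 g (dg y)) ->
    is_derive z 1 (fun y => g (a + y)) (dg (a + z)).
  move=> gd; have h : is_derive z 1 (cst a + id) (0 + 1 : R) by exact: is_deriveD.
  have := @is_derive1_comp R g (cst a + id) z _ _ (gd _) h.
  by rewrite add0r mulr1.
pose s2 (y : R) := sechR y ^+ 2.
have B0 y : `|s2 (a + y) - s2 a| <= 2 * `|y|.
  pose ds2 z : R := - 2 * sechR z ^+ 2 * tanhR z.
  have ds2_le z : `|ds2 z| <= 2.
    rewrite normrM -[leRHS]mulr1.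
    apply: ler_pM; [exact: normr_ge0|exact: normr_ge0| |exact: norm_tanhR_le1].
    rewrite mulNr normrN ger0_norm ?mulr_ge0 ?sqr_ge0// ler_piMr//.
    exact: sechR2_le1.
  have s2d : forall z : R, is_derive z 1 s2 (ds2 z) by exact: is_derive_sechR2.
  clearbody s2 ds2; rewrite -[X in _ <= 2 * X]expr1.
  apply: (@norm_le_of_derive (fun y => s2 (a + y) - s2 a) (fun y => ds2 (a + y))).
  - by [].
  - by rewrite addr0 subrr.
  - move=> z; have hd := dshift _ _ z s2d.
    by apply: is_derive_eq; rewrite subr0.
  - by move=> z; rewrite expr0 mulr1.
have td : forall z : R, is_derive z 1 tanhR (s2 z) by exact: is_derive_tanhR.
have ld := is_derive_lcosh.
rewrite -/(s2 a); clearbody s2.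
move: (@tanhR R) lcosh td ld => T L td ld.
have B1 y : `|T (a + y) - T a - y * s2 a| <= 2 * `|y| ^+ 2.
  apply: (@norm_le_of_derive (fun y => T (a + y) - T a - y * s2 a)
    (fun y => s2 (a + y) - s2 a)).
  - by [].
  - by rewrite addr0 subrr mul0r subrr.
  - move=> z; have hd := dshift _ _ z td.
    by apply: is_derive_eq; rewrite /GRing.scale /=; lra.
  - by move=> z; rewrite expr1.
apply: (@norm_le_of_derive
  (fun x => L (a + x) - L a - x * T a - x ^+ 2 / 2 * s2 a)
  (fun y => T (a + y) - T a - y * s2 a)).
- by [].
- by rewrite addr0 subrr mul0r subrr expr0n !mul0r subr0.
- move=> z; have hd := dshift _ _ z ld.
  by apply: is_derive_eq; rewrite /GRing.scale /=; lra.
- exact: B1.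
Qed.

End Calculus.

(** * Gaussian integrals on the line *)

Section StdGaussian.
Context {R : realType}.
Local Notation mu := (@lebesgue_measure R).
Implicit Types (f : R -> R) (s t c : R).

(** Change of variables brings in the Radon-Nikodym derivative. It equals [normal_pdf] almost
    everywhere, since both integrate to [normal_prob] over every measurable set. *)
Lemma ge0_integral_normal_prob (m : R) f : (forall x, 0 <= f x) ->
  measurable_fun setT f ->
  (\int[normal_prob m 1]_x (f x)%:E =
   \int[mu]_x (f x * normal_pdf m 1 x)%:E)%E.
Proof.
move=> f0 mf.
have dom : normal_prob m 1 `<< mu by exact: normal_prob_dominates.
rewrite -(Radon_Nikodym_SigmaFinite.change_of_variables dom)//; last exact/measurable_EFinP.
apply: ae_eq_integral => //.
- apply: emeasurable_funM; first exact/measurable_EFinP.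
  exact: measurable_int (Radon_Nikodym_SigmaFinite.f_integrable dom).
- apply/measurable_EFinP; apply: measurable_funM => //.
  exact: measurable_normal_pdf.
- under [X in ae_eq _ _ _ X]eq_fun do rewrite EFinM.
  apply: ae_eqe_mul2l; apply: integral_ae_eq => //.
  + exact: Radon_Nikodym_SigmaFinite.f_integrable.
  + by apply/measurable_EFinP; exact: measurable_normal_pdf.
  + by move=> A _ mA; rewrite -Radon_Nikodym_SigmaFinite.f_integral.
Qed.

Lemma continuous_shift f s : continuous f -> continuous (fun x => f (x + s)).
Proof.
move=> cf x; apply: (@continuous_comp _ _ _ (fun x => x + s) f); last exact: cf.
by apply: cvgD; [exact: cvg_id|exact: cvg_cst].
Qed.

Lemma continuous_comp_oppr f : continuous f -> continuous (fun x => f (- x)).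
Proof.
by move=> cf x; apply: (@continuous_comp _ _ _ -%R f); [exact: oppr_continuous|exact: cf].
Qed.

Lemma ge0_integral_shift f s : continuous f -> (forall x, 0 <= f x) ->
  (\int[mu]_x (f x)%:E = \int[mu]_x (f (x + s))%:E)%E.
Proof.
move=> cf f0.
have D (x : R) : is_derive x 1 (fun y : R => y + s) (1 : R).
  by apply: is_derive_eq; rewrite addr0.
have D1 : (fun y : R => y + s)^`()%classic = cst 1.
  by apply/funext => x; rewrite derive1E; apply: derive_val.
rewrite (@increasing_ge0_integration_by_substitutionT R (fun x => x + s))//.
- by apply: eq_integral => x _; rewrite D1 /= /GRing.mul/= ?mulr1.
- by move=> x y; rewrite ltrD2r.
- by rewrite D1 => x; exact: cvg_cst.
- by rewrite D1; exact: is_cvg_cst.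
- by rewrite D1; exact: is_cvg_cst.
- exact: cvg_addrr_Ny.
- exact: cvg_addrr.
Qed.

Lemma ge0_integral_oppr f : continuous f -> (forall x, 0 <= f x) ->
  (\int[mu]_x (f x)%:E = \int[mu]_x (f (- x))%:E)%E.
Proof.
move=> cf f0.
have cfN := continuous_comp_oppr cf.
(* Both half-lines are folded onto the positive one; reflection then merely exchanges the two
   terms. *)
have spl (g : R -> R) : continuous g -> (forall x, 0 <= g x) ->
   (\int[mu]_x (g x)%:E = \int[mu]_(x in `[0%R, +oo[) (g (- x))%:E +
     \int[mu]_(x in `[0%R, +oo[) (g x)%:E)%E.
  move=> cg g0; have mg : measurable_fun setT g by exact: continuous_measurable_fun.
  rewrite -{1}(setUv `[(0 : R), +oo[%classic) ge0_integral_setU//=; last 4 first.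
  - exact: measurableC.
  - by apply/measurable_EFinP; rewrite setUv.
  - by move=> x _; rewrite lee_fin.
  - exact/disj_setPCl.
  rewrite setCitvr addeC; congr (_ + _)%E.
  rewrite integral_itv_bndo_bndc; last exact/measurable_EFinP/measurable_funTS.
  by rewrite -{1}oppr0 ge0_integration_by_substitutionNy//; exact: continuous_subspaceT.
rewrite (spl f)// (spl (fun x => f (- x)))// addeC; congr (_ + _)%E.
by apply: eq_integral => x _; rewrite opprK.
Qed.

End StdGaussian.

(** Such functions are Gaussian integrable and closed under sums, products, translation and
    reflection, so that integrability conditions are settled by the shape of the integrand. *)
Definition expgrow1 (R : realType) (f : R -> R) := continuous f /\
  exists C c : R, [/\ 0 <= C, 0 <= c & forall t, `|f t| <= C * expR (c * `|t|)].

(** * Gaussian expectation of functions of exponential growth *)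

Section StdGaussianExpectation.
Context {R : realType}.
Local Notation mu := (@lebesgue_measure R).
Local Notation N := (normal_prob (0 : R) 1).
Local Notation E1 f := (\int[normal_prob 0 1]_(t in setT) f t)%R.
Implicit Types (f g : R -> R) (s t c : R).

Lemma continuous_measurable_EFin f : continuous f ->
  measurable_fun (setT : set (measurableTypeR R)) (EFin \o f).
Proof. by move=> cf; apply/measurable_EFinP; exact: continuous_measurable_fun. Qed.

Lemma normal_pdf1E (m x : R) :
  normal_pdf m 1 x = normal_peak 1 * expR (- (x - m) ^+ 2 / 2).
Proof. by rewrite normal_pdfE ?oner_eq0// /normal_fun expr1n. Qed.

Lemma normal_pdf_shift s x :
  normal_pdf 0 1 (x + s) = expR (- (s * x + s ^+ 2 / 2)) * normal_pdf 0 1 x.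
Proof.
rewrite !normal_pdf1E mulrCA -expRD; congr (_ * expR _).
by rewrite !subr0; field.
Qed.

(** One-dimensional Cameron-Martin formula. In the nonnegative form it presupposes no integrability
    and can itself be used to prove it. *)
Lemma ge0_gaussian_shift f s : continuous f -> (forall x, 0 <= f x) ->
  (\int[N]_x (f x)%:E =
   \int[N]_x (f (x + s) * expR (- (s * x + s ^+ 2 / 2)))%:E)%E.
Proof.
move=> cf f0; have cphi : continuous (normal_pdf (0 : R) 1).
  by apply: continuous_normal_pdf; exact: oner_neq0.
have cfs := continuous_shift (s := s) cf.
have ce : continuous (fun x : R => expR (- (s * x + s ^+ 2 / 2))).
  move=> x; apply: continuous_comp; last exact: continuous_expR.
  by apply: cvgN; apply: cvgD; [apply: cvgM; [exact: cvg_cst|exact: cvg_id]|exact: cvg_cst].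
have mf := continuous_measurable_fun cf.
have cg : continuous (fun x => f (x + s) * expR (- (s * x + s ^+ 2 / 2))).
  by move=> x; apply: cvgM; [exact: cfs|exact: ce].
have g0 x : 0 <= f (x + s) * expR (- (s * x + s ^+ 2 / 2)).
  by rewrite mulr_ge0 ?expR_ge0.
have mg := continuous_measurable_fun cg.
rewrite (ge0_integral_normal_prob _ f0 mf) (ge0_integral_normal_prob _ g0 mg).
rewrite (@ge0_integral_shift _ _ s).
- by apply: eq_integral => x _; rewrite normal_pdf_shift mulrA.
- by move=> x; apply: cvgM; [exact: cf|exact: cphi].
- by move=> x; rewrite mulr_ge0 ?normal_pdf_ge0.
Qed.

Lemma ge0_gaussian_oppr f : continuous f -> (forall x, 0 <= f x) ->
  (\int[N]_x (f x)%:E = \int[N]_x (f (- x))%:E)%E.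
Proof.
move=> cf f0; have cphi : continuous (normal_pdf (0 : R) 1).
  by apply: continuous_normal_pdf; exact: oner_neq0.
have cfN := continuous_comp_oppr cf.
have mf := continuous_measurable_fun cf.
have mg := continuous_measurable_fun cfN.
rewrite (ge0_integral_normal_prob _ f0 mf).
rewrite (ge0_integral_normal_prob _ (fun x => f0 (- x)) mg).
rewrite ge0_integral_oppr.
- by apply: eq_integral => x _; rewrite !normal_pdf1E !subr0 sqrrN.
- by move=> x; apply: cvgM; [exact: cf|exact: cphi].
- by move=> x; rewrite mulr_ge0 ?normal_pdf_ge0.
Qed.

Lemma ge0_normal_prob_center f m : continuous f -> (forall x, 0 <= f x) ->
  (\int[normal_prob m 1]_x (f x)%:E = \int[N]_x (f (x + m))%:E)%E.
Proof.
move=> cf f0; have cphi : continuous (normal_pdf (m : R) 1).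
  by apply: continuous_normal_pdf; exact: oner_neq0.
have cfs := continuous_shift (s := m) cf.
have mf := continuous_measurable_fun cf.
have mg := continuous_measurable_fun cfs.
rewrite (ge0_integral_normal_prob _ f0 mf).
rewrite (ge0_integral_normal_prob _ (fun x => f0 (x + m)) mg).
rewrite (@ge0_integral_shift _ _ m).
- by apply: eq_integral => x _; rewrite !normal_pdf1E addrK subr0.
- by move=> x; apply: cvgM; [exact: cf|exact: cphi].
- by move=> x; rewrite mulr_ge0 ?normal_pdf_ge0.
Qed.

Lemma continuous_expR_lin (a b : R) : continuous (fun x : R => expR (a * x + b)).
Proof.
move=> x; apply: continuous_comp; last exact: continuous_expR.
by apply: cvgD; [apply: cvgM; [exact: cvg_cst|exact: cvg_id]|exact: cvg_cst].
Qed.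

Lemma continuous_expR_norm (c : R) : continuous (fun x : R => expR (c * `|x|)).
Proof.
move=> x; apply: continuous_comp; last exact: continuous_expR.
by apply: cvgM; [exact: cvg_cst|exact: norm_continuous].
Qed.

Lemma gaussian_integrable_expR c : N.-integrable setT (fun x => (expR (c * x))%:E).
Proof.
have ce : continuous (fun x : R => expR (c * x)).
  by move=> x; have := @continuous_expR_lin c 0 x; under eq_fun do rewrite addr0.
apply/integrableP; split; first exact: continuous_measurable_EFin.
have h1 : (\int[N]_x (1 : R)%:E = 1)%E.
  by rewrite integral_cst// mul1e; exact: (@probability_setT _ _ _ N).
(* The constant 1 shifted by -c shows that e^(c x - c^2/2) has Gaussian integral one. *)
have h := @ge0_gaussian_shift (cst 1) (- c) (@cst_continuous _ _ _) (fun=> ler01).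
rewrite /= h1 in h.
have -> : (\int[N]_x `|(expR (c * x))%:E| = \int[N]_x ((expR (c ^+ 2 / 2))%:E *
    (1 * expR (- (- c * x + (- c) ^+ 2 / 2)))%:E))%E.
  apply: eq_integral => x _; rewrite /= mul1r -EFinM -expRD ger0_norm ?expR_ge0//.
  by congr (expR _)%:E; rewrite sqrrN; ring.
rewrite ge0_integralZl_EFin//.
- by rewrite /= -h mule1 ltry.
- apply: continuous_measurable_EFin => x.
  have := @continuous_expR_lin c (- ((- c) ^+ 2 / 2)) x.
  by under eq_fun do rewrite -[X in X * _]opprK mulNr -opprD -[expR _]mul1r.
Qed.

Lemma gaussian_integrable_expR_norm c : 0 <= c ->
  N.-integrable setT (fun x => (expR (c * `|x|))%:E).
Proof.
move=> c0.
have i := integrableD measurableT (gaussian_integrable_expR c)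
  (gaussian_integrable_expR (- c)).
apply: le_integrable i => //.
  by apply: continuous_measurable_EFin; exact: continuous_expR_norm.
move=> x _ /=; rewrite lee_fin (ger0_norm (expR_ge0 _)) (ger0_norm (addr_ge0 (expR_ge0 _) (expR_ge0 _))).
case: (ger0P x) => x0; first by rewrite lerDl expR_ge0.
by rewrite mulrN -mulNr lerDr expR_ge0.
Qed.

Lemma expgrow1_integrable f : expgrow1 f -> N.-integrable setT (EFin \o f).
Proof.
move=> [cf [C [c [C0 c0 fC]]]].
have i := integrableZl measurableT C (gaussian_integrable_expR_norm c0).
apply: le_integrable i => //.
  exact: continuous_measurable_EFin.
by move=> x _ /=; rewrite lee_fin (le_trans (fC x))// ler_norm.
Qed.

Lemma expgrow1_norm f : expgrow1 f -> expgrow1 (fun x => `|f x|).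
Proof.
move=> [cf [C [c [C0 c0 fC]]]]; split.
  by move=> x; apply: (continuous_comp (cf x)); exact: norm_continuous.
by exists C, c; split => // t; rewrite normr_id.
Qed.

Lemma expgrow1D f g : expgrow1 f -> expgrow1 g -> expgrow1 (fun x => f x + g x).
Proof.
move=> [cf [C [c [C0 c0 fC]]]] [cg [D [d [D0 d0 gD]]]]; split.
  by move=> x; apply: cvgD; [exact: cf|exact: cg].
exists (C + D), (c + d); split; [exact: addr_ge0..|] => t.
rewrite (le_trans (ler_normD _ _))// mulrDl lerD//.
  rewrite (le_trans (fC t))// ler_wpM2l// ler_expR mulrDl lerDl mulr_ge0//.
rewrite (le_trans (gD t))// ler_wpM2l// ler_expR mulrDl lerDr mulr_ge0//.
Qed.

Lemma expgrow1M f g : expgrow1 f -> expgrow1 g -> expgrow1 (fun x => f x * g x).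
Proof.
move=> [cf [C [c [C0 c0 fC]]]] [cg [D [d [D0 d0 gD]]]]; split.
  by move=> x; apply: cvgM; [exact: cf|exact: cg].
exists (C * D), (c + d); split; [exact: mulr_ge0|exact: addr_ge0|] => t.
by rewrite normrM mulrDl expRD mulrACA ler_pM.
Qed.

Lemma expgrow1_bounded f (M : R) : continuous f -> (forall x, `|f x| <= M) ->
  expgrow1 f.
Proof.
move=> cf fM; split => //; exists M, 0; split => //.
  exact: le_trans (fM 0).
by move=> t; rewrite mul0r expR0 mulr1.
Qed.

Lemma expgrow1_cst c : expgrow1 (cst c).
Proof. by apply: (@expgrow1_bounded _ `|c|) => // x; exact: cvg_cst. Qed.

Lemma expgrow1_id : expgrow1 (@id R).
Proof.
split; first by move=> x; exact: cvg_id.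
exists 1, 1; split => // t; rewrite !mul1r.
by apply: le_trans (expR_ge1Dx _); rewrite lerDr.
Qed.

Lemma E1D f g : expgrow1 f -> expgrow1 g ->
  E1 (fun x => f x + g x) = E1 f + E1 g.
Proof. by move=> ef eg; rewrite RintegralD//; exact: expgrow1_integrable. Qed.

Lemma E1Z c f : expgrow1 f -> E1 (fun x => c * f x) = c * E1 f.
Proof. by move=> ef; rewrite RintegralZl//; exact: expgrow1_integrable. Qed.

Lemma E1_cst c : E1 (fun=> c) = c.
Proof. by rewrite Rintegral_cst// [X in fine X](@probability_setT _ _ _ N) mulr1. Qed.

Lemma E1_le f g : expgrow1 f -> expgrow1 g -> (forall x, f x <= g x) ->
  E1 f <= E1 g.
Proof.
by move=> ef eg fg; apply: le_Rintegral => //; exact: expgrow1_integrable.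
Qed.

(** A difference of two nonnegative functions of the same class: this extends the nonnegative
    change-of-variables formulas to signed integrands. *)
Lemma E1_posneg f : expgrow1 f ->
  E1 f = E1 (fun x => f x + `|f x|) - E1 (fun x => `|f x|).
Proof.
by move=> ef; rewrite E1D ?addrK//; exact: expgrow1_norm.
Qed.

Lemma expgrow1_shift f s : expgrow1 f -> expgrow1 (fun x => f (x + s)).
Proof.
move=> [cf [C [c [C0 c0 fC]]]]; split.
  exact: continuous_shift.
exists (C * expR (c * `|s|)), c; split => //; first by rewrite mulr_ge0 ?expR_ge0.
move=> t; rewrite (le_trans (fC _))// -mulrA ler_wpM2l// -expRD ler_expR.
by rewrite -mulrDr ler_wpM2l// addrC ler_normD.
Qed.

Lemma expgrow1_oppr f : expgrow1 f -> expgrow1 (fun x => f (- x)).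
Proof.
move=> [cf [C [c [C0 c0 fC]]]]; split.
  exact: continuous_comp_oppr.
by exists C, c; split => // t; rewrite -(normrN t).
Qed.

Lemma expgrow1_expR_lin (a b : R) : expgrow1 (fun x => expR (a * x + b)).
Proof.
split; first exact: continuous_expR_lin.
exists (expR b), `|a|; split; rewrite ?expR_ge0//.
move=> t; rewrite ger0_norm ?expR_ge0// -expRD ler_expR addrC lerD2l -normrM.
exact: ler_norm.
Qed.

Lemma expgrow1_CM (s : R) : expgrow1 (fun x => expR (- (s * x + s ^+ 2 / 2))).
Proof.
have := expgrow1_expR_lin (- s) (- (s ^+ 2 / 2)).
by under eq_fun do rewrite mulNr -opprD.
Qed.

Lemma E1_shift f s : expgrow1 f ->
  E1 f = E1 (fun x => f (x + s) * expR (- (s * x + s ^+ 2 / 2))).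
Proof.
have ge0 g : expgrow1 g -> (forall x, 0 <= g x) ->
    E1 g = E1 (fun x => g (x + s) * expR (- (s * x + s ^+ 2 / 2))).
  move=> [cg _] g0; congr fine; exact: ge0_gaussian_shift.
move=> ef; have ea := expgrow1_norm ef; have eS := expgrow1D ef ea.
have p1 : forall x, 0 <= f x + `|f x|.
  by move=> x; rewrite addrC -lerBlDr sub0r -normrN ler_norm.
rewrite E1_posneg// (ge0 _ ea)// (ge0 _ eS)//.
apply/eqP; rewrite subr_eq -E1D.
- by apply/eqP; apply: eq_Rintegral => x _; rewrite mulrDl.
- by apply: expgrow1M; [exact: expgrow1_shift|exact: expgrow1_CM].
- by apply: expgrow1M; [exact: (expgrow1_shift _ ea)|exact: expgrow1_CM].
Qed.

Lemma E1_oppr f : expgrow1 f -> E1 f = E1 (fun x => f (- x)).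
Proof.
have ge0 g : expgrow1 g -> (forall x, 0 <= g x) -> E1 g = E1 (fun x => g (- x)).
  move=> [cg _] g0; congr fine; exact: ge0_gaussian_oppr.
move=> ef; have ea := expgrow1_norm ef; have eS := expgrow1D ef ea.
have p1 : forall x, 0 <= f x + `|f x|.
  by move=> x; rewrite addrC -lerBlDr sub0r -normrN ler_norm.
rewrite E1_posneg// (ge0 _ ea)// (ge0 _ eS)//.
rewrite E1D ?addrK//; [exact: (expgrow1_oppr ef)|exact: (expgrow1_oppr ea)].
Qed.

End StdGaussianExpectation.

(** * Stein's identity, moments and characteristic function on the line *)

Section StdGaussianMoments.
Context {R : realType}.
Local Notation N := (normal_prob (0 : R) 1).
Local Notation E1 f := (\int[normal_prob (0 : R) 1]_(t in setT) f t)%R.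
Implicit Types (f g : R -> R) (s t c : R).

Lemma is_derive_E1 (f df : R -> R -> R) (G : R -> R) (a : R) :
  (forall u y : R, is_derive u 1 (f^~ y) (df u y)) ->
  (forall u, expgrow1 (f u)) -> expgrow1 G ->
  (forall u y, `|u - a| < 1 -> `|df u y| <= G y) ->
  is_derive a 1 (fun u => E1 (f u)) (E1 (df a)).
Proof.
move=> fd ef eG dfG.
have Ia : `]a - 1, a + 1[%classic a by rewrite /= in_itv/= ltrBlDr ltrDl ltr01.
have d1f u y : partial1of2 f u y = df u y.
  by rewrite partial1of2E; exact: derive_val.
have intf u (_ : `]a - 1, a + 1[%classic u) : N.-integrable setT (EFin \o f u).
  exact: expgrow1_integrable.
have derf u y (_ : `]a - 1, a + 1[%classic u) (_ : setT y) : derivable (f ^~ y) u 1.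
  exact: ex_derive.
have iG := expgrow1_integrable eG.
have Gub u y : `]a - 1, a + 1[%classic u -> setT y -> `|partial1of2 f u y| <= G y.
  move=> uI _; rewrite d1f; apply: dfG; move: uI; rewrite /= in_itv/= => /andP[u1 u2].
  by rewrite ltr_norml; apply/andP; split; lra.
have G0 y : 0 <= G y by apply: le_trans (dfG a y _); rewrite ?subrr ?normr0.
have h1 := derivable_under_integral measurableT Ia intf derf G0 iG Gub.
have h2 := differentiation_under_integral measurableT Ia intf derf G0 iG Gub.
apply: DeriveDef; first exact: h1.
by rewrite -derive1E h2; apply: eq_Rintegral => y _; exact: d1f.
Qed.

(** Envelope for differentiating the translation formula under the integral. For |s| < 1 the growth
    at y + s costs a factor e^(c+d), the linear factor |y| + 1 is at most 2 e^|y|, and the tilt is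
    at most e^|y|; whence the exponent c + d + 2. *)
Lemma stein_domination (h dh : R -> R) (C c D d s y : R) :
  0 <= C -> 0 <= c -> 0 <= D -> 0 <= d ->
  (forall t, `|h t| <= C * expR (c * `|t|)) ->
  (forall t, `|dh t| <= D * expR (d * `|t|)) -> `|s| < 1 ->
  `|(dh (y + s) - (y + s) * h (y + s)) * expR (- (s * y + s ^+ 2 / 2))| <=
    (C + D) * expR (c + d) * 2 * expR ((c + d + 2) * `|y|).
Proof.
move=> C0 c0 D0 d0 hC hD s1; have cd0 : 0 <= c + d by exact: addr_ge0.
rewrite normrM [X in _ * X]ger0_norm ?expR_ge0//.
have ys : `|y + s| <= `|y| + 1 by rewrite (le_trans (ler_normD _ _))// lerD2l ltW.
have e1 : expR (- (s * y + s ^+ 2 / 2)) <= expR `|y|.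
  rewrite ler_expR (@le_trans _ _ (- (s * y)))//.
    by rewrite lerN2 lerDl divr_ge0 ?sqr_ge0.
  rewrite (le_trans (ler_norm _))// normrN normrM ler_piMl// ltW//.
have e2 : `|h (y + s)| <= C * expR ((c + d) * (`|y| + 1)).
  by rewrite (le_trans (hC _))// ler_wpM2l// ler_expR ler_pM ?lerDl.
have e3 : `|dh (y + s)| <= D * expR ((c + d) * (`|y| + 1)).
  by rewrite (le_trans (hD _))// ler_wpM2l// ler_expR ler_pM ?lerDr.
have e4 : `|y| + 1 <= 2 * expR `|y|.
  have := expR_ge1Dx `|y|; have : 1 <= expR `|y| by rewrite -expR0 ler_expR.
  lra.
have e5 : 1 <= 2 * expR `|y|.
  have : 1 <= expR `|y| by rewrite -expR0 ler_expR.
  lra.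
have -> : (C + D) * expR (c + d) * 2 * expR ((c + d + 2) * `|y|) = (D + C) * expR ((c + d) * (`|y| + 1)) * (2 * expR `|y|) * expR `|y|.
  rewrite (_ : (c + d + 2) * `|y| = (c + d) * `|y| + (`|y| + `|y|)); last by ring.
  rewrite (_ : (c + d) * (`|y| + 1) = (c + d) * `|y| + (c + d)); last by ring.
  rewrite (expRD ((c + d) * `|y|) (`|y| + `|y|)) (expRD `|y| `|y|).
  by rewrite (expRD ((c + d) * `|y|) (c + d)); ring.
apply: ler_pM; rewrite ?expR_ge0//.
rewrite (le_trans (ler_normB _ _))// normrM mulrDl mulrDl lerD//.
  rewrite (le_trans e3)// ler_peMr// mulr_ge0// expR_ge0//.
rewrite mulrC ler_pM//; exact: le_trans ys e4.
Qed.

(* Stein's identity: differentiate the translation formula [E1_shift] at 0. *)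
Lemma E1_stein (h dh : R -> R) : (forall x : R, is_derive x 1 h (dh x)) ->
  expgrow1 h -> expgrow1 dh -> E1 (fun x => dh x - x * h x) = 0.
Proof.
move=> hd eh edh.
pose F s := E1 (fun y => h (y + s) * expR (- (s * y + s ^+ 2 / 2))).
have Fcst : F = cst (F 0).
  by apply/funext => s; rewrite /F /= -!(E1_shift _ eh).
pose f s y := h (y + s) * expR (- (s * y + s ^+ 2 / 2)).
have fd s y : is_derive s 1 (f^~ y)
    ((dh (y + s) - (y + s) * h (y + s)) * expR (- (s * y + s ^+ 2 / 2))).
  have d1 : is_derive s 1 (cst y + id) (0 + 1 : R) by exact: is_deriveD.
  have d2 := @is_derive1_comp R h (cst y + id) s _ _ (hd _) d1.
  have d3 : is_derive s 1 (fun s : R => - (s * y + s ^+ 2 / 2)) (- (y + s)).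
    by apply: is_derive_eq; rewrite /GRing.scale/=; lra.
  have d4 := @is_derive1_comp R expR (fun s : R => - (s * y + s ^+ 2 / 2)) s _ _
    (is_derive_expR _) d3.
  have d5 := is_deriveM d2 d4.
  by apply: (is_derive_eq d5); rewrite /GRing.scale/=; ring.
pose df (s y : R) := (dh (y + s) - (y + s) * h (y + s)) * expR (- (s * y + s ^+ 2 / 2)).
have fd' : forall s y : R, is_derive s 1 (f^~ y) (df s y) by exact: fd.
case: (eh) => ch [C [c [C0 c0 hC]]]; case: (edh) => cdh [D [d [D0 d0 hD]]].
pose G (y : R) := (C + D) * expR (c + d) * 2 * expR ((c + d + 2) * `|y|).
have G0 y : 0 <= G y by rewrite !mulr_ge0 ?expR_ge0// addr_ge0.
have cd0 : 0 <= c + d by exact: addr_ge0.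
have eG : expgrow1 G.
  split.
    by move=> x; apply: cvgM; [exact: cvg_cst|exact: continuous_expR_norm].
  exists ((C + D) * expR (c + d) * 2), (c + d + 2); split.
  - by rewrite !mulr_ge0 ?expR_ge0// addr_ge0.
  - by rewrite addr_ge0.
  - by move=> t; rewrite ger0_norm.
have Gub s y : `|s - 0| < 1 -> `|df s y| <= G y.
  rewrite subr0 => s1; rewrite /df /G.
  exact: (stein_domination y C0 c0 D0 d0 hC hD s1).
have ef s : expgrow1 (f s).
  by apply: expgrow1M; [exact: (expgrow1_shift _ eh)|exact: expgrow1_CM].
have FE : F = (fun u => E1 (f u)) by [].
have df0 : df 0 = (fun x => dh x - x * h x).
  apply/funext => y; rewrite /df (_ : - (0 * y + 0 ^+ 2 / 2) = 0); last by ring.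
  by rewrite expR0 mulr1 addr0.
clearbody f df F G.
have := is_derive_E1 fd' ef eG Gub.
rewrite -FE Fcst df0 => h1; have h2 := is_derive_cst (F 0) (0 : R) 1.
by rewrite -(@derive_val _ _ _ _ _ _ _ h1) (@derive_val _ _ _ _ _ _ _ h2).
Qed.

Lemma E1_id : E1 (fun x : R => x) = 0.
Proof.
have := E1_oppr (@expgrow1_id R).
have -> : E1 (fun x => - x) = - E1 (fun x => x).
  rewrite -mulN1r -E1Z; last exact: expgrow1_id.
  by apply: eq_Rintegral => x _; rewrite mulN1r.
lra.
Qed.

Lemma E1_sqr : E1 (fun x : R => x * x) = 1.
Proof.
have ei := @expgrow1_id R; have ec := @expgrow1_cst R 1.
have := @E1_stein id (cst 1) (fun x => is_derive_id x 1) ei ec.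
have -> : E1 (fun x => cst 1 x - x * id x) = 1 - E1 (fun x => x * x).
  rewrite -[X in X - _](E1_cst 1) -[X in _ - X]mul1r -mulNr -E1Z; last exact: expgrow1M.
  rewrite -E1D//; first by apply: eq_Rintegral => x _; rewrite mulN1r.
  by apply: expgrow1M; [exact: expgrow1_cst|exact: expgrow1M].
lra.
Qed.

Lemma continuous_cos_lin s c : continuous (fun x : R => cos (s * x + c)).
Proof.
move=> x; apply: continuous_comp; last exact: continuous_cos.
by apply: cvgD; [apply: cvgM; [exact: cvg_cst|exact: cvg_id]|exact: cvg_cst].
Qed.

Lemma expgrow1_cos s c : expgrow1 (fun x : R => cos (s * x + c)).
Proof.
by apply: (@expgrow1_bounded _ _ 1) => [|x]; [exact: continuous_cos_lin|exact: cos_max].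
Qed.

Lemma expgrow1_sin s : expgrow1 (fun x : R => sin (s * x)).
Proof.
have := expgrow1_cos s (- (pi / 2)).
by under eq_fun do rewrite cosBpihalf.
Qed.

(** Stein's identity for sin(u x) shows that the characteristic function satisfies c' = -u c; hence
    c(u) e^(u^2/2) is constant. *)
Lemma E1_cos0 s : E1 (fun x => cos (s * x)) = expR (- s ^+ 2 / 2).
Proof.
pose f s x := cos (s * x : R).
have ec (u : R) : expgrow1 (fun x => cos (u * x)).
  by have := expgrow1_cos u 0; under eq_fun do rewrite addr0.
have linD (u x : R) : is_derive x 1 (fun x : R => u * x) u.
  by apply: is_derive_eq; rewrite /GRing.scale/= mulr1.
have linD' (u x : R) : is_derive u 1 (fun u : R => u * x) x.
  rewrite (_ : (fun u : R => u * x) = (fun u : R => x * u)); first exact: linD.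
  by apply/funext => z; rewrite mulrC.
have fd (u y : R) : is_derive u 1 (f^~ y) (- sin (u * y) * y).
  exact: (@is_derive1_comp R cos (fun u => u * y) u _ _ (is_derive_cos _) (linD' _ _)).
pose c u := E1 (f u).
have cd (u : R) : is_derive u 1 c (- u * c u).
  have en := expgrow1_norm (@expgrow1_id R).
  have Gub v y : `|v - u| < 1 -> `|- sin (v * y) * y| <= `|y|.
    by move=> _; rewrite normrM normrN ler_piMl// sin_max.
  apply: (is_derive_eq (is_derive_E1 fd ec en Gub)).
  have es := expgrow1_sin u; have ei := @expgrow1_id R.
  have eu := expgrow1M (@expgrow1_cst R u) (ec u).
  have sd (x : R) : is_derive x 1 (fun x => sin (u * x)) (u * cos (u * x)).
    rewrite mulrC.
    exact: (@is_derive1_comp R sin (fun x => u * x) x _ _ (is_derive_sin _) (linD _ _)).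
  have ems := expgrow1M ei es.
  have eNms := expgrow1M (@expgrow1_cst R (-1)) ems.
  have st := E1_stein sd es eu.
  have e1 : E1 (fun x => u * cos (u * x) - x * sin (u * x)) =
      u * c u + (-1) * E1 (fun y => y * sin (u * y)).
    rewrite /c -(E1Z u (ec u)) -(E1Z (-1) ems) -E1D//.
    by apply: eq_Rintegral => x _; rewrite mulN1r.
  have -> : E1 (fun y => - sin (u * y) * y) = (-1) * E1 (fun y => y * sin (u * y)).
    by rewrite -E1Z//; apply: eq_Rintegral => y _; ring.
  by move: e1; rewrite st; lra.
pose F u := c u * expR (u ^+ 2 / 2).
have Fd (u : R) : is_derive u 1 F 0.
  have d3 : is_derive u 1 (fun s : R => s ^+ 2 / 2) u.
    by apply: is_derive_eq; rewrite /GRing.scale/=; lra.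
  have d4 := @is_derive1_comp R expR (fun s : R => s ^+ 2 / 2) u _ _
    (is_derive_expR _) d3.
  have d5 := is_deriveM (cd u) d4.
  by apply: (is_derive_eq d5); rewrite /GRing.scale/=; ring.
have c0 : c 0 = 1.
  transitivity (E1 (fun=> 1)); last exact: E1_cst.
  apply: eq_Rintegral => x _.
  by rewrite /f mul0r cos0.
have := @is_derive_0_is_cst R F s 0 Fd.
rewrite /F c0 (_ : expR (0 ^+ 2 / 2) = 1); last by rewrite expr0n mul0r expR0.
move=> h; apply: (@mulIf _ (expR (s ^+ 2 / 2))); first by rewrite gt_eqF ?expR_gt0.
by rewrite -expRD mulNr addNr expR0 -[RHS]mulr1 -h.
Qed.

(* Only the even part of [cos (s * x + c)] contributes. *)
Lemma E1_cos s c : E1 (fun x => cos (s * x + c)) = expR (- s ^+ 2 / 2) * cos c.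
Proof.
have e1 := expgrow1_sin s.
have ec : expgrow1 (fun x => cos (s * x)).
  by have := expgrow1_cos s 0; under eq_fun do rewrite addr0.
have s0 : E1 (fun x => sin (s * x)) = 0.
  have := E1_oppr e1.
  have -> : E1 (fun x => sin (s * - x)) = (-1) * E1 (fun x => sin (s * x)).
    by rewrite -E1Z//; apply: eq_Rintegral => x _; rewrite mulrN sinN mulN1r.
  lra.
transitivity (E1 (fun x => cos c * cos (s * x) + - sin c * sin (s * x))).
  by apply: eq_Rintegral => x _; rewrite cosD; ring.
rewrite E1D; [|exact: expgrow1M (expgrow1_cst _) ec|exact: expgrow1M (expgrow1_cst _) e1].
by rewrite !E1Z// s0 mulr0 addr0 E1_cos0 mulrC.
Qed.

Lemma E1_dct (f_ : nat -> R -> R) f (C c : R) : 0 <= c -> expgrow1 f ->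
  (forall m, continuous (f_ m)) ->
  (forall m x, `|f_ m x| <= C * expR (c * `|x|)) ->
  (forall x, f_ ^~ x @ \oo --> f x) ->
  (fun m => E1 (f_ m)) @ \oo --> E1 f.
Proof.
move=> c0 ef cf fC ff.
apply: fine_cvg; rewrite fineK; last first.
  by apply: integrable_fin_num => //; exact: expgrow1_integrable.
apply: (@dominated_cvg _ _ _ N setT measurableT (fun m x => (f_ m x)%:E)
  (fun x => (f x)%:E) (fun x => (C%:E * (expR (c * `|x|))%:E)%E)) => //.
- by move=> m; exact: continuous_measurable_EFin.
- by move=> x _; apply/fine_cvgP; split; [exact: nearW|exact: ff].
- by apply: integrableZl => //; exact: gaussian_integrable_expR_norm.
- by move=> m x _; rewrite lee_fin.
Qed.

End StdGaussianMoments.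

(** * Gaussian vectors *)

Lemma cvg_sumr (R : realType) (T I : Type) (F : set_system T) (s : seq I)
  (u : I -> T -> R) (l : I -> R) : Filter F ->
  (forall i, u i @ F --> l i) ->
  (fun t => \sum_(i <- s) u i t) @ F --> \sum_(i <- s) l i.
Proof.
move=> FF ul; elim: s => [|i s IH].
  by rewrite big_nil; under eq_fun do rewrite big_nil; exact: cvg_cst.
by rewrite big_cons; under eq_fun do rewrite big_cons; exact: cvgD.
Qed.

Section IteratedGaussian.
Context {R : realType}.
Local Notation N := (normal_prob (0 : R) 1).
Local Notation E1 f := (\int[normal_prob (0 : R) 1]_(t in setT) f t)%R.
Implicit Types (F G : (nat -> R) -> R) (g : nat -> R) (k K : nat).

(** Convertible to the update inside [stdgauss_iter], so that [stdgauss_iterS] holds by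
    computation. *)
Definition upd g k (t : R) : nat -> R := fun j => if j == k then t else g j.

(** Continuity along sequences converging coordinatewise: this is the form that dominated
    convergence passes on from an integrand to its partial integral. *)
Definition seqcont F := forall (g_ : nat -> nat -> R) g,
  (forall j, (fun m => g_ m j) @ \oo --> g j) -> (fun m => F (g_ m)) @ \oo --> F g.

Definition wexp K (c : R) g : R := expR (c * \sum_(j < K) `|g j|).

(** [K] stays fixed while the number of integrated coordinates varies: the weight keeps all [K]
    coordinates, also those already integrated. *)
Definition expgrow K F := seqcont F /\
  exists C c : R, [/\ 0 <= C, 0 <= c & forall g, `|F g| <= C * wexp K c g].

Lemma stdgauss_iterS k F g :
  stdgauss_iter k.+1 F g = E1 (fun t => stdgauss_iter k F (upd g k t)).
Proof. by []. Qed.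

Lemma wexp_ge0 K c g : 0 <= wexp K c g.
Proof. exact: expR_ge0. Qed.

Lemma wexp_upd K c g k t : 0 <= c ->
  wexp K c (upd g k t) <= wexp K c g * expR (c * `|t|).
Proof.
move=> c0; rewrite -expRD ler_expR -mulrDr ler_wpM2l//.
have h (j : 'I_K) : `|upd g k t j| <= `|g j| + (if (j == k :> nat) then `|t| else 0).
  by rewrite /upd; case: eqP => _; rewrite ?lerDr ?addr0.
apply: (le_trans (ler_sum _ (fun j _ => h j))).
rewrite big_split/= lerD2l -big_mkcond/=.
have [kK|Kk] := ltnP k K; last first.
  rewrite big1 ?normr_ge0// => j /eqP jk.
  by have := ltn_ord j; rewrite jk ltnNge Kk.
by rewrite (big_pred1 (Ordinal kK)).
Qed.

Lemma seqcont_upd F g k : seqcont F -> continuous (fun t => F (upd g k t)).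
Proof.
move=> cF t; apply/continuous_withinNx; apply/cvgr_dnbhsP => u [_ ut].
apply: (cF (fun m => upd g k (u m))) => j; rewrite /upd.
by case: eqP => _; [exact: ut|exact: cvg_cst].
Qed.

Lemma expgrow_upd K F g k : expgrow K F -> expgrow1 (fun t => F (upd g k t)).
Proof.
move=> [cF [C [c [C0 c0 FC]]]]; split; first exact: seqcont_upd.
exists (C * wexp K c g), c; split; rewrite ?mulr_ge0 ?wexp_ge0// => t.
by rewrite -mulrA (le_trans (FC _))// ler_wpM2l// wexp_upd.
Qed.

Lemma cvg_seq_ub (u : R^nat) (l : R) : u @ \oo --> l -> exists B, forall m, u m <= B.
Proof.
move=> ul; have /cvg_seq_bounded [B [_ hB]] : cvgn u by apply/cvg_ex; exists l.
exists (B + 1) => m; apply: le_trans (ler_norm _) _.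
by apply: (hB (B + 1)); rewrite ?ltrDl.
Qed.

Definition gauss_expnorm (c : R) : R := E1 (fun t => expR (c * `|t|)).

Lemma expgrow1_expnorm (c : R) : 0 <= c -> expgrow1 (fun t : R => expR (c * `|t|)).
Proof.
move=> c0; split; first exact: continuous_expR_norm.
by exists 1, c; split => // t; rewrite mul1r ger0_norm ?expR_ge0.
Qed.

Lemma gauss_expnorm_ge0 c : 0 <= gauss_expnorm c.
Proof. by apply: Rintegral_ge0 => t _; exact: expR_ge0. Qed.

Lemma E1_norm_le (f : R -> R) (C c : R) : 0 <= c -> expgrow1 f ->
  (forall t, `|f t| <= C * expR (c * `|t|)) -> `|E1 f| <= C * gauss_expnorm c.
Proof.
move=> c0 ef fC; apply: le_trans (le_normr_Rintegral _ _) _ => //.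
  exact: expgrow1_integrable.
rewrite /gauss_expnorm -E1Z; last exact: expgrow1_expnorm.
apply: E1_le => //; first exact: expgrow1_norm.
by apply: expgrow1M; [exact: expgrow1_cst|exact: expgrow1_expnorm].
Qed.

(** Continuity and growth share one induction, because continuity of the next partial integral is
    dominated convergence under the growth bound of the previous one. The constant depends on [C],
    [c] and [k] alone, hence is uniform along a sequence of integrands. *)
Lemma stdgauss_iter_bound k K F (C c : R) : 0 <= C -> 0 <= c -> seqcont F ->
  (forall g, `|F g| <= C * wexp K c g) ->
  seqcont (stdgauss_iter k F) /\
  forall g, `|stdgauss_iter k F g| <= C * gauss_expnorm c ^+ k * wexp K c g.
Proof.
move=> C0 c0 cF FC; elim: k => [|k [cI IC]]; first by split=> // g; rewrite expr0 mulr1.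
have CM0 : 0 <= C * gauss_expnorm c ^+ k by rewrite mulr_ge0 ?exprn_ge0 ?gauss_expnorm_ge0.
have eI : expgrow K (stdgauss_iter k F).
  by split => //; exists (C * gauss_expnorm c ^+ k), c; split.
have ub g t : `|stdgauss_iter k F (upd g k t)| <=
    C * gauss_expnorm c ^+ k * wexp K c g * expR (c * `|t|).
  by rewrite (le_trans (IC _))// -[leRHS]mulrA ler_wpM2l// wexp_upd.
split=> [g_ g gg|g].
(* Along a convergent sequence the weights are bounded, which provides one dominating function. *)
- have [B wB] : exists B, forall m, wexp K c (g_ m) <= B.
    apply: (@cvg_seq_ub _ (wexp K c g)); apply: continuous_cvg.
      exact: continuous_expR.
    apply: cvgM; first exact: cvg_cst.
    by apply: cvg_sumr => j; apply: cvg_norm; exact: gg.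
  apply: (@E1_dct _ _ _ (C * gauss_expnorm c ^+ k * B) c c0).
  + exact: expgrow_upd eI.
  + by move=> m; exact: seqcont_upd.
  + move=> m t; apply: (le_trans (ub _ _)); apply: ler_wpM2r; first exact: expR_ge0.
    by apply: ler_wpM2l => //; exact: wB.
  + move=> t; apply: cI => j; rewrite /upd.
    by case: eqP => _; [exact: cvg_cst|exact: gg].
- rewrite stdgauss_iterS exprSr mulrA mulrAC.
  by apply: E1_norm_le => //; exact: expgrow_upd eI.
Qed.

Lemma expgrow_iter k K F : expgrow K F -> expgrow K (stdgauss_iter k F).
Proof.
move=> [cF [C [c [C0 c0 FC]]]].
have [h1 h2] := stdgauss_iter_bound k C0 c0 cF FC.
split => //; exists (C * gauss_expnorm c ^+ k), c; split => //.
by rewrite mulr_ge0 ?exprn_ge0 ?gauss_expnorm_ge0.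
Qed.

Lemma expgrow_iter_upd k K F g : expgrow K F ->
  expgrow1 (fun t => stdgauss_iter k F (upd g k t)).
Proof. by move=> eF; apply: (@expgrow_upd K); exact: expgrow_iter. Qed.

Lemma eq_stdgauss_iter k F G g : F =1 G ->
  stdgauss_iter k F g = stdgauss_iter k G g.
Proof. by move=> FG; congr (stdgauss_iter k _ g); exact/funext. Qed.

Lemma stdgauss_iterD k K F G g : expgrow K F -> expgrow K G ->
  stdgauss_iter k (fun g => F g + G g) g = stdgauss_iter k F g + stdgauss_iter k G g.
Proof.
move=> eF eG; elim: k g => // k IH g; rewrite !stdgauss_iterS.
rewrite -E1D; [|exact: expgrow_iter_upd eF|exact: expgrow_iter_upd eG].
by apply: eq_Rintegral => t _; rewrite IH.
Qed.

Lemma stdgauss_iterZ k K F (c : R) g : expgrow K F ->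
  stdgauss_iter k (fun g => c * F g) g = c * stdgauss_iter k F g.
Proof.
move=> eF; elim: k g => // k IH g; rewrite !stdgauss_iterS.
rewrite -E1Z; last exact: expgrow_iter_upd eF.
by apply: eq_Rintegral => t _; rewrite IH.
Qed.

Lemma stdgauss_iter_cst k (c : R) g : stdgauss_iter k (fun=> c) g = c.
Proof.
elim: k g => // k IH g; rewrite stdgauss_iterS -[RHS](E1_cst c).
by apply: eq_Rintegral => t _; rewrite IH.
Qed.

Lemma stdgauss_iter_le k K F G g : expgrow K F -> expgrow K G ->
  (forall g, F g <= G g) -> stdgauss_iter k F g <= stdgauss_iter k G g.
Proof.
move=> eF eG FG; elim: k g => // k IH g; rewrite !stdgauss_iterS.
by apply: E1_le => [||t]; [exact: expgrow_iter_upd eF|exact: expgrow_iter_upd eG|].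
Qed.

Lemma stdgauss_iter_dct k K (F_ : nat -> (nat -> R) -> R) F (C c : R) g :
  0 <= C -> 0 <= c -> expgrow K F -> (forall m, seqcont (F_ m)) ->
  (forall m g, `|F_ m g| <= C * wexp K c g) ->
  (forall g, (fun m => F_ m g) @ \oo --> F g) ->
  (fun m => stdgauss_iter k (F_ m) g) @ \oo --> stdgauss_iter k F g.
Proof.
move=> C0 c0 eF cF FC FF; elim: k g => [|k IH] g; first exact: FF.
apply: (@E1_dct _ (fun m t => stdgauss_iter k (F_ m) (upd g k t))
  (fun t => stdgauss_iter k F (upd g k t))
  (C * gauss_expnorm c ^+ k * wexp K c g) c c0).
- exact: expgrow_iter_upd eF.
- move=> m; apply: seqcont_upd.
  by have [] := stdgauss_iter_bound k C0 c0 (cF m) (FC m).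
- move=> m t; have [_ h] := stdgauss_iter_bound k C0 c0 (cF m) (FC m).
  rewrite (le_trans (h _))// -[leRHS]mulrA; apply: ler_wpM2l; last exact: wexp_upd.
  by rewrite mulr_ge0 ?exprn_ge0 ?gauss_expnorm_ge0.
- by move=> t; exact: IH.
Qed.

Lemma stdgauss_iterMl k K F (a : (nat -> R) -> R) g : expgrow K F ->
  (forall g j t, (j < k)%N -> a (upd g j t) = a g) ->
  stdgauss_iter k (fun g => a g * F g) g = a g * stdgauss_iter k F g.
Proof.
move=> eF; elim: k g => // k IH g ak; rewrite !stdgauss_iterS.
rewrite -E1Z; last exact: expgrow_iter_upd eF.
apply: eq_Rintegral => t _; rewrite IH ?ak// => g' j s jk.
by apply: ak; exact: ltnW.
Qed.

Lemma stdgauss_iter_comp k F (phi : (nat -> R) -> nat -> R) g :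
  (forall g j t, (j < k)%N -> phi (upd g j t) = upd (phi g) j t) ->
  stdgauss_iter k F (phi g) = stdgauss_iter k (F \o phi) g.
Proof.
elim: k g => // k IH g phik; rewrite !stdgauss_iterS.
apply: eq_Rintegral => t _; rewrite -phik// IH// => g' j s jk.
by apply: phik; exact: ltnW.
Qed.

Lemma stdgauss_iter_oppr k K F g : expgrow K F ->
  stdgauss_iter k F (- g) = stdgauss_iter k (fun g => F (- g)) g.
Proof.
move=> eF; elim: k g => // k IH g; rewrite !stdgauss_iterS.
rewrite E1_oppr; last exact: expgrow_iter_upd eF.
apply: eq_Rintegral => t _; rewrite -IH; congr stdgauss_iter.
by apply/funext => j; rewrite /upd !fctE; case: eqP.
Qed.

Lemma expgrow_coord K (h : nat -> R -> R) : (forall j, expgrow1 (h j)) ->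
  expgrow K (fun g => \prod_(j < K) h j (g j)).
Proof.
move=> eh; split.
  move=> g_ g gg; elim: K => [|K IH].
    by rewrite big_ord0; under eq_fun do rewrite big_ord0; exact: cvg_cst.
  rewrite big_ord_recr/=; under eq_fun do rewrite big_ord_recr/=.
  apply: cvgM; first exact: IH.
  by apply: continuous_cvg; [case: (eh K) => + _; exact|exact: gg].
elim: K => [|K [C [c [C0 c0 hC]]]].
  by exists 1, 0; split => // g; rewrite /wexp !big_ord0 mulr0 expR0 mulr1 normr1.
have [_ [D [d [D0 d0 hD]]]] := eh K.
exists (C * D), (c + d); split; rewrite ?mulr_ge0 ?addr_ge0// => g.
rewrite big_ord_recr/= normrM.
have -> : C * D * wexp K.+1 (c + d) g = (C * wexp K c g) * (D * expR (d * `|g K|)) *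
    (expR (d * \sum_(j < K) `|g j|) * expR (c * `|g K|)).
  rewrite /wexp big_ord_recr/= -!mulrA; congr (_ * _).
  rewrite mulrCA; congr (_ * _); rewrite -!expRD; congr expR; ring.
rewrite -[leLHS]mulr1; apply: ler_pM; rewrite ?mulr_ge0//.
  exact: ler_pM.
rewrite -expRD -[leLHS]expR0 ler_expR addr_ge0 ?mulr_ge0//.
by apply: sumr_ge0.
Qed.

Lemma stdgauss_iter_prod k (h : nat -> R -> R) g : (forall j, expgrow1 (h j)) ->
  stdgauss_iter k (fun g => \prod_(j < k) h j (g j)) g = \prod_(j < k) E1 (h j).
Proof.
move=> eh; elim: k g => [|k IH] g; first by rewrite /= !big_ord0.
rewrite stdgauss_iterS big_ord_recr/= -E1Z//.
apply: eq_Rintegral => t _.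
transitivity (stdgauss_iter k (fun g => h k (g k) * \prod_(j < k) h j (g j)) (upd g k t)).
  by apply: eq_stdgauss_iter => g'; rewrite big_ord_recr/= mulrC.
rewrite (@stdgauss_iterMl k k _ (fun g => h k (g k))).
- by rewrite IH /upd eqxx mulrC.
- exact: expgrow_coord.
- by move=> g' j s jk; rewrite /upd gtn_eqF.
Qed.

End IteratedGaussian.

(** * Translation and characteristic function of iterated Gaussian integrals *)

Section IteratedGaussianFormulas.
Context {R : realType}.
Local Notation E1 f := (\int[normal_prob (0 : R) 1]_(t in setT) f t)%R.
Implicit Types (F G : (nat -> R) -> R) (g s : nat -> R) (k K : nat).

Lemma expgrowM K F G : expgrow K F -> expgrow K G -> expgrow K (fun g => F g * G g).
Proof.
move=> [cF [C [c [C0 c0 FC]]]] [cG [D [d [D0 d0 GD]]]]; split.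
  by move=> g_ g gg; apply: cvgM; [exact: cF|exact: cG].
exists (C * D), (c + d); split; [exact: mulr_ge0|exact: addr_ge0|] => g.
by rewrite /wexp normrM mulrDl expRD mulrACA ler_pM.
Qed.

Lemma expgrow_widen k K F : (k <= K)%N -> expgrow k F -> expgrow K F.
Proof.
move=> kK [cF [C [c [C0 c0 FC]]]]; split => //; exists C, c; split => // g.
apply: (le_trans (FC g)); rewrite ler_wpM2l// ler_expR ler_wpM2l//.
rewrite -(subnKC kK) big_split_ord/= lerDl.
by apply: sumr_ge0.
Qed.

Definition shiftn s k g : nat -> R := fun j => if (j < k)%N then g j + s j else g j.

Lemma expgrow_shiftn k K F s : expgrow K F -> expgrow K (fun g => F (shiftn s k g)).
Proof.
move=> [cF [C [c [C0 c0 FC]]]]; split.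
  move=> g_ g gg; apply: cF => j; rewrite /shiftn.
  by case: ifP => _; [apply: cvgD; [exact: gg|exact: cvg_cst]|exact: gg].
exists (C * expR (c * \sum_(j < K) `|s j|)), c.
split; rewrite ?mulr_ge0 ?expR_ge0// => g.
apply: (le_trans (FC _)); rewrite -mulrA ler_wpM2l// -expRD ler_expR -mulrDr ler_wpM2l//.
rewrite -big_split/=; apply: ler_sum => j _; rewrite /shiftn.
by case: ifP => _; [rewrite addrC ler_normD|rewrite lerDr].
Qed.

Lemma stdgauss_iter_shift k K F s g : (k <= K)%N -> expgrow K F ->
  stdgauss_iter k F g = stdgauss_iter k (fun g => F (shiftn s k g) *
    \prod_(j < k) expR (- (s j * g j + s j ^+ 2 / 2))) g.
Proof.
move=> kK eF; elim: k kK g => [|k IH] kK g.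
  by rewrite /= big_ord0 mulr1; congr F; apply/funext => j; rewrite /shiftn ltn0.
pose e j (t : R) := expR (- (s j * t + s j ^+ 2 / 2)).
(* Shift of coordinate [k] alone. It commutes with updates of the lower coordinates, so it can be
   moved inside the inner integral; written as a [shiftn] below, it preserves the growth class. *)
pose phi g' : nat -> R := fun j => if j == k then g' j + s k else g' j.
have ee j : expgrow1 (e j) by exact: expgrow1_CM.
rewrite !stdgauss_iterS (E1_shift (s k)); last exact: expgrow_iter_upd eF.
apply: eq_Rintegral => t _.
have -> : upd g k (t + s k) = phi (upd g k t).
  by apply/funext => j; rewrite /phi /upd; case: eqP.
rewrite IH; last exact: ltnW.
rewrite stdgauss_iter_comp; last first.
  move=> g' j u jk; apply/funext => i; rewrite /phi /upd.
  by case: (eqVneq i j) => // ->; rewrite ltn_eqF.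
pose Fk g' := F (shiftn s k g') * \prod_(j < k) e j (g' j).
have phiE : phi = shiftn (fun j => if j == k then s k else 0) K.
  apply/funext => g'; apply/funext => j; rewrite /phi /shiftn.
  by case: (eqVneq j k) => [->|]; [rewrite kK|rewrite addr0 if_same].
have eFk : expgrow K (Fk \o phi).
  rewrite phiE; apply: (@expgrow_shiftn K K Fk).
  apply: expgrowM; first exact: expgrow_shiftn.
  by apply: (expgrow_widen (ltnW kK)); exact: expgrow_coord.
rewrite mulrC.
transitivity (e k (upd g k t k) * stdgauss_iter k (Fk \o phi) (upd g k t)).
  by rewrite {2}/upd eqxx.
rewrite -(@stdgauss_iterMl _ k K (Fk \o phi) (fun g' => e k (g' k)))//; last first.
  by move=> g' j u jk; rewrite /upd gtn_eqF.
apply: eq_stdgauss_iter => g' /=.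
rewrite big_ord_recr/= mulrA mulrC /Fk; congr (_ * _ * _); last first.
  by apply: eq_bigr => j _; rewrite /phi ltn_eqF.
congr F; apply/funext => j; rewrite /shiftn /phi [(j < k.+1)%N]ltnS [(j <= k)%N]leq_eqVlt.
by case: (eqVneq j k) => [->|]; rewrite ?ltnn.
Qed.

(** The phase is a function [b] rather than a constant because the induction absorbs the outer term
    a_k g_k into it; the inner integrals see it as constant. *)
Lemma stdgauss_iter_cos k (a : nat -> R) (b : (nat -> R) -> R) g :
  seqcont b -> (forall g j t, (j < k)%N -> b (upd g j t) = b g) ->
  stdgauss_iter k (fun g => cos (\sum_(j < k) a j * g j + b g)) g =
  expR (- (\sum_(j < k) a j ^+ 2) / 2) * cos (b g).
Proof.
elim: k b g => [|k IH] b g cb bk.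
  by rewrite /= !big_ord0 add0r oppr0 mul0r expR0 mul1r.
rewrite stdgauss_iterS.
transitivity (E1 (fun t => expR (- (\sum_(j < k) a j ^+ 2) / 2) * cos (a k * t + b g))).
  apply: eq_Rintegral => t _.
  transitivity (stdgauss_iter k (fun g => cos (\sum_(j < k) a j * g j + (a k * g k + b g)))
     (upd g k t)).
    by apply: eq_stdgauss_iter => g'; rewrite big_ord_recr/= addrA.
  rewrite (IH (fun g => a k * g k + b g)).
  - by rewrite bk// /upd eqxx.
  - move=> g_ g' gg; apply: cvgD; last exact: cb.
    by apply: cvgM; [exact: cvg_cst|exact: gg].
  - by move=> g' j u jk; rewrite (bk _ _ _ (ltnW jk)) /upd gtn_eqF.
rewrite E1Z; last exact: expgrow1_cos.
rewrite E1_cos mulrA -expRD big_ord_recr/=; congr (expR _ * _).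
by rewrite !mulNr -opprD -mulrDl.
Qed.

End IteratedGaussianFormulas.

(** * Expectations under Gaussian vectors *)

Section VectorGaussian.
Context {R : realType} {d : nat}.
Implicit Types (f h : 'cV[R]_d -> R) (v mu th : 'cV[R]_d) (L : 'M[R]_d).

Definition l1 v : R := \sum_j `|v j ord0|.

(** Vector form of [expgrow]; with the l1 norm the weight is a product over coordinates, as in
    [wexp]. *)
Definition admissible f := continuous f /\
  exists C c : R, [/\ 0 <= C, 0 <= c & forall v, `|f v| <= C * expR (c * l1 v)].

Definition dotv v th : R := \sum_j v j ord0 * th j ord0.

Lemma cvg_col (T : Type) (F : set_system T) (u : T -> 'cV[R]_d) v : Filter F ->
  (forall j, (fun t => u t j ord0) @ F --> v j ord0) -> u @ F --> v.
Proof.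
move=> FF uv A [P vP PA].
have h : \forall t \near F, forall j, P j ord0 (u t j ord0).
  by apply: filter_forall => j; exact: uv (vP j ord0).
by apply: filterS h => t Pt; apply: PA => i j; rewrite (ord1 j).
Qed.

Lemma admissibleD f h : admissible f -> admissible h -> admissible (fun v => f v + h v).
Proof.
move=> [cf [C [c [C0 c0 fC]]]] [ch [D [e [D0 e0 hD]]]]; split.
  by move=> v; exact: cvgD (cf v) (ch v).
have l0 v : 0 <= l1 v by exact: sumr_ge0.
exists (C + D), (c + e); split; rewrite ?addr_ge0// => v.
rewrite (le_trans (ler_normD _ _))// [leRHS]mulrDl lerD//.
  by rewrite (le_trans (fC v))// ler_wpM2l// ler_expR ler_wpM2r// lerDl.
by rewrite (le_trans (hD v))// ler_wpM2l// ler_expR ler_wpM2r// lerDr.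
Qed.

Lemma admissibleM f h : admissible f -> admissible h -> admissible (fun v => f v * h v).
Proof.
move=> [cf [C [c [C0 c0 fC]]]] [ch [D [e [D0 e0 hD]]]]; split.
  by move=> v; exact: cvgM (cf v) (ch v).
exists (C * D), (c + e); split; rewrite ?addr_ge0 ?mulr_ge0// => v.
by rewrite normrM mulrDl expRD mulrACA ler_pM.
Qed.

Lemma admissible_bounded f (M : R) : continuous f -> (forall v, `|f v| <= M) ->
  admissible f.
Proof.
move=> cf fM; split => //; exists M, 0; split => //; first exact: le_trans (fM 0).
by move=> v; rewrite mul0r expR0 mulr1.
Qed.

Lemma admissible_cst (c : R) : admissible (cst c).
Proof. by apply: (@admissible_bounded _ `|c|) => // v; exact: cst_continuous. Qed.

Lemma admissibleZ (c : R) f : admissible f -> admissible (fun v => c * f v).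
Proof. by move=> af; apply: admissibleM => //; exact: admissible_cst. Qed.

Lemma admissible_sum (I : Type) (s : seq I) (f_ : I -> 'cV[R]_d -> R) :
  (forall i, admissible (f_ i)) -> admissible (fun v => \sum_(i <- s) f_ i v).
Proof.
move=> af; elim: s => [|i s IH].
  by under eq_fun do rewrite big_nil; exact: admissible_cst.
by under eq_fun do rewrite big_cons; exact: admissibleD.
Qed.

Lemma admissible_coord (j : 'I_d) : admissible (fun v => v j ord0).
Proof.
split; first exact: coord_continuous.
exists 1, 1; split => // v; rewrite !mul1r.
apply: le_trans (_ : l1 v <= _).
  by rewrite /l1 (bigD1 j)//= lerDl sumr_ge0.
by apply: le_trans (expR_ge1Dx _); rewrite lerDr.
Qed.

Lemma admissible_dotv th : admissible (dotv th).
Proof. by apply: admissible_sum => j; apply: admissibleZ; exact: admissible_coord. Qed.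

Lemma admissible_norm f : admissible f -> admissible (fun v => `|f v|).
Proof.
move=> [cf [C [c [C0 c0 fC]]]]; split.
  by move=> v; apply: continuous_comp; [exact: cf|exact: norm_continuous].
by exists C, c; split => // v; rewrite normr_id.
Qed.

Lemma admissibleX f n : admissible f -> admissible (fun v => f v ^+ n).
Proof.
move=> af; elim: n => [|n IH]; first exact: (admissible_cst 1).
by under eq_fun do rewrite exprS; exact: admissibleM.
Qed.

Lemma admissible_affine mu L f : admissible f ->
  expgrow d (fun g => f (mu + L *m \col_(i < d) g i)).
Proof.
move=> [cf [C [c [C0 c0 fC]]]]; split.
  move=> g_ g gg; apply: continuous_cvg; first exact: cf.
  apply: cvg_col => j; rewrite !mxE; under eq_fun do rewrite !mxE.
  apply: cvgD; first exact: cvg_cst.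
  apply: cvg_sumr => i; rewrite mxE; under eq_fun do rewrite mxE.
  by apply: cvgM; [exact: cvg_cst|exact: gg].
pose B := \sum_j \sum_i `|L j i|.
have B0 : 0 <= B by apply: sumr_ge0 => j _; exact: sumr_ge0.
exists (C * expR (c * l1 mu)), (c * B); split; rewrite ?mulr_ge0 ?expR_ge0// => g.
apply: (le_trans (fC _)); rewrite -mulrA ler_wpM2l// -expRD ler_expR -mulrA -mulrDr.
rewrite ler_wpM2l// /l1 /B mulr_suml -big_split/=; apply: ler_sum => j _.
rewrite mxE (le_trans (ler_normD _ _))// lerD2l mxE (le_trans (ler_norm_sum _ _ _))//.
rewrite mulr_suml; apply: ler_sum => i _; rewrite mxE normrM ler_wpM2l//.
by rewrite (bigD1 i)//= lerDl sumr_ge0.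
Qed.

Lemma eq_gaussE mu L f h : f =1 h -> gaussE mu L f = gaussE mu L h.
Proof. by move=> fh; apply: eq_stdgauss_iter => g; rewrite fh. Qed.

Lemma gaussED mu L f h : admissible f -> admissible h ->
  gaussE mu L (fun v => f v + h v) = gaussE mu L f + gaussE mu L h.
Proof.
move=> af ah; exact: (stdgauss_iterD _ _ (admissible_affine _ _ af) (admissible_affine _ _ ah)).
Qed.

Lemma gaussEZ mu L f (c : R) : admissible f ->
  gaussE mu L (fun v => c * f v) = c * gaussE mu L f.
Proof. move=> af; exact: (stdgauss_iterZ _ _ _ (admissible_affine _ _ af)). Qed.

Lemma gaussE_cst mu L (c : R) : gaussE mu L (fun=> c) = c.
Proof. exact: stdgauss_iter_cst. Qed.

Lemma gaussE_sum mu L (I : Type) (s : seq I) (f_ : I -> 'cV[R]_d -> R) :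
  (forall i, admissible (f_ i)) ->
  gaussE mu L (fun v => \sum_(i <- s) f_ i v) = \sum_(i <- s) gaussE mu L (f_ i).
Proof.
move=> af; elim: s => [|i s IH].
  rewrite big_nil -[RHS](gaussE_cst mu L); apply: eq_gaussE => v; exact: big_nil.
rewrite big_cons -IH -gaussED//; last exact: admissible_sum.
by apply: eq_gaussE => v; exact: big_cons.
Qed.

Lemma gaussE_le mu L f h : admissible f -> admissible h -> (forall v, f v <= h v) ->
  gaussE mu L f <= gaussE mu L h.
Proof.
move=> af ah fh; apply: (@stdgauss_iter_le _ _ d); [exact: admissible_affine..|].
by move=> g; exact: fh.
Qed.

Lemma gaussE_dct mu L (f_ : nat -> 'cV[R]_d -> R) f h : admissible f -> admissible h ->
  (forall m, continuous (f_ m)) -> (forall m v, `|f_ m v| <= h v) ->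
  (forall v, f_ ^~ v @ \oo --> f v) ->
  (fun m => gaussE mu L (f_ m)) @ \oo --> gaussE mu L f.
Proof.
move=> af ah cf fh ff.
have [_ [C [c [C0 c0 hC]]]] := admissible_affine mu L ah.
apply: (@stdgauss_iter_dct _ _ d (fun m g => f_ m (mu + L *m \col_(i < d) g i))
  (fun g => f (mu + L *m \col_(i < d) g i)) C c) => //.
- exact: admissible_affine.
- move=> m; have am : admissible (f_ m).
    split; first exact: cf.
    case: ah => _ [D [e [D0 e0 hD]]]; exists D, e; split => // v.
    by rewrite (le_trans (fh _ _))// (le_trans (ler_norm _)).
  by have [] := admissible_affine mu L am.
- by move=> m g; rewrite (le_trans (fh _ _))// (le_trans (ler_norm _)).
Qed.

(** Only L L^T enters, so the factor chosen by [normal_covE] is immaterial; the phase [c] covers the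
    sine as well. *)
Lemma gaussE_cos L th (c : R) :
  gaussE 0 L (fun v => cos (dotv th v + c)) =
  expR (- (th^T *m (L *m L^T) *m th) ord0 ord0 / 2) * cos c.
Proof.
(* [insub] extends coefficients indexed by ['I_d] to the integer indices of [stdgauss_iter]; the
   default 0 is never read. *)
pose a (j : nat) : R := if insub j is Some j' then (L^T *m th) j' ord0 else 0.
rewrite /gaussE.
transitivity (stdgauss_iter d (fun g => cos (\sum_(j < d) a j * g j + c)) (fun=> 0)).
  apply: eq_stdgauss_iter => g; congr (cos (_ + _)).
  rewrite add0r /dotv.
  transitivity (\sum_j \sum_i th j ord0 * (L j i * g i)).
    apply: eq_bigr => j _; rewrite mxE mulr_sumr; apply: eq_bigr => i _.
    by rewrite mxE.
  rewrite exchange_big/=; apply: eq_bigr => i _.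
  rewrite /a valK mxE mulr_suml; apply: eq_bigr => j _.
  by rewrite mxE; ring.
rewrite (@stdgauss_iter_cos _ d a (fun=> c))//; last by move=> *; exact: cvg_cst.
congr (expR (- _ / 2) * _).
have -> : th^T *m (L *m L^T) *m th = (L^T *m th)^T *m (L^T *m th).
  by rewrite trmx_mul trmxK !mulmxA.
rewrite mxE; apply: eq_bigr => j _.
by rewrite /a valK [in RHS]mxE expr2.
Qed.

Lemma gaussE_oppr mu f : admissible f ->
  gaussE (- mu) 1%:M f = gaussE mu 1%:M (fun v => f (- v)).
Proof.
move=> af; rewrite /gaussE.
have h0 : (fun=> 0 : R) = - (fun=> 0 : R) :> (nat -> R).
  by apply/funext => j; rewrite fctE oppr0.
rewrite [in LHS]h0 (stdgauss_iter_oppr _ _ (admissible_affine (- mu) 1%:M af)).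
apply: eq_stdgauss_iter => g; congr f; rewrite !mul1mx.
by apply/colP => j; rewrite !mxE opprD fctE.
Qed.

Lemma gaussE_prod mu (h : 'I_d -> R -> R) : (forall j, expgrow1 (h j)) ->
  gaussE mu 1%:M (fun v => \prod_j h j (v j ord0)) =
  \prod_j (\int[normal_prob (0 : R) 1]_(t in setT) h j (t + mu j ord0))%R.
Proof.
move=> eh.
pose k (j : nat) (t : R) : R :=
  if insub j is Some j' then h j' (t + mu j' ord0) else 0.
have ek j : expgrow1 (k j).
  rewrite /k; case: insub => [j'|]; first exact: expgrow1_shift.
  exact: expgrow1_cst.
transitivity (stdgauss_iter d (fun g => \prod_(j < d) k j (g j)) (fun=> 0)).
  apply: eq_stdgauss_iter => g; apply: eq_bigr => j _.
  by rewrite /k valK mul1mx !mxE addrC.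
rewrite stdgauss_iter_prod//; apply: eq_bigr => j _.
by apply: eq_Rintegral => t _; rewrite /k valK.
Qed.

End VectorGaussian.

(** * Trigonometric Bernstein approximation *)

Section BernsteinWeights.
Context {R : realType}.
Implicit Types (p : R) (n k : nat).

(* The binomial weights C(n,k) p^k (1-p)^(n-k), by Pascal's recursion. *)
Fixpoint bweight p n k : R :=
  if n is n'.+1 then
    p * (if k is k'.+1 then bweight p n' k' else 0) + (1 - p) * bweight p n' k
  else (k == 0)%:R.

Lemma bweight_gt p n k : (n < k)%N -> bweight p n k = 0.
Proof.
elim: n k => [|n IH] [|k]//= nk; rewrite IH// IH ?mulr0 ?addr0//.
exact: ltnW.
Qed.

Lemma bweight_ge0 p n k : 0 <= p <= 1 -> 0 <= bweight p n k.
Proof.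
move=> /andP[p0 p1]; elim: n k => [|n IH] k /=; first exact: ler0n.
by rewrite addr_ge0// mulr_ge0 ?subr_ge0//; case: k.
Qed.

(** Conditioning on the last Bernoulli trial; total mass and variance follow from it by induction on
    n. *)
Lemma sum_bweightS p n (phi : nat -> R) :
  \sum_(k < n.+2) phi k * bweight p n.+1 k =
  \sum_(k < n.+1) (p * phi k.+1 + (1 - p) * phi k) * bweight p n k.
Proof.
transitivity (\sum_(k < n.+2) (p * (phi k * (if (k : nat) is k'.+1 then bweight p n k' else 0)))
    + \sum_(k < n.+2) ((1 - p) * (phi k * bweight p n k))).
  by rewrite -big_split/=; apply: eq_bigr => k _ /=; ring.
rewrite big_ord_recl/= !mulr0 add0r [X in _ + X]big_ord_recr/= bweight_gt// !mulr0 addr0.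
by rewrite -big_split/=; apply: eq_bigr => k _ /=; ring.
Qed.

Lemma sum_bweight p n : \sum_(k < n.+1) bweight p n k = 1.
Proof.
elim: n => [|n IH]; first by rewrite big_ord1.
have := sum_bweightS p n (fun=> 1).
under eq_bigr do rewrite mul1r.
move=> ->; rewrite -[RHS]IH; apply: eq_bigr => k _; ring.
Qed.

Lemma bweight_variance p n :
  \sum_(k < n.+1) (k%:R - n%:R * p) ^+ 2 * bweight p n k = n%:R * (p * (1 - p)).
Proof.
elim: n => [|n IH]; first by rewrite big_ord1/= !mul0r subr0 expr0n mul0r.
rewrite (sum_bweightS p n (fun k => (k%:R - n.+1%:R * p) ^+ 2)).
(* The cross terms cancel because the added trial is centred at p, and its variance p (1 - p)
   remains. *)
transitivity (\sum_(k < n.+1) ((k%:R - n%:R * p) ^+ 2 * bweight p n k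
    + p * (1 - p) * bweight p n k)).
  by apply: eq_bigr => k _; rewrite -!natr1; ring.
by rewrite big_split/= IH -mulr_sumr sum_bweight -natr1; ring.
Qed.

End BernsteinWeights.

Section UniformContinuity.
Context {R : realType} {d : nat}.

(** Only [v] has to lie in the box: the Bernstein nodes compared with it may fall outside.
    Compactness comes from [rV_compact], on row vectors, hence the transposes. *)
Lemma box_unif_continuous (f : 'cV[R]_d -> R) (B e : R) : continuous f -> 0 < e ->
  exists2 r : R, 0 < r & forall u v : 'cV[R]_d, (forall j, `|v j ord0| <= B) ->
    (forall j, `|u j ord0 - v j ord0| <= r) -> `|f u - f v| <= e.
Proof.
move=> cf e0.
pose D := [set v : 'rV[R]_d | forall j, v ord0 j \in `[(- B), B] ].
have cD : compact D.
  apply: (@rV_compact _ _ (fun=> `[(- B), B]%classic)) => _; exact: segment_compact.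
have cft : continuous (fun v : 'rV[R]_d => f v^T).
  move=> v; have vt : (fun u : 'rV[R]_d => u^T) @ nbhs v --> v^T.
    apply: cvg_col => j; rewrite mxE; under eq_fun do rewrite mxE.
    exact: coord_continuous.
  exact: cvg_comp vt (cf v^T).
have near_r : \forall r \near (0 : R)^'+, D `<=` (fun v => forall u : 'rV[R]_d,
    (forall j, `|u ord0 j - v ord0 j| <= r) -> `|f u^T - f v^T| <= e).
  apply: ((compact_near_coveringP D).1 cD R _ (fun r v => forall u : 'rV[R]_d,
    (forall j, `|u ord0 j - v ord0 j| <= r) -> `|f u^T - f v^T| <= e)) => x Dx.
  have e2 : 0 < e / 2 by rewrite divr_gt0.
  have /cvgrPdist_lt/(_ _ e2) := cft x.
  move=> /nbhs_ballP[s /= s0 xs].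
  have s2 : 0 < s / 2 by rewrite divr_gt0.
  exists ([set y | ball x (s / 2) y], [set r | r < s / 2]) => /=.
    split; first by apply: nbhsx_ballx.
    exact: nbhs_right_lt.
  move=> [y r]/= [[_ xy] rs] u uy.
  have h1 : `|f x^T - f y^T| < e / 2.
    apply: xs; split=> // i j; have := xy i j; rewrite /ball/= => xyj.
    by rewrite (lt_trans xyj)// ltr_pdivrMr// mulr_natr mulr2n ltrDl.
  have h2 : `|f x^T - f u^T| < e / 2.
    apply: xs; split=> // i j; have := xy i j; rewrite /ball/= (ord1 i) => xyj.
    rewrite -(subrK (y ord0 j) (x ord0 j)) -addrA (le_lt_trans (ler_normD _ _))//.
    rewrite [ltRHS]splitr ltrD// distrC (le_lt_trans (uy j))//.
  rewrite -(subrK (f x^T) (f u^T)) -addrA (le_trans (ler_normD _ _))//.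
  by rewrite [leRHS]splitr lerD// ltW// distrC.
have : \forall r \near (0 : R)^'+, 0 < r by exact: nbhs_right_gt.
move=> /(filterI near_r) /filter_ex [r [hr rgt0]].
exists r => // u v vB uv.
rewrite -(trmxK u) -(trmxK v); apply: (hr v^T _ u^T); rewrite /D/=.
- by move=> j; rewrite mxE in_itv/= -ler_norml.
- by move=> j; rewrite !mxE.
Qed.

End UniformContinuity.

(** * The tensor Bernstein operator and trigonometric polynomials *)

Section Bernstein.
Context {R : realType} {d : nat}.
Implicit Types (f h : 'cV[R]_d -> R) (v : 'cV[R]_d) (K : R).

(** Quantitative injectivity of the sine. By monotonicity it suffices to compare b with b + r, where
    the difference is 2 cos(b + r/2) sin(r/2); as |b| and r are at most pi/4, the midpoint satisfies
    |b + r/2| <= 3 pi/8. *)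
Lemma sin_gap (a b r : R) : `|b| <= pi / 4 -> `|a| <= pi / 2 -> 0 < r <= pi / 4 ->
  r <= `|a - b| -> 2 * (cos (3 * pi / 8) * sin (r / 2)) <= `|sin a - sin b|.
Proof.
have pi0 := @pi_gt0 R.
wlog ab : a b / b <= a.
  move=> H; have [/H//|/ltW ba hb ha hr rab] := leP b a.
  have := H (- a) (- b); rewrite !sinN !normrN lerN2 -!opprD !normrN.
  by apply.
move=> hb ha /andP[r0 r4]; rewrite ger0_norm ?subr_ge0// => rab.
move: ha hb; rewrite !ler_norml => /andP[a1 a2] /andP[b1 b2].
have e1 : b + r = (b + r / 2) + r / 2 by lra.
have e2 : b = (b + r / 2) - r / 2 by lra.
have s1 : sin (b + r) <= sin a.
  have [->|ne] := eqVneq (b + r) a; first by [].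
  apply: ltW; rewrite ltr_sin ?in_itv/=; [|by apply/andP; split; lra..].
  by rewrite lt_neqAle ne/=; lra.
have s2 : sin (b + r) - sin b = 2 * (cos (b + r / 2) * sin (r / 2)).
  by rewrite {1}e1 {2}e2 sinD sinB; ring.
have s3 : cos (3 * pi / 8) <= cos (b + r / 2).
  rewrite -(cos_norm (b + r / 2)).
  have hm : `|b + r / 2| <= 3 * pi / 8 by rewrite ler_norml; apply/andP; split; lra.
  have [->//|ne] := eqVneq `|b + r / 2| (3 * pi / 8).
  apply: ltW; rewrite ltr_cos ?in_itv/= ?normr_ge0/=; last by lra.
    by rewrite lt_neqAle ne.
  by rewrite (le_trans hm)//; lra.
have s4 : 0 <= sin (r / 2).
  by apply/ltW/sin_gt0_pihalf; apply/andP; split; lra.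
apply: (@le_trans _ _ (sin (b + r) - sin b)); last first.
  by apply: le_trans (ler_norm _); rewrite lerD2r.
by rewrite s2 ler_wpM2l// ler_wpM2r.
Qed.

Lemma sin_gap_ex (r : R) : 0 < r -> exists2 eta : R, 0 < eta & forall a b : R,
  `|b| <= pi / 4 -> - (pi / 2) <= a <= pi / 2 -> `|sin a - sin b| < 2 * eta ->
  `|a - b| < r.
Proof.
move=> r0; have pi0 := @pi_gt0 R; pose r' := Num.min r (pi / 4).
have r'0 : 0 < r' by rewrite lt_min r0/= divr_gt0.
have r'4 : r' <= pi / 4 by rewrite ge_min lexx orbT.
have r'r : r' <= r by rewrite ge_min lexx.
clearbody r'; exists (cos (3 * pi / 8) * sin (r' / 2)).
  apply: mulr_gt0; first by apply: cos_gt0_pihalf; apply/andP; split; lra.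
  by apply: sin_gt0_pihalf; apply/andP; split; lra.
move=> a b hb; rewrite -ler_norml => ha sab; rewrite ltNge; apply/negP => rab.
move: sab; apply/negP; rewrite -leNgt; apply: sin_gap => //; first by rewrite r'0.
exact: le_trans rab.
Qed.

(** Maps [-K, K] onto [-pi/4, pi/4], well inside the branch [-pi/2, pi/2] of [asin], as [sin_gap]
    requires of one of its two points. *)
Definition bscale K : R := pi / 4 / K.
Definition bparam K (x : R) : R := (1 + sin (bscale K * x)) / 2.
(** For 0 < n, 0 < K and k <= n, the point of [-2K, 2K] at which [bparam K] equals k/n. *)
Definition bnode K (n k : nat) : R := asin (2 * k%:R / n%:R - 1) / bscale K.

(* The tensor Bernstein operator in the variables (1 + sin (pi v_j / 4K)) / 2:
   a trigonometric polynomial that approximates f on [-K, K]^d and is bounded by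
   sup |f| on the whole space. *)
Definition bern K n f v : R :=
  \sum_(k : {ffun 'I_d -> 'I_n.+1})
    f (\col_j bnode K n (k j)) * \prod_j bweight (bparam K (v j ord0)) n (k j).

Lemma bparam01 K x : 0 <= bparam K x <= 1.
Proof.
rewrite /bparam; have := sin_le1 (bscale K * x); have := sin_geN1 (bscale K * x).
by move=> *; apply/andP; split; lra.
Qed.

Lemma sum_bweight_ffun (p : 'I_d -> R) n :
  \sum_(k : {ffun 'I_d -> 'I_n.+1}) \prod_j bweight (p j) n (k j) = 1.
Proof.
rewrite -(bigA_distr_bigA (fun j (k : 'I_n.+1) => bweight (p j) n k)).
by rewrite big1// => j _; exact: sum_bweight.
Qed.

Lemma sum_bweight_ffun_marg (p : 'I_d -> R) n (phi : nat -> R) i :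
  \sum_(k : {ffun 'I_d -> 'I_n.+1}) phi (k i) * \prod_j bweight (p j) n (k j) =
  \sum_(k < n.+1) phi k * bweight (p i) n k.
Proof.
pose F j (k : 'I_n.+1) := (if j == i then phi k else 1) * bweight (p j) n k.
transitivity (\sum_(k : {ffun 'I_d -> 'I_n.+1}) \prod_j F j (k j)).
  apply: eq_bigr => k _; rewrite big_split/=; congr (_ * _).
  by rewrite -big_mkcond big_pred1_eq.
rewrite -(bigA_distr_bigA F) (bigD1 i)//= [X in _ * X]big1 ?mulr1 /F.
  by apply: eq_bigr => k _; rewrite eqxx.
move=> j /negbTE ji; rewrite ji; under eq_bigr do rewrite mul1r.
exact: sum_bweight.
Qed.

Lemma prod_bweight_ge0 K n v (k : {ffun 'I_d -> 'I_n.+1}) :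
  0 <= \prod_j bweight (bparam K (v j ord0)) n (k j).
Proof. by apply: prodr_ge0 => j _; rewrite bweight_ge0// bparam01. Qed.

Lemma norm_bern_le K n f (M : R) v : (forall v, `|f v| <= M) -> `|bern K n f v| <= M.
Proof.
move=> fM; rewrite (le_trans (ler_norm_sum _ _ _))//.
rewrite -[leRHS]mulr1 -[X in _ <= _ * X](sum_bweight_ffun (fun j => bparam K (v j ord0)) n) mulr_sumr.
by apply: ler_sum => k _; rewrite normrM (ger0_norm (prod_bweight_ge0 _ _ _)) ler_wpM2r// prod_bweight_ge0.
Qed.

(** Bernstein's probabilistic argument: the weights are a product of binomial laws, and Chebyshev's
    inequality bounds the mass of the nodes far from [v]. *)
Lemma bern_approx K f (M e : R) : continuous f -> (forall v, `|f v| <= M) ->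
  0 < K -> 0 < e -> exists n0, forall n, (n0 <= n)%N -> forall v,
    (forall j, `|v j ord0| <= K) -> `|bern K n f v - f v| <= e.
Proof.
move=> cf fM K0 e0; have pi0 := @pi_gt0 R.
have w0 : 0 < bscale K by rewrite /bscale divr_gt0// divr_gt0.
have e2 : 0 < e / 2 by rewrite divr_gt0.
have [r r0 fr] := box_unif_continuous K cf e2.
have wr0 : 0 < bscale K * r by exact: mulr_gt0.
have [eta eta0 etaP] := sin_gap_ex wr0.
have M0 : 0 <= M by exact: le_trans (fM 0).
(* A squared deviation of at least eta^2, multiplied by [c], outweighs the trivial bound 2M. *)
have [c c0 cE] : exists2 c : R, 0 <= c & c * eta ^+ 2 = 2 * M.
  have eta2 : 0 < eta ^+ 2 by rewrite exprn_gt0.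
  exists (2 * M / eta ^+ 2); first by apply: divr_ge0; [exact: mulr_ge0|exact: ltW].
  by rewrite divfK// gt_eqF.
(* Each marginal variance is at most 1/n, so the d coordinates contribute at most c d / n in
   total. *)
pose n1 := (Num.trunc (c * d%:R / (e / 2))).+1.
have n1P : c * d%:R <= e / 2 * n1%:R.
  by rewrite [leRHS]mulrC -ler_pdivrMr// ltW// truncnS_gt.
exists n1 => n n1n v vK; have n0 : (0 : R) < n%:R by rewrite ltr0n (leq_trans _ n1n).
have nP : c * d%:R / n%:R <= e / 2.
  rewrite ler_pdivrMr// (le_trans n1P)//; apply: ler_wpM2l; first exact: ltW.
  by rewrite ler_nat.
clearbody n1.
pose p j := bparam K (v j ord0).
pose dev j (k : nat) : R := (k%:R / n%:R - p j) ^+ 2.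
(* Either all frequencies are within eta of their means and the node is close to [v] by
   [sin_gap_ex], or a single deviation already pays for 2M. *)
have key (k : {ffun 'I_d -> 'I_n.+1}) :
    `|f (\col_j bnode K n (k j)) - f v| <= e / 2 + \sum_j c * dev j (k j).
  have S0 : 0 <= \sum_j c * dev j (k j).
    by apply: sumr_ge0 => j _; rewrite mulr_ge0 ?sqr_ge0.
  have [kd|] := pselect (forall j, `|(k j)%:R / n%:R - p j| < eta).
    apply: (@le_trans _ _ (e / 2)); last by rewrite lerDl.
    apply: fr => // j; rewrite mxE leNgt; apply/negP => rj.
    have x1 : -1 <= (2 * (k j)%:R / n%:R - 1 : R) <= 1.
      have k1 : (k j)%:R / n%:R <= (1 : R).
        by rewrite ler_pdivrMr// mul1r ler_nat -ltnS.
      have k0 : (0 : R) <= (k j)%:R / n%:R by rewrite divr_ge0.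
      by rewrite -mulrA; apply/andP; split; lra.
    have [sb sinb] := asin_def x1.
    have vj : `|bscale K * v j ord0| <= pi / 4.
      rewrite normrM (gtr0_norm w0) /bscale mulrAC ler_pdivrMr//.
      by apply: ler_wpM2l; [apply: divr_ge0 => //; exact: ltW|exact: vK].
    have := etaP _ _ vj sb; rewrite sinb.
    have -> : 2 * (k j)%:R / n%:R - 1 - sin (bscale K * v j ord0) =
        2 * ((k j)%:R / n%:R - p j) by rewrite /p /bparam; field; rewrite gt_eqF.
    rewrite normrM ger0_norm// ltr_pM2l// => /(_ (kd j)).
    have -> : asin (2 * (k j)%:R / n%:R - 1) = bscale K * bnode K n (k j).
      by rewrite /bnode [RHS]mulrC divfK// gt_eqF.
    rewrite -mulrBr normrM (gtr0_norm w0) ltr_pM2l// => h.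
    by move: rj; rewrite ltNge (ltW h).
  move=> /existsNP[j /negP]; rewrite -leNgt => etaj.
  apply: (@le_trans _ _ (2 * M)).
    rewrite (le_trans (ler_normB _ _))// mulr_natl mulr2n lerD//; exact: fM.
  apply: (@le_trans _ _ (c * dev j (k j))); last first.
    have h : c * dev j (k j) <= \sum_j c * dev j (k j).
      rewrite (bigD1 j)//= lerDl; apply: sumr_ge0 => i _.
      by apply: mulr_ge0 => //; exact: sqr_ge0.
    by apply: (le_trans h); rewrite lerDr ltW.
  rewrite -cE ler_wpM2l// /dev.
  by rewrite -[leRHS]real_normK ?num_real// lerXn2r// nnegrE ltW.
pose w (k : {ffun 'I_d -> 'I_n.+1}) := \prod_j bweight (p j) n (k j).
have w_ge0 k : 0 <= w k by exact: prod_bweight_ge0.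
have -> : bern K n f v - f v = \sum_(k : {ffun 'I_d -> 'I_n.+1}) (f (\col_j bnode K n (k j)) - f v) * w k.
  rewrite /bern -[X in _ - X]mulr1 -[X in _ - _ * X](sum_bweight_ffun p n) mulr_sumr.
  by rewrite -sumrB; apply: eq_bigr => k _; rewrite mulrBl.
apply: (@le_trans _ _ (\sum_(k : {ffun 'I_d -> 'I_n.+1}) (e / 2 + \sum_j c * dev j (k j)) * w k)).
  rewrite (le_trans (ler_norm_sum _ _ _))//; apply: ler_sum => k _.
  by rewrite normrM (ger0_norm (w_ge0 k)) ler_wpM2r.
have margin j : \sum_(k : {ffun 'I_d -> 'I_n.+1}) dev j (k j) * w k = p j * (1 - p j) / n%:R.
  rewrite /w (sum_bweight_ffun_marg p n (dev j)).
  apply: (@mulIf _ (n%:R ^+ 2)); first by rewrite expf_neq0// gt_eqF.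
  rewrite mulr_suml.
  transitivity (\sum_(k < n.+1) (k%:R - n%:R * p j) ^+ 2 * bweight (p j) n k).
    by apply: eq_bigr => k _; rewrite /dev; field; rewrite gt_eqF.
  by rewrite bweight_variance; field; rewrite gt_eqF.
under eq_bigr do rewrite mulrDl.
rewrite big_split/= -mulr_sumr sum_bweight_ffun mulr1 [leRHS]splitr lerD2l.
under eq_bigr do rewrite mulr_suml.
rewrite exchange_big/=.
apply: (@le_trans _ _ (\sum_(j < d) c / n%:R)).
  apply: ler_sum => j _; under eq_bigr do rewrite -mulrA.
  rewrite -mulr_sumr margin ler_wpM2l//.
  have /andP[p0 p1] := bparam01 K (v j ord0).
  apply: ler_piMl; first by rewrite invr_ge0.
  by apply: mulr_ile1 => //; rewrite ?subr_ge0// gerBl.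
by rewrite sumr_const card_ord -[leLHS]mulr_natr -[leLHS]mulrA [X in c * X]mulrC mulrA.
Qed.

(** Box radius m+1 and error 1/(m+1), with one degree for the whole finite family: pointwise
    convergence everywhere, which together with [norm_bern_le] feeds dominated convergence. *)
Lemma bern_approx_seq (I : finType) (f : I -> 'cV[R]_d -> R) (M : R) :
  (forall i, continuous (f i)) -> (forall i v, `|f i v| <= M) ->
  exists N : nat -> nat, forall i v,
    (fun m => bern m.+1%:R (N m) (f i) v) @ \oo --> f i v.
Proof.
move=> cf fM.
have h (mi : nat * I) : exists n0, forall n, (n0 <= n)%N -> forall v,
    (forall j, `|v j ord0| <= mi.1.+1%:R) ->
    `|bern mi.1.+1%:R n (f mi.2) v - f mi.2 v| <= (mi.1.+1%:R)^-1.
  by apply: (bern_approx (cf _) (fM _)); rewrite ?invr_gt0 ltr0n.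
have [N0 hN] := choice h.
exists (fun m => \max_(i : I) N0 (m, i)) => i v.
apply/cvgrPdist_le => e e0.
have H := @near_infty_natSinv_lt R (PosNum e0).
near=> m.
rewrite distrC (le_trans (hN (m, i) _ _ v _))//.
- exact: leq_bigmax.
- move=> j; rewrite (@le_trans _ _ (l1 v))//.
    by rewrite /l1 (bigD1 j)//= lerDl sumr_ge0.
  rewrite ltW// (lt_le_trans (truncnS_gt _))// ler_nat ltnS.
  by near: m; exact: nbhs_infty_ge.
- by apply: ltW; near: m; exact: H.
Unshelve. all: by end_near. Qed.

(** A phase in each cosine takes the place of separate sine terms, so that products stay in the
    class. *)
Definition trigpoly h := exists s : seq (R * 'cV[R]_d * R), forall v,
  h v = \sum_(x <- s) x.1.1 * cos (dotv x.1.2 v + x.2).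

Lemma trigpoly_cst (c : R) : trigpoly (fun=> c).
Proof.
exists [:: (c, 0, 0)] => v; rewrite big_seq1/= addr0.
by rewrite /dotv big1 ?cos0 ?mulr1// => j _; rewrite mxE mul0r.
Qed.

Lemma trigpolyD f h : trigpoly f -> trigpoly h -> trigpoly (fun v => f v + h v).
Proof.
by move=> [s fs] [t ht]; exists (s ++ t) => v; rewrite big_cat/= fs ht.
Qed.

Lemma dotvDl (a b v : 'cV[R]_d) : dotv (a + b) v = dotv a v + dotv b v.
Proof. by rewrite /dotv -big_split; apply: eq_bigr => j _; rewrite !mxE mulrDl. Qed.

Lemma dotvBl (a b v : 'cV[R]_d) : dotv (a - b) v = dotv a v - dotv b v.
Proof. by rewrite /dotv -sumrB; apply: eq_bigr => j _; rewrite !mxE mulrBl. Qed.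

Lemma trigpolyM f h : trigpoly f -> trigpoly h -> trigpoly (fun v => f v * h v).
Proof.
move=> [s fs] [t ht].
(* Product-to-sum formula: one term for the sum and one for the difference of the arguments. *)
exists ([seq ((x.1.1 * y.1.1 / 2 : R), x.1.2 + y.1.2, x.2 + y.2) | x <- s, y <- t] ++
  [seq ((x.1.1 * y.1.1 / 2 : R), x.1.2 - y.1.2, x.2 - y.2) | x <- s, y <- t]) => v.
rewrite big_cat/= !big_allpairs_dep/= -big_split/= fs ht mulr_suml.
apply: eq_bigr => x _; rewrite mulr_sumr -big_split/=; apply: eq_bigr => y _.
rewrite dotvDl dotvBl.
have -> : dotv x.1.2 v + dotv y.1.2 v + (x.2 + y.2) =
    (dotv x.1.2 v + x.2) + (dotv y.1.2 v + y.2) by ring.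
have -> : dotv x.1.2 v - dotv y.1.2 v + (x.2 - y.2) =
    (dotv x.1.2 v + x.2) - (dotv y.1.2 v + y.2) by ring.
move: (dotv x.1.2 v + x.2) (dotv y.1.2 v + y.2) => a b.
by rewrite cosD cosB; field.
Qed.

Lemma trigpoly_sum (I : Type) (s : seq I) (h : I -> 'cV[R]_d -> R) :
  (forall i, trigpoly (h i)) -> trigpoly (fun v => \sum_(i <- s) h i v).
Proof.
move=> th; elim: s => [|i s IH].
  by under eq_fun do rewrite big_nil; exact: trigpoly_cst.
by under eq_fun do rewrite big_cons; exact: trigpolyD.
Qed.

Lemma trigpoly_prod (I : Type) (s : seq I) (h : I -> 'cV[R]_d -> R) :
  (forall i, trigpoly (h i)) -> trigpoly (fun v => \prod_(i <- s) h i v).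
Proof.
move=> th; elim: s => [|i s IH].
  by under eq_fun do rewrite big_nil; exact: trigpoly_cst.
by under eq_fun do rewrite big_cons; exact: trigpolyM.
Qed.

Lemma trigpoly_bparam K (j : 'I_d) : trigpoly (fun v => bparam K (v j ord0)).
Proof.
exists [:: (2^-1, 0, 0); (2^-1, bscale K *: delta_mx j ord0, - (pi / 2))] => v.
rewrite !big_cons big_nil/= addr0 [dotv 0 v]big1 ?addr0 ?cos0; last first.
  by move=> i _; rewrite mxE mul0r.
have -> : dotv (bscale K *: delta_mx j ord0) v = bscale K * v j ord0.
  rewrite /dotv (bigD1 j)//= !mxE !eqxx mulr1 big1 ?addr0// => i /negbTE ij.
  by rewrite !mxE ij mulr0 mul0r.
by rewrite cosBpihalf /bparam; field.
Qed.

Lemma trigpoly_bweight K n k (j : 'I_d) :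
  trigpoly (fun v => bweight (bparam K (v j ord0)) n k).
Proof.
have tp := trigpoly_bparam K j.
have tq : trigpoly (fun v => 1 - bparam K (v j ord0)).
  have := trigpolyD (trigpoly_cst 1) (trigpolyM (trigpoly_cst (-1)) tp).
  by under eq_fun do rewrite mulN1r.
elim: n k => [|n IH] k /=; first exact: trigpoly_cst.
apply: trigpolyD; last exact: trigpolyM.
by apply: trigpolyM => //; case: k => [|k]; [exact: trigpoly_cst|exact: IH].
Qed.

Lemma trigpoly_bern K n f : trigpoly (bern K n f).
Proof.
apply: trigpoly_sum => k; apply: trigpolyM; first exact: trigpoly_cst.
by apply: trigpoly_prod => j; exact: trigpoly_bweight.
Qed.

Lemma continuous_trigpoly h : trigpoly h -> continuous h.
Proof.
move=> [s /funext ->].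
have : admissible (fun v => \sum_(x <- s) x.1.1 * cos (dotv x.1.2 v + x.2)).
  apply: admissible_sum => x; apply: admissibleZ.
  apply: (@admissible_bounded _ _ _ 1) => [v|v]; last exact: cos_max.
  apply: (cvg_comp (fun v => dotv x.1.2 v + x.2) cos); last exact: continuous_cos.
  by have [+ _] := admissibleD (admissible_dotv x.1.2) (admissible_cst x.2); exact.
by case.
Qed.

End Bernstein.

(** * Bounded expectations and weak convergence *)

Section BoundedExpectation.
Context {R : realType} {dd : measure_display} {T : measurableType dd}.
Variable P : probability T R.
Local Notation EP Y := (\int[P]_(w in setT) Y w)%R.
Implicit Types (Y Z : T -> R) (M c : R).

(** The integrands used under an abstract probability: they are integrable whatever the law. *)
Definition bmeas Y := measurable_fun setT Y /\ exists M : R, forall w, `|Y w| <= M.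

Lemma bmeas_integrable Y : bmeas Y -> P.-integrable setT (EFin \o Y).
Proof.
move=> [mY [M YM]].
have i : P.-integrable setT (cst M%:E) by exact: finite_measure_integrable_cst.
apply: le_integrable i => //; first exact/measurable_EFinP.
by move=> w _ /=; rewrite lee_fin (le_trans (YM w))// ler_norm.
Qed.

Lemma bmeas_cst c : bmeas (cst c).
Proof. by split => //; exists `|c|. Qed.

Lemma bmeasD Y Z : bmeas Y -> bmeas Z -> bmeas (fun w => Y w + Z w).
Proof.
move=> [mY [M YM]] [mZ [N ZN]]; split; first exact: measurable_funD.
by exists (M + N) => w; rewrite (le_trans (ler_normD _ _))// lerD.
Qed.

Lemma bmeasM Y Z : bmeas Y -> bmeas Z -> bmeas (fun w => Y w * Z w).
Proof.
move=> [mY [M YM]] [mZ [N ZN]]; split; first exact: measurable_funM.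
by exists (M * N) => w; rewrite normrM ler_pM.
Qed.

Lemma bmeas_sum (I : Type) (s : seq I) (Y : I -> T -> R) :
  (forall i, bmeas (Y i)) -> bmeas (fun w => \sum_(i <- s) Y i w).
Proof.
move=> bY; elim: s => [|i s IH].
  by under eq_fun do rewrite big_nil; exact: bmeas_cst.
by under eq_fun do rewrite big_cons; exact: bmeasD.
Qed.

Lemma bmeas_prod (I : Type) (s : seq I) (Y : I -> T -> R) :
  (forall i, bmeas (Y i)) -> bmeas (fun w => \prod_(i <- s) Y i w).
Proof.
move=> bY; elim: s => [|i s IH].
  by under eq_fun do rewrite big_nil; exact: bmeas_cst.
by under eq_fun do rewrite big_cons; exact: bmeasM.
Qed.

Lemma bmeas_min Y (M : R) : measurable_fun setT Y -> 0 <= M -> (forall w, 0 <= Y w) ->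
  bmeas (fun w => Num.min M (Y w)).
Proof.
move=> mY M0 Y0; split; first exact: measurable_minr.
by exists M => w; rewrite ger0_norm ?le_min ?M0//= ge_min lexx.
Qed.

Lemma bmeas_indic (A : set T) : measurable A -> bmeas (\1_A).
Proof.
move=> mA; split; first exact: measurable_indic.
by exists 1 => w; rewrite indicE; case: (_ \in _); rewrite ?normr1 ?normr0.
Qed.

Lemma EPD Y Z : bmeas Y -> bmeas Z -> EP (fun w => Y w + Z w) = EP Y + EP Z.
Proof. by move=> bY bZ; rewrite RintegralD//; exact: bmeas_integrable. Qed.

Lemma EPZ c Y : bmeas Y -> EP (fun w => c * Y w) = c * EP Y.
Proof. by move=> bY; rewrite RintegralZl//; exact: bmeas_integrable. Qed.

Lemma EP_cst c : EP (fun=> c) = c.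
Proof. by rewrite Rintegral_cst// [X in fine X](@probability_setT _ _ _ P) mulr1. Qed.

Lemma EP_le Y Z : bmeas Y -> bmeas Z -> (forall w, Y w <= Z w) -> EP Y <= EP Z.
Proof.
by move=> bY bZ YZ; apply: le_Rintegral => //; exact: bmeas_integrable.
Qed.

Lemma EP_sum (I : Type) (s : seq I) (Y : I -> T -> R) : (forall i, bmeas (Y i)) ->
  EP (fun w => \sum_(i <- s) Y i w) = \sum_(i <- s) EP (Y i).
Proof.
move=> bY; elim: s => [|i s IH].
  by rewrite big_nil -[RHS]EP_cst; apply: eq_Rintegral => w _; rewrite big_nil.
rewrite big_cons -IH -EPD//; last exact: bmeas_sum.
by apply: eq_Rintegral => w _; rewrite big_cons.
Qed.

Lemma EP_indic (A : set T) : measurable A -> EP (\1_A) = fine (P A).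
Proof. by move=> mA; rewrite /Rintegral integral_indic// setIT. Qed.

Lemma EP_dct (Y_ : nat -> T -> R) Y M : (forall m, measurable_fun setT (Y_ m)) ->
  (forall m w, `|Y_ m w| <= M) -> (forall w, Y_ ^~ w @ \oo --> Y w) ->
  bmeas Y /\ (fun m => EP (Y_ m)) @ \oo --> EP Y.
Proof.
move=> mY YM YY.
have bY : bmeas Y.
  split; first by apply: (measurable_fun_cvg mY) => w _; exact: YY.
  exists M => w; have h : (fun m => `|Y_ m w|) @ \oo --> `|Y w| by apply: cvg_norm; exact: YY.
  by rewrite -(cvg_lim _ h)//; apply: limr_le; [exact: cvgP h|exact: nearW].
split=> //; apply: fine_cvg; rewrite fineK; last first.
  by apply: integrable_fin_num => //; exact: bmeas_integrable.
apply: (@dominated_cvg _ _ _ P setT measurableT (fun m x => (Y_ m x)%:E)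
  (fun x => (Y x)%:E) (cst M%:E)) => //.
- by move=> m; exact/measurable_EFinP.
- by move=> x _; apply/fine_cvgP; split; [exact: nearW|exact: YY].
- exact: finite_measure_integrable_cst.
- by move=> m x _; rewrite lee_fin.
Qed.

Lemma EP_norm_le Y M : bmeas Y -> (forall w, `|Y w| <= M) -> `|EP Y| <= M.
Proof.
move=> bY YM; rewrite ler_norml -[in - M](EP_cst M) -[X in _ && (_ <= X)](EP_cst M).
have bM := bmeas_cst M; have bNM := bmeas_cst (- M).
have -> : - EP (fun=> M) = EP (fun=> - M) by rewrite !EP_cst.
by apply/andP; split; apply: EP_le => // w; move: (YM w); rewrite ler_norml => /andP[].
Qed.

Lemma measurable_norm_gt Y (e : R) : measurable_fun setT Y -> measurable [set w | e < `|Y w|].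
Proof.
move=> mY; rewrite -[X in measurable X]setTI.
have mnY : measurable_fun setT (fun w => `|Y w|) by exact: measurableT_comp.
have := mnY measurableT `]e, +oo[%classic (measurable_itv _).
congr (measurable _); apply/seteqP; split => w [_]/=; rewrite in_itv/= andbT => h //.
Qed.

(** Chebyshev's inequality with the square truncated at e^2, which asks for no second moment. *)
Lemma prob_gt_le Y (e : R) : 0 < e -> measurable_fun setT Y ->
  fine (P [set w | e < `|Y w|]) <= (e ^+ 2)^-1 * EP (fun w => Num.min (e ^+ 2) (Y w ^+ 2)).
Proof.
move=> e0 mY; have e2 : 0 < e ^+ 2 by rewrite exprn_gt0.
have mA := measurable_norm_gt e mY.
have bm : bmeas (fun w => Num.min (e ^+ 2) (Y w ^+ 2)).
  apply: bmeas_min; [exact: measurable_funX|exact: ltW|by move=> w; exact: sqr_ge0].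
rewrite -EP_indic// -EPZ//; apply: EP_le; first exact: bmeas_indic.
  by apply: bmeasM => //; exact: bmeas_cst.
move=> w; rewrite indicE; case: (boolP (w \in _)) => [|_] /=.
  rewrite inE/= => ew; rewrite min_l ?mulVf ?gt_eqF//.
  by rewrite -[leRHS]real_normK ?num_real// lerXn2r// ?nnegrE ?ltW// (lt_trans e0).
by rewrite mulr_ge0 ?invr_ge0 ?le_min ?(ltW e2)//= sqr_ge0.
Qed.

End BoundedExpectation.

(** * Weak convergence from characteristic functions and tightness *)

Section WeakConvergence.
Context {R : realType} {d : nat}.
Implicit Types (f h : 'cV[R]_d -> R) (v : 'cV[R]_d) (E : ('cV[R]_d -> R) -> R).

Definition bcont f := continuous f /\ exists M : R, forall v, `|f v| <= M.

Lemma bcont_admissible f : bcont f -> admissible f.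
Proof. by move=> [cf [M fM]]; exact: (admissible_bounded cf fM). Qed.

Lemma bcont_cst (c : R) : bcont (cst c).
Proof. by split; [case: (admissible_cst (d := d) c)|exists `|c|]. Qed.

Lemma bcontD f h : bcont f -> bcont h -> bcont (fun v => f v + h v).
Proof.
move=> bf bh; split; first by case: (admissibleD (bcont_admissible bf) (bcont_admissible bh)).
case: bf bh => _ [M fM] [_ [N hN]]; exists (M + N) => v.
by rewrite (le_trans (ler_normD _ _))// lerD.
Qed.

Lemma bcontM f h : bcont f -> bcont h -> bcont (fun v => f v * h v).
Proof.
move=> bf bh; split; first by case: (admissibleM (bcont_admissible bf) (bcont_admissible bh)).
case: bf bh => _ [M fM] [_ [N hN]]; exists (M * N) => v.
by rewrite normrM ler_pM.
Qed.

Lemma bcontZ (c : R) f : bcont f -> bcont (fun v => c * f v).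
Proof. by move=> bf; apply: bcontM => //; exact: bcont_cst. Qed.

Lemma bcont_sum (I : Type) (s : seq I) (f : I -> 'cV[R]_d -> R) :
  (forall i, bcont (f i)) -> bcont (fun v => \sum_(i <- s) f i v).
Proof.
move=> bf; elim: s => [|i s IH].
  by under eq_fun do rewrite big_nil; exact: bcont_cst.
by under eq_fun do rewrite big_cons; exact: bcontD.
Qed.

Lemma bcont_cos f (c : R) : continuous f -> bcont (fun v => cos (f v + c)).
Proof.
move=> cf; split; last by exists 1 => v; exact: cos_max.
move=> v; apply: (cvg_comp (fun v => f v + c) cos); last exact: continuous_cos.
exact: cvgD (cf v) (@cst_continuous _ _ c v).
Qed.

Lemma continuous_dotv th : continuous (@dotv R d th).
Proof. by case: (admissible_dotv th). Qed.

(** A positive normalised linear functional on bounded continuous functions: the common ground of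
    laws given by a measure and of [gaussE], given by iterated integrals. *)
Definition mean E := [/\
  forall f h, bcont f -> bcont h -> E (fun v => f v + h v) = E f + E h,
  forall (c : R) f, bcont f -> E (fun v => c * f v) = c * E f,
  forall f h, bcont f -> bcont h -> (forall v, f v <= h v) -> E f <= E h &
  E (fun=> 1) = 1].

(** A bounded continuous majorant of the indicator of the complement of [-K, K]^d, bounded in mean
    by second moments. *)
Definition tail (K : R) v : R := \sum_j Num.min 1 (v j ord0 ^+ 2 / K ^+ 2).

Lemma bcont_tail K : bcont (tail K).
Proof.
apply: bcont_sum => j; split.
  have [cj _] := admissibleM (admissibleX 2 (admissible_coord j)) (admissible_cst (K ^+ 2)^-1).
  move=> v; apply: (cvg_comp _ (fun x : R => Num.min 1 x) (cj v)).
  have c1 : continuous (fun x : R => Num.min 1 x).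
    by move=> x; apply: continuous_min; [exact: cst_continuous|exact: cvg_id].
  exact: c1.
exists 1 => v; rewrite ger0_norm; first by rewrite ge_min lexx.
by rewrite le_min ler01 divr_ge0 ?sqr_ge0.
Qed.

Lemma mean_sum E (I : Type) (s : seq I) (f : I -> 'cV[R]_d -> R) : mean E ->
  (forall i, bcont (f i)) -> E (fun v => \sum_(i <- s) f i v) = \sum_(i <- s) E (f i).
Proof.
move=> [ED EZ _ _] bf; elim: s => [|i s IH].
  rewrite big_nil; under eq_fun do rewrite big_nil.
  have := EZ 0 (cst 0) (bcont_cst 0); rewrite mul0r.
  by under eq_fun do rewrite mul0r.
rewrite big_cons -IH; under eq_fun do rewrite big_cons.
by rewrite ED//; exact: bcont_sum.
Qed.

Lemma mean_dist E f h k : mean E -> bcont f -> bcont h -> bcont k ->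
  (forall v, `|f v - h v| <= k v) -> `|E f - E h| <= E k.
Proof.
move=> [ED EZ Ele _] bf bh bk fhk.
have ineq f1 f2 : bcont f1 -> bcont f2 -> (forall v, f1 v - f2 v <= k v) -> E f1 - E f2 <= E k.
  move=> b1 b2 h12; rewrite lerBlDr -ED//; apply: Ele => //; first exact: bcontD.
  by move=> v; rewrite -lerBlDr.
rewrite ler_norml lerNl opprB; apply/andP; split; apply: ineq => // v.
  by rewrite (le_trans _ (fhk v))// distrC ler_norm.
by rewrite (le_trans _ (fhk v))// ler_norm.
Qed.

(* Tightness reduces the test function to a box, where it is uniformly close to a
   trigonometric polynomial with the same sup bound. *)
Lemma cvg_mean (E_ : nat -> ('cV[R]_d -> R) -> R) E (B : R) :
  (forall n, mean (E_ n)) -> mean E ->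
  (forall n (K : R), (0 < n)%N -> 0 < K -> E_ n (tail K) <= B / K ^+ 2) ->
  (forall K : R, 0 < K -> E (tail K) <= B / K ^+ 2) ->
  (forall th c, (fun n => E_ n (fun v => cos (dotv th v + c))) @ \oo -->
     E (fun v => cos (dotv th v + c))) ->
  forall f, bcont f -> (fun n => E_ n f) @ \oo --> E f.
Proof.
move=> mE_ mE tE_ tE cosE f bf; have [cf [M fM]] := bf.
have M0 : 0 <= M by exact: le_trans (fM 0).
apply/cvgrPdist_le => e e0.
have e8 : 0 < e / 8 by rewrite divr_gt0.
(* The box is so large that 2M times the tail bound is at most e/8; [1 + x] serves because (1 + x)^2
   >= x. *)
have [K K1 KP] : exists2 K : R, 1 <= K & 2 * M * `|B| <= e / 8 * K ^+ 2.
  have [x x0 ->] : exists2 x : R, 0 <= x & 2 * M * `|B| = e / 8 * x.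
    exists (2 * M * `|B| / (e / 8)); last by rewrite [RHS]mulrC divfK ?gt_eqF.
    by apply: divr_ge0; [apply: mulr_ge0 => //; exact: mulr_ge0|exact: ltW].
  exists (1 + x); first by rewrite lerDl.
  rewrite ler_wpM2l ?(ltW e8)//; nra.
have K0 : 0 < K by exact: lt_le_trans K1.
have [N /(_ N (leqnn N)) pP] := bern_approx cf fM K0 e8.
pose p := bern K N f.
have tp : trigpoly p by exact: trigpoly_bern.
have pM v : `|p v| <= M by exact: norm_bern_le.
have bp : bcont p by split; [exact: continuous_trigpoly|exists M].
(* Majorant of |f - p|: in the box p is within e/8 of f, and outside it the tail is at least 1 while
   |f| and |p| are at most M. *)
pose k v := e / 8 + 2 * M * tail K v.
have bt := bcont_tail K.
have bk : bcont k by apply: bcontD; [exact: bcont_cst|exact: bcontZ].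
have t0 v j : 0 <= Num.min 1 (v j ord0 ^+ 2 / K ^+ 2) :> R.
  by rewrite le_min ler01 divr_ge0 ?sqr_ge0.
have fpk v : `|f v - p v| <= k v.
  have [vK|] := pselect (forall j, `|v j ord0| <= K).
    rewrite distrC (le_trans (pP v vK))// /k lerDl mulr_ge0 ?mulr_ge0//.
    by apply: sumr_ge0 => j _; exact: t0.
  move=> /existsNP[j /negP]; rewrite -ltNge => Kv.
  rewrite (le_trans (ler_normB _ _))// (@le_trans _ _ (2 * M))//.
    by rewrite mulr_natl mulr2n lerD.
  rewrite /k -[leLHS]add0r lerD ?(ltW e8)// ler_peMr ?mulr_ge0// /tail (bigD1 j)//=.
  rewrite -[leLHS]addr0 lerD//; last by apply: sumr_ge0 => i _; exact: t0.
  rewrite le_min lexx/= ler_pdivlMr ?exprn_gt0// mul1r.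
  by rewrite -[leRHS]real_normK ?num_real// lerXn2r// ?nnegrE ltW// ltW.
have kE F : mean F -> F (tail K) <= B / K ^+ 2 -> `|F f - F p| <= e / 4.
  move=> mF tF; apply: (le_trans (mean_dist mF bf bp bk fpk)).
  case: mF => FD FZ _ F1.
  have -> : F k = e / 8 + 2 * M * F (tail K).
    rewrite FD//; [|exact: bcont_cst|exact: bcontZ].
    rewrite FZ//; congr (_ + _).
    transitivity (F (fun=> e / 8 * 1)).
      by congr F; apply/funext => v; rewrite mulr1.
    by rewrite (FZ (e / 8) (fun=> 1)) ?F1 ?mulr1//; exact: bcont_cst.
  have -> : e / 4 = e / 8 + e / 8 by lra.
  rewrite lerD2l; apply: (@le_trans _ _ (2 * M * (`|B| / K ^+ 2))).
    rewrite ler_wpM2l ?mulr_ge0// (le_trans tF)// ler_wpM2r ?invr_ge0 ?sqr_ge0//.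
    exact: ler_norm.
  by rewrite mulrA ler_pdivrMr ?exprn_gt0.
have pcvg : (fun n => E_ n p) @ \oo --> E p.
  have [s sp] := tp.
  have pE F : mean F -> F p = \sum_(x <- s) x.1.1 * F (fun v => cos (dotv x.1.2 v + x.2)).
    move=> mF; rewrite (_ : p = fun v => \sum_(x <- s) x.1.1 * cos (dotv x.1.2 v + x.2)); last exact/funext.
    have bc x : bcont (fun v => cos (dotv x.1.2 v + x.2)).
      by apply: bcont_cos; exact: continuous_dotv.
    rewrite mean_sum//; last by move=> x; exact: bcontZ.
    by apply: eq_bigr => x _; case: mF => _ FZ _ _; rewrite FZ.
  rewrite (pE _ mE); under eq_fun do rewrite (pE _ (mE_ _)).
  by apply: cvg_sumr => x; apply: cvgM; [exact: cvg_cst|exact: cosE].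
have e2 : 0 < e / 2 by rewrite divr_gt0.
move/cvgrPdist_le : pcvg => /(_ _ e2) pcvg.
near=> n.
have h1 := kE _ mE (tE _ K0).
have h2 : `|E_ n f - E_ n p| <= e / 4.
  by apply: kE => //; apply: tE_ => //; near: n; exact: nbhs_infty_gt.
have h3 : `|E p - E_ n p| <= e / 2 by near: n; exact: pcvg.
have -> : E f - E_ n f = (E f - E p) + (E p - E_ n p) - (E_ n f - E_ n p) by ring.
rewrite (le_trans (ler_normB _ _))// (le_trans (lerD (ler_normD _ _) (lexx _)))//.
have : e = e / 4 + e / 2 + e / 4 by lra.
by move=> ->; rewrite !lerD.
Unshelve. all: by end_near. Qed.

End WeakConvergence.

(** * The mixture law of the rows *)

Section StepApproximation.
Context {R : realType}.
Implicit Types (h : R -> R) (m c : nat) (t : R).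

(** Left endpoints of cells of length 1/(m+1); the [ncells m] half-open cells partition [-(m+1),
    m+1[, so at most one indicator in [step] is nonzero. *)
Definition grid m c : R := c%:R / m.+1%:R - m.+1%:R.
Definition cell m c : set R := `[grid m c, grid m c.+1[%classic.
Definition ncells m : nat := (2 * m.+1 * m.+1)%N.
Definition step h m t : R := \sum_(c < ncells m) h (grid m c) * \1_(cell m c) t.

Lemma indic_cell m c t : let s := (t + m.+1%:R) * m.+1%:R in
  \1_(cell m c) t = ((0 <= s) && (Num.trunc s == c))%:R :> R.
Proof.
move=> s; rewrite indicE; congr (_%:R : R); congr nat_of_bool.
have m0 : (0 : R) < m.+1%:R by rewrite ltr0n.
have -> : (t \in cell m c) = (c%:R <= s < c.+1%:R).
  rewrite /cell; apply/idP/idP; rewrite inE/= in_itv/= /grid lerBlDr ltrBrDr.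
    by rewrite ler_pdivrMr// ltr_pdivlMr.
  by rewrite ler_pdivrMr// ltr_pdivlMr.
have [s0|s0] /= := boolP (0 <= s); first by rewrite truncn_eq.
apply/negbTE; apply: contra s0 => /andP[cs _].
exact: le_trans cs.
Qed.

Lemma stepE h m t : let s := (t + m.+1%:R) * m.+1%:R in
  step h m t = if (0 <= s) && (Num.trunc s < ncells m)%N
               then h (grid m (Num.trunc s)) else 0.
Proof.
move=> s; rewrite /step; under eq_bigr do rewrite indic_cell -/s.
have [s0|s0] /= := boolP (0 <= s); last first.
  by rewrite big1// => c _; rewrite mulr0.
case: ltnP => [sK|Ks].
  rewrite (bigD1 (Ordinal sK))//= eqxx mulr1 big1 ?addr0// => c /eqP cs.
  by case: eqP => [e|_]; rewrite ?mulr0//; case: cs; apply: val_inj.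
rewrite big1// => c _; case: eqP => [e|_]; rewrite ?mulr0//.
by have := ltn_ord c; rewrite -e ltnNge Ks.
Qed.

Lemma norm_step_le h m t (M : R) : (forall t, `|h t| <= M) -> `|step h m t| <= M.
Proof.
move=> hM; rewrite stepE; case: ifP => _ //.
by rewrite normr0; exact: le_trans (hM 0).
Qed.

Lemma step_cvg h t : continuous h -> (fun m => step h m t) @ \oo --> h t.
Proof.
move=> ch; apply/cvgrPdist_le => e e0.
have /cvgrPdist_le/(_ e e0) := ch t.
move=> /nbhs_ballP[r /= r0 hr].
have H := @near_infty_natSinv_lt R (PosNum r0).
near=> m.
have m0 : (0 : R) < m.+1%:R by rewrite ltr0n.
have tm : `|t| < m.+1%:R.
  rewrite (lt_le_trans (truncnS_gt _))// ler_nat ltnS.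
  by near: m; exact: nbhs_infty_ge.
move: tm; rewrite ltr_norml => /andP[t1 t2].
rewrite stepE; set s := (t + _) * _.
have s0 : 0 <= s by rewrite mulr_ge0 ?(ltW m0)//; lra.
have sK : (Num.trunc s < ncells m)%N.
  rewrite truncn_lt_nat// /ncells !natrM ltr_pM2r//; lra.
rewrite s0 sK/=; apply: hr; rewrite /ball/=.
have := truncn_itv s0 => /andP[s1 s2].
have -> : t = s / m.+1%:R - m.+1%:R by rewrite /s mulfK ?gt_eqF// addrK.
rewrite /grid opprB addrA subrK -mulrBl normrM (ger0_norm (x := s - _)) ?subr_ge0//.
rewrite normfV (gtr0_norm m0).
apply: (@le_lt_trans _ _ m.+1%:R^-1); last by near: m; exact: H.
rewrite ler_piMl ?invr_ge0 ?(ltW m0)//.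
by move: s2; rewrite -natr1; lra.
Unshelve. all: by end_near. Qed.

Lemma measurable_cell m c : measurable (cell m c).
Proof. exact: measurable_itv. Qed.

End StepApproximation.

Section NormalExpectation.
Context {R : realType}.

(** Adding the bound [M] makes the integrand nonnegative, and the constant is then removed from both
    sides. *)
Lemma Rintegral_normal_center (h : R -> R) (mu M : R) : continuous h ->
  (forall t, `|h t| <= M) ->
  (\int[normal_prob mu 1]_(t in setT) h t)%R =
  (\int[normal_prob (0 : R) 1]_(t in setT) h (t + mu))%R.
Proof.
move=> ch hM.
have ge0 (g : R -> R) : continuous g -> (forall t, 0 <= g t) ->
    (\int[normal_prob mu 1]_(t in setT) g t)%R =
    (\int[normal_prob (0 : R) 1]_(t in setT) g (t + mu))%R.
  by move=> cg g0; rewrite /Rintegral (ge0_normal_prob_center mu cg g0).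
have eh : expgrow1 h by exact: expgrow1_bounded hM.
have mM : measurable_fun (setT : set (measurableTypeR R)) (fun t => h t + M).
  by apply: measurable_funD => //; exact: continuous_measurable_fun.
have bh : @bmeas R _ (measurableTypeR R) h.
  by split; [exact: continuous_measurable_fun|exists M].
have bM : @bmeas R _ (measurableTypeR R) (fun=> M) by exact: bmeas_cst.
have e1 : (\int[normal_prob mu 1]_(t in setT) (h t + M))%R =
    (\int[normal_prob mu 1]_(t in setT) h t)%R + M.
  rewrite -[X in _ + X](EP_cst (normal_prob mu 1) M).
  exact: (EPD (normal_prob mu 1) bh bM).
have e2 : (\int[normal_prob (0 : R) 1]_(t in setT) (h (t + mu) + M))%R =
    (\int[normal_prob (0 : R) 1]_(t in setT) h (t + mu))%R + M.
  rewrite -[X in _ + X](E1_cst M).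
  exact: (E1D (expgrow1_shift mu eh) (expgrow1_cst M)).
have cM : continuous (fun t => h t + M).
  by move=> t; exact: cvgD (ch t) (@cst_continuous _ _ M t).
have M0 t : 0 <= h t + M.
  by have := hM t; rewrite ler_norml => /andP[+ _]; rewrite -[X in _ + X]opprK subr_ge0.
have := ge0 _ cM M0; rewrite e1 e2; exact: addIr.
Qed.

Lemma sum_step_normal_cvg (h : R -> R) (mu M : R) : continuous h ->
  (forall t, `|h t| <= M) ->
  (fun m => \sum_(c < ncells m) h (grid m c) * fine (normal_prob mu 1 (cell m c)))
    @ \oo --> (\int[normal_prob (0 : R) 1]_(t in setT) h (t + mu))%R.
Proof.
move=> ch hM; rewrite -(Rintegral_normal_center mu ch hM).
have -> : (fun m => \sum_(c < ncells m) h (grid m c) * fine (normal_prob mu 1 (cell m c)))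
    = (fun m => \int[normal_prob mu 1]_(t in setT) step h m t)%R.
  apply/funext => m; rewrite /step EP_sum; last first.
    move=> c; apply: bmeasM; first exact: bmeas_cst.
    by apply: bmeas_indic; exact: measurable_cell.
  apply: eq_bigr => c _; rewrite EPZ; last by apply: bmeas_indic; exact: measurable_cell.
  by rewrite EP_indic//; exact: measurable_cell.
have mS m : measurable_fun (setT : set (measurableTypeR R)) (step h m).
  apply: measurable_sum => c; apply: measurable_funM => //.
  by apply: measurable_indic; exact: measurable_cell.
have [_ +] := EP_dct (normal_prob mu 1) mS (fun m t => norm_step_le m t hM)
  (fun t => @step_cvg R h t ch).
exact.
Qed.

End NormalExpectation.

(** * Measurability of continuous functions of a random vector *)

Section BernsteinMeasurability.
Context {R : realType} {d : nat}.
Implicit Types (f : 'cV[R]_d -> R) (K : R).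

Lemma bweight_le1 (p : R) n k : 0 <= p <= 1 -> bweight p n k <= 1.
Proof.
move=> p01; have [nk|kn] := ltnP n k; first by rewrite bweight_gt.
have kn1 : (k < n.+1)%N by [].
rewrite -(sum_bweight p n) (bigD1 (Ordinal kn1))//= lerDl.
by apply: sumr_ge0 => i _; exact: bweight_ge0.
Qed.

Lemma continuous_bparam K : continuous (bparam K).
Proof.
move=> x; rewrite /bparam; apply: cvgM; last exact: cvg_cst.
apply: cvgD; first exact: cvg_cst.
apply: (cvg_comp (fun x => bscale K * x) sin); last exact: continuous_sin.
by apply: cvgM; [exact: cvg_cst|exact: cvg_id].
Qed.

Lemma continuous_bweight K n k : continuous (fun x => bweight (bparam K x) n k).
Proof.
have cb := @continuous_bparam K; elim: n k => [|n IH] k x /=; first exact: cvg_cst.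
apply: cvgD; apply: cvgM.
- exact: cb.
- by case: k => [|k]; [exact: cvg_cst|exact: IH].
- by apply: cvgB; [exact: cvg_cst|exact: cb].
- exact: IH.
Qed.

Lemma admissible_prod (I : Type) (s : seq I) (f_ : I -> 'cV[R]_d -> R) :
  (forall i, admissible (f_ i)) -> admissible (fun v => \prod_(i <- s) f_ i v).
Proof.
move=> af; elim: s => [|i s IH].
  by under eq_fun do rewrite big_nil; exact: admissible_cst.
by under eq_fun do rewrite big_cons; exact: admissibleM.
Qed.

Variables (dd : measure_display) (T : measurableType dd) (Y : T -> 'cV[R]_d).
Hypothesis mY : forall j, measurable_fun setT (fun w => Y w j ord0).

Lemma measurable_bern K n f : measurable_fun setT (fun w => bern K n f (Y w)).
Proof.
apply: measurable_sum => k; apply: measurable_funM => //.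
apply: measurable_prod => j _.
exact: (measurableT_comp (continuous_measurable_fun
  (@continuous_bweight K n (k j))) (mY j)).
Qed.

(** Bernstein polynomials are finite sums of products of one-coordinate functions, so measurability
    of the coordinates suffices and passes to the pointwise limit. *)
Lemma measurable_bcont f : bcont f -> measurable_fun setT (fun w => f (Y w)).
Proof.
move=> [cf [M fM]].
have [N fN] := @bern_approx_seq R d unit (fun=> f) M (fun=> cf) (fun=> fM).
apply: (measurable_fun_cvg (h := fun m w => bern m.+1%:R (N m) f (Y w))).
  by move=> m; exact: measurable_bern.
by move=> w _; exact: (fN tt).
Qed.

(** Truncation to [-M, M] when M >= 0; it is dominated by |x|, which gives convergence of Gaussian
    expectations as M grows. *)
Definition clamp (M x : R) := Num.max (- M) (Num.min M x).

Lemma continuous_clamp M : continuous (clamp M).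
Proof.
have c1 : continuous (fun x : R => Num.min M x).
  by move=> x; apply: continuous_min; [exact: cst_continuous|exact: cvg_id].
move=> x; apply: (@continuous_max _ _ (cst (- M)) (fun x => Num.min M x)).
  exact: cst_continuous.
exact: c1.
Qed.

Lemma norm_clamp_le (M x : R) : 0 <= M -> `|clamp M x| <= M.
Proof.
move=> M0; rewrite ler_norml le_max lexx/= /clamp ge_max ge_min lexx/= andbT.
by rewrite (le_trans _ M0)// oppr_le0.
Qed.

Lemma clamp_id (M x : R) : `|x| <= M -> clamp M x = x.
Proof.
rewrite ler_norml => /andP[x1 x2]; rewrite /clamp.
by rewrite min_r// max_r.
Qed.

Lemma norm_clamp_le_norm (M x : R) : 0 <= M -> `|clamp M x| <= `|x|.
Proof.
move=> M0; have [xM|Mx] := lerP (`|x|) M.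
  by rewrite clamp_id.
exact: le_trans (norm_clamp_le _ M0) (ltW Mx).
Qed.

Lemma clamp_cvg (x : R) : (fun m : nat => clamp m%:R x) @ \oo --> x.
Proof.
apply/cvgrPdist_le => e e0; near=> m; rewrite clamp_id ?subrr ?normr0 ?(ltW e0)//.
rewrite ltW// (lt_le_trans (truncnS_gt _))// ler_nat.
by near: m; exact: nbhs_infty_ge.
Unshelve. all: by end_near. Qed.

Lemma bcont_clamp f (M : R) : 0 <= M -> continuous f -> bcont (fun v => clamp M (f v)).
Proof.
move=> M0 cf; split; last by exists M => v; exact: norm_clamp_le.
by move=> v; apply: (cvg_comp f (clamp M) (cf v)); exact: continuous_clamp.
Qed.

Lemma measurable_continuous_vec f : continuous f -> measurable_fun setT (fun w => f (Y w)).
Proof.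
move=> cf; apply: (measurable_fun_cvg (h := fun m w => clamp m%:R (f (Y w)))).
  by move=> m; apply: (measurable_bcont (f := fun v => clamp m%:R (f v))); exact: bcont_clamp.
by move=> w _; exact: clamp_cvg.
Qed.

Lemma mean_pushforward (P : probability T R) :
  mean (fun f : 'cV[R]_d -> R => \int[P]_(w in setT) f (Y w))%R.
Proof.
have bY f : bcont f -> bmeas (fun w => f (Y w)).
  by move=> bf; split; [exact: measurable_bcont|case: bf => _ [M fM]; exists M].
split.
- by move=> f h bf bh; rewrite EPD//; exact: bY.
- by move=> c f bf; rewrite EPZ//; exact: bY.
- by move=> f h bf bh fh; apply: EP_le => //; exact: bY.
- exact: EP_cst.
Qed.

Lemma mean_gaussE (mu : 'cV[R]_d) L : mean (gaussE mu L).
Proof.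
split=> [f h bf bh|c f bf|f h bf bh fh|].
- by rewrite gaussED//; exact: bcont_admissible.
- by rewrite gaussEZ//; exact: bcont_admissible.
- by apply: gaussE_le => //; exact: bcont_admissible.
- exact: gaussE_cst.
Qed.

End BernsteinMeasurability.

(** * Expectations under the mixture law *)

Section MixtureLaw.
Context {R : realType} {dd : measure_display} {T : measurableType dd}.
Variables (P : probability T R) (n d : nat) (X : T -> 'M[R]_(n, d)).
Variables (Q : {ffun 'I_n -> bool} -> R) (th : 'cV[R]_d).
Hypothesis mX : forall i j, measurable_fun setT (fun w => X w i j).
Hypothesis lawX : forall B : 'I_n -> 'I_d -> set R, (forall i j, measurable (B i j)) ->
  P [set w | forall i j, B i j (X w i j)] =
  ((\sum_(z : {ffun 'I_n -> bool}) Q z * \prod_(i < n) \prod_(j < d)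
      fine (normal_prob (th j ord0 * spin (z i)) 1 (B i j)))%:E)%E.
Local Notation EP Y := (\int[P]_(w in setT) Y w)%R.

Lemma measurable_rect (B : 'I_n -> 'I_d -> set R) : (forall i j, measurable (B i j)) ->
  measurable [set w | forall i j, B i j (X w i j)].
Proof.
move=> mB.
have -> : [set w | forall i j, B i j (X w i j)] =
    \bigcap_(p in [set: 'I_n * 'I_d]) ((fun w => X w p.1 p.2) @^-1` B p.1 p.2).
  by apply/seteqP; split=> [w h p _|w h i j]; [exact: h|exact: (h (i, j))].
apply: fin_bigcap_measurable => // p _.
by rewrite -[X in measurable X]setTI; exact: mX.
Qed.

(** Expanding the product of step functions over choices of one cell per entry produces indicators
    of rectangles. The law evaluates these, and for fixed spins the sum over the choices factors
    again into one-dimensional sums. *)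
Lemma EP_mixture_prod1 (h : 'I_n -> 'I_d -> R -> R) (M : R) :
  (forall i j, continuous (h i j)) -> (forall i j t, `|h i j t| <= M) ->
  EP (fun w => \prod_i \prod_j h i j (X w i j)) =
  \sum_z Q z * \prod_i \prod_j
    (\int[normal_prob (0 : R) 1]_(t in setT) h i j (t + th j ord0 * spin (z i)))%R.
Proof.
move=> ch hM.
have [M1 [M10 M1M]] : exists M1, 0 <= M1 /\ M <= M1 by exists `|M|; rewrite normr_ge0 ler_norm.
have hM1 i j t : `|h i j t| <= M1 by exact: le_trans (hM i j t) M1M.
have bprod (F : 'I_n -> 'I_d -> R) : (forall i j, `|F i j| <= M1) ->
    `|\prod_i \prod_j F i j| <= \prod_(i < n) \prod_(j < d) M1.
  move=> FM; rewrite normr_prod; apply: ler_prod => i _; rewrite normr_ge0/=.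
  rewrite normr_prod; apply: ler_prod => j _; rewrite normr_ge0/=; exact: FM.
pose S m w := \prod_i \prod_j step (h i j) m (X w i j).
have mstep i j m : measurable_fun setT (fun w => step (h i j) m (X w i j)).
  apply: measurable_sum => c; apply: measurable_funM => //.
  exact: (measurableT_comp (measurable_indic (measurable_cell m c)) (mX i j)).
have mS m : measurable_fun setT (S m).
  by apply: measurable_prod => i _; apply: measurable_prod => j _; exact: mstep.
have cvgprod (F : nat -> 'I_n -> 'I_d -> R) (G : 'I_n -> 'I_d -> R) :
    (forall i j, (fun m => F m i j) @ \oo --> G i j) ->
    (fun m => \prod_i \prod_j F m i j) @ \oo --> \prod_i \prod_j G i j.
  move=> FG; apply: cvg_big => [|i _]; first exact: mul_continuous.
  by apply: cvg_big => [|j _]; [exact: mul_continuous|exact: FG].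
have [_ lim1] : bmeas (fun w => \prod_i \prod_j h i j (X w i j)) /\
    (fun m => EP (S m)) @ \oo --> EP (fun w => \prod_i \prod_j h i j (X w i j)).
  apply: (@EP_dct _ _ _ P S _ (\prod_(i < n) \prod_(j < d) M1)) => //.
  - by move=> m w; apply: bprod => i j; exact: norm_step_le.
  - by move=> w; apply: cvgprod => i j; exact: step_cvg.
pose A m i j z := \sum_(c < ncells m) h i j (grid m c) *
  fine (normal_prob (th j ord0 * spin z) 1 (cell m c)).
have ES m : EP (S m) = \sum_z Q z * \prod_i \prod_j A m i j (z i).
  pose I := ('I_n * 'I_d)%type.
  pose rect (k : {ffun I -> 'I_(ncells m)}) :=
    [set w | forall i j, cell m (k (i, j)) (X w i j)].
  have mrect k : measurable (rect k).
    by apply: (measurable_rect (B := fun i j => cell m (k (i, j)))) => i j; exact: measurable_cell.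
  transitivity (EP (fun w => \sum_(k : {ffun I -> 'I_(ncells m)})
      (\prod_(p : I) h p.1 p.2 (grid m (k p))) * \1_(rect k) w)).
    apply: eq_Rintegral => w _; rewrite /S pair_bigA/= /step bigA_distr_bigA/=.
    apply: eq_bigr => k _; rewrite big_split/=; congr (_ * _).
    have [rk|rk] := pselect (rect k w).
      rewrite [RHS]indicE mem_set// big1// => p _.
      by rewrite indicE mem_set//; have := rk p.1 p.2; rewrite -surjective_pairing.
    rewrite [RHS]indicE memNset//.
    have [i /existsNP[j ij]] : exists i, ~ forall j, cell m (k (i, j)) (X w i j).
      exact/existsNP.
    by rewrite (bigD1 (i, j))//= indicE memNset// mul0r.
  rewrite EP_sum; last by move=> k; apply: bmeasM; [exact: bmeas_cst|exact: bmeas_indic].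
  transitivity (\sum_(k : {ffun I -> 'I_(ncells m)}) \sum_z Q z *
      \prod_(p : I) (h p.1 p.2 (grid m (k p)) *
        fine (normal_prob (th p.2 ord0 * spin (z p.1)) 1 (cell m (k p))))).
    apply: eq_bigr => k _; rewrite EPZ; last exact: bmeas_indic.
    rewrite EP_indic// /rect (lawX (B := fun i j => cell m (k (i, j)))); last first.
      by move=> i j; exact: measurable_cell.
    rewrite /= mulr_sumr; apply: eq_bigr => z _.
    rewrite big_split/= mulrCA; congr (_ * (_ * _)).
    rewrite pair_bigA/=; apply: eq_bigr => p _.
    by rewrite -surjective_pairing.
  rewrite exchange_big/=; apply: eq_bigr => z _.
  by rewrite -mulr_sumr pair_bigA/= bigA_distr_bigA.
have lim2 : (fun m => EP (S m)) @ \oo --> \sum_z Q z * \prod_i \prod_j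
    (\int[normal_prob (0 : R) 1]_(t in setT) h i j (t + th j ord0 * spin (z i)))%R.
  under eq_fun do rewrite ES.
  apply: cvg_sumr => z; apply: cvgM; first exact: cvg_cst.
  by apply: cvgprod => i j; exact: (sum_step_normal_cvg (ch i j) (hM i j)).
exact: cvg_unique lim1 lim2.
Qed.

Definition xrow w i : 'cV[R]_d := \col_j X w i j.

Lemma EP_mixture_prod (g : 'I_n -> 'cV[R]_d -> R) : (forall i, bcont (g i)) ->
  EP (fun w => \prod_i g i (xrow w i)) =
  \sum_z Q z * \prod_i gaussE (spin (z i) *: th) 1%:M (g i).
Proof.
move=> bg; have cg i : continuous (g i) by case: (bg i).
have [M gM] : exists M, forall i v, `|g i v| <= M.
  have [M gM] := choice (fun i => (bg i).2); exists (\sum_i `|M i|) => i v.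
  rewrite (le_trans (gM i v))// (le_trans (ler_norm _))// (bigD1 i)//= lerDl.
  exact: sumr_ge0.
have [N gN] := bern_approx_seq cg gM.
pose p m i := bern m.+1%:R (N m) (g i).
have pM m i v : `|p m i v| <= M by exact: norm_bern_le.
have bp m i : bcont (p m i).
  by split; [apply: continuous_trigpoly; exact: trigpoly_bern|exists M].
have mrow i j : measurable_fun setT (fun w => xrow w i j ord0).
  by under eq_fun do rewrite mxE; exact: mX.
have M0 (i : 'I_n) : 0 <= M by exact: le_trans (gM i 0).
have [_ lim1] : bmeas (fun w => \prod_i g i (xrow w i)) /\
    (fun m => EP (fun w => \prod_i p m i (xrow w i))) @ \oo -->
    EP (fun w => \prod_i g i (xrow w i)).
  apply: (@EP_dct _ _ _ P (fun m w => \prod_i p m i (xrow w i)) _ (\prod_(i < n) M)).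
  - move=> m; apply: measurable_prod => i _.
    exact: measurable_bern.
  - by move=> m w; rewrite normr_prod; apply: ler_prod => i _; rewrite normr_ge0 pM.
  - move=> w; apply: cvg_big => [|i _]; first exact: mul_continuous.
    exact: gN.
have bw01 K n' k x : `|bweight (bparam (R := R) K x) n' k| <= 1.
  by rewrite ger0_norm ?bweight_ge0 ?bweight_le1 ?bparam01.
have Ep m : EP (fun w => \prod_i p m i (xrow w i)) =
    \sum_z Q z * \prod_i gaussE (spin (z i) *: th) 1%:M (p m i).
  pose K : R := m.+1%:R; pose F := {ffun 'I_d -> 'I_(N m).+1}.
  pose c i (k : F) := g i (\col_j bnode K (N m) (k j)).
  pose b k x := bweight (bparam K x) (N m) k.
  transitivity (EP (fun w => \sum_(k : {ffun 'I_n -> F}) (\prod_i c i (k i)) *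
      \prod_i \prod_j b (k i j) (X w i j))).
    apply: eq_Rintegral => w _; rewrite /p /bern bigA_distr_bigA/=.
    apply: eq_bigr => k _; rewrite -big_split/=; apply: eq_bigr => i _; congr (_ * _).
    by apply: eq_bigr => j _; rewrite mxE.
  have bmp (k : {ffun 'I_n -> F}) : bmeas (fun w => \prod_i \prod_j b (k i j) (X w i j)).
    apply: bmeas_prod => i; apply: bmeas_prod => j; split; last by exists 1 => w; exact: bw01.
    apply: (measurableT_comp _ (mX i j)); apply: continuous_measurable_fun.
    exact: continuous_bweight.
  rewrite EP_sum; last by move=> k; apply: bmeasM => //; exact: bmeas_cst.
  transitivity (\sum_(k : {ffun 'I_n -> F}) \sum_z Q z * \prod_i (c i (k i) * \prod_j
      (\int[normal_prob (0 : R) 1]_(t in setT) b (k i j) (t + th j ord0 * spin (z i)))%R)).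
    apply: eq_bigr => k _; rewrite EPZ//.
    rewrite (@EP_mixture_prod1 (fun i j => b (k i j)) 1); last 2 first.
    - by move=> i j; exact: continuous_bweight.
    - by move=> i j t; exact: bw01.
    rewrite mulr_sumr; apply: eq_bigr => z _.
    by rewrite big_split/= mulrCA.
  rewrite exchange_big/=; apply: eq_bigr => z _.
  rewrite -mulr_sumr -(bigA_distr_bigA (fun i (k : F) => c i k * \prod_j
      (\int[normal_prob (0 : R) 1]_(t in setT) b (k j) (t + th j ord0 * spin (z i)))%R)).
  congr (_ * _); apply: eq_bigr => i _; rewrite /p /bern.
  have eb k : expgrow1 (b k).
    by apply: (@expgrow1_bounded _ _ 1) => [|x]; [exact: continuous_bweight|exact: bw01].
  have ab (k : F) : admissible (fun v : 'cV[R]_d => \prod_j b (k j) (v j ord0)).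
    apply: admissible_prod => j; apply: (@admissible_bounded _ _ _ 1) => [v|v].
      apply: (cvg_comp (fun v : 'cV[R]_d => v j ord0) (b (k j))).
        exact: coord_continuous.
      exact: continuous_bweight.
    exact: bw01.
  rewrite [RHS](@gaussE_sum _ _ _ _ _ _ (fun (k : F) v => c i k * \prod_j b (k j) (v j ord0)));
    last by move=> k; exact: admissibleZ (ab k).
  apply: eq_bigr => k _.
  rewrite (gaussEZ _ _ _ (ab k)) (gaussE_prod _ (fun j : 'I_d => eb (k j))); congr (_ * _).
  by apply: eq_bigr => j _; apply: eq_Rintegral => t _; rewrite mxE [in RHS]mulrC.
have lim2 : (fun m => EP (fun w => \prod_i p m i (xrow w i))) @ \oo -->
    \sum_z Q z * \prod_i gaussE (spin (z i) *: th) 1%:M (g i).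
  under eq_fun do rewrite Ep.
  apply: cvg_sumr => z; apply: cvgM; first exact: cvg_cst.
  apply: cvg_big => [|i _]; first exact: mul_continuous.
  apply: (@gaussE_dct _ _ _ _ (fun m => p m i) _ (cst M)).
  - exact: bcont_admissible.
  - exact: admissible_cst.
  - by move=> m; case: (bp m i).
  - by move=> m v; exact: pM.
  - exact: gN.
exact: cvg_unique lim1 lim2.
Qed.

Lemma gaussE_spin b (g : 'cV[R]_d -> R) : admissible g -> (forall v, g (- v) = g v) ->
  gaussE (spin b *: th) 1%:M g = gaussE th 1%:M g.
Proof.
move=> ag geven; case: b; rewrite /spin ?scale1r// scaleN1r gaussE_oppr//.
exact: eq_gaussE.
Qed.

(* The spins only flip the signs of the Gaussian means, which even functions do not see. *)
Lemma EP_even_prod (g : 'I_n -> 'cV[R]_d -> R) : \sum_z Q z = 1 ->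
  (forall i, bcont (g i)) -> (forall i v, g i (- v) = g i v) ->
  EP (fun w => \prod_i g i (xrow w i)) = \prod_i gaussE th 1%:M (g i).
Proof.
move=> Q1 bg geven; rewrite EP_mixture_prod//.
transitivity (\sum_z Q z * \prod_i gaussE th 1%:M (g i)).
  apply: eq_bigr => z _; congr (_ * _); apply: eq_bigr => i _.
  by rewrite gaussE_spin//; exact: bcont_admissible.
by rewrite -mulr_suml Q1 mul1r.
Qed.

End MixtureLaw.

(** * Sums of even functions of the rows *)

Section GaussianTaylor.
Context {R : realType} {d : nat}.
Variables (th : 'cV[R]_d) (u : 'cV[R]_d -> R).
Local Notation gam f := (gaussE th 1%:M f).
Hypotheses (au : admissible u) (u0 : gam u = 0).

Lemma gaussE_norm_sub_le (f h k : 'cV[R]_d -> R) : admissible f -> admissible h -> admissible k ->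
  (forall v, `|f v - h v| <= k v) -> `|gam f - gam h| <= gam k.
Proof.
move=> af ah ak fhk.
have aNf : admissible (fun v => -1 * f v) by exact: admissibleZ.
have aNh : admissible (fun v => -1 * h v) by exact: admissibleZ.
have e1 : gam f - gam h = gam (fun v => f v + -1 * h v) by rewrite gaussED// gaussEZ// mulN1r.
have e2 : gam h - gam f = gam (fun v => h v + -1 * f v) by rewrite gaussED// gaussEZ// mulN1r.
rewrite ler_norml -[X in _ <= X](opprB (gam h)) lerN2 e1 e2.
apply/andP; split; apply: gaussE_le => //; try exact: admissibleD.
  by move=> v; have := fhk v; rewrite mulN1r distrC; exact: le_trans (ler_norm _).
by move=> v; have := fhk v; rewrite mulN1r; exact: le_trans (ler_norm _).
Qed.

Lemma admissible_cos (s : R) : admissible (fun v => cos (s * u v)).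
Proof.
have [cu _] := admissibleZ s au.
by have := bcont_admissible (bcont_cos 0 cu); under eq_fun do rewrite addr0.
Qed.

Lemma admissible_sin (s : R) : admissible (fun v => sin (s * u v)).
Proof.
have [cu _] := admissibleZ s au.
apply: (@admissible_bounded _ _ _ 1) => v; last exact: sin_max.
apply: (cvg_comp (fun v => s * u v) sin (cu v)); exact: continuous_sin.
Qed.

Lemma gaussE_cos_taylor (s : R) :
  `|gam (fun v => cos (s * u v)) - (1 - s ^+ 2 / 2 * gam (fun v => u v ^+ 2))|
    <= s ^+ 4 * gam (fun v => u v ^+ 4).
Proof.
have a2 := admissibleX 2 au; have a4 := admissibleX 4 au.
have a2' : admissible (fun v => - (s ^+ 2 / 2) * u v ^+ 2) by exact: admissibleZ.
have -> : 1 - s ^+ 2 / 2 * gam (fun v => u v ^+ 2) =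
    gam (fun v => 1 + - (s ^+ 2 / 2) * u v ^+ 2).
  by rewrite gaussED ?gaussE_cst ?gaussEZ ?mulNr//; exact: admissible_cst.
rewrite -gaussEZ//; apply: gaussE_norm_sub_le.
- exact: admissible_cos.
- by apply: admissibleD => //; exact: admissible_cst.
- exact: admissibleZ.
- move=> v; have := norm_cos_taylor2 (s * u v).
  rewrite -normrX exprMn [X in _ <= X -> _]ger0_norm; last first.
    by rewrite -[4%N]/(2 * 2)%N exprM sqr_ge0.
  by rewrite exprMn (_ : _ - (_ + _) = cos (s * u v) - 1 + s ^+ 2 * u v ^+ 2 / 2)//; ring.
Qed.

(** As [u] is centred, the linear term integrates to zero and the sine is of third order. *)
Lemma gaussE_sin_taylor (s : R) : 0 <= s ->
  `|gam (fun v => sin (s * u v))| <= s ^+ 3 * gam (fun v => `|u v| ^+ 3).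
Proof.
move=> s0; rewrite -[X in `|X|]subr0.
have -> : 0 = gam (fun v => s * u v) by rewrite gaussEZ// u0 mulr0.
have a3 := admissibleX 3 (admissible_norm au).
rewrite -gaussEZ//; apply: gaussE_norm_sub_le.
- exact: admissible_sin.
- exact: admissibleZ.
- exact: admissibleZ.
- by move=> v; rewrite (le_trans (norm_sinB_le _))// normrM exprMn (ger0_norm s0).
Qed.

End GaussianTaylor.

(** * Moment bounds and central limit theorem for sums of even functions *)

Section EvenRows.
Context {R : realType} {dd : measure_display} {T : measurableType dd}.
Variables (P : probability T R) (n d : nat) (x : T -> 'I_n -> 'cV[R]_d) (th : 'cV[R]_d).
Hypothesis mx : forall i j, measurable_fun setT (fun w => x w i j ord0).
Local Notation EP Y := (\int[P]_(w in setT) Y w)%R.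
Local Notation gam f := (gaussE th 1%:M f).
Hypothesis even_prod : forall g : 'I_n -> 'cV[R]_d -> R,
  (forall i, bcont (g i)) -> (forall i v, g i (- v) = g i v) ->
  EP (fun w => \prod_i g i (x w i)) = \prod_i gam (g i).
Implicit Types (f g u : 'cV[R]_d -> R).

Lemma bmeas_row i g : bcont g -> bmeas (fun w => g (x w i)).
Proof.
move=> bg; split; last by case: bg => _ [M gM]; exists M.
exact: (measurable_bcont (Y := fun w => x w i)).
Qed.

Lemma EP_even1 i g : bcont g -> (forall v, g (- v) = g v) ->
  EP (fun w => g (x w i)) = gam g.
Proof.
move=> bg eg; pose G k : 'cV[R]_d -> R := if k == i then g else cst 1.
have : EP (fun w => \prod_k G k (x w k)) = \prod_k gam (G k).
  by apply: even_prod => k; rewrite /G; case: eqP => // _; exact: bcont_cst.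
rewrite [RHS](bigD1 i)//= {2}/G eqxx [X in _ * X]big1 ?mulr1; last first.
  by move=> k /negbTE ki; rewrite /G ki; exact: gaussE_cst.
move=> <-; apply: eq_Rintegral => w _; rewrite (bigD1 i)//= {1}/G eqxx big1 ?mulr1//.
by move=> k /negbTE ki; rewrite /G ki.
Qed.

Lemma EP_even2 i j g h : i != j -> bcont g -> (forall v, g (- v) = g v) ->
  bcont h -> (forall v, h (- v) = h v) ->
  EP (fun w => g (x w i) * h (x w j)) = gam g * gam h.
Proof.
move=> ij bg eg bh eh.
pose G k : 'cV[R]_d -> R := if k == i then g else if k == j then h else cst 1.
have ji : j == i = false by rewrite eq_sym; exact: negbTE.
have : EP (fun w => \prod_k G k (x w k)) = \prod_k gam (G k).
  by apply: even_prod => k; rewrite /G; case: eqP => // _; case: eqP => // _; exact: bcont_cst.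
rewrite [RHS](bigD1 i)//= {2}/G eqxx [X in _ * X](bigD1 j) ?ji//= {2}/G ji eqxx.
rewrite [X in _ * (_ * X)]big1 ?mulr1; last first.
  by move=> k /andP[/negbTE ki /negbTE kj]; rewrite /G ki kj; exact: gaussE_cst.
move=> <-; apply: eq_Rintegral => w _.
rewrite (bigD1 i)//= {1}/G eqxx (bigD1 j) ?ji//= {1}/G ji eqxx big1 ?mulr1//.
by move=> k /andP[/negbTE ki /negbTE kj]; rewrite /G ki kj.
Qed.

Lemma gaussE_clamp_cvg u : admissible u ->
  (fun m : nat => gam (fun v => clamp m%:R (u v))) @ \oo --> gam u.
Proof.
move=> au; apply: (gaussE_dct (h := fun v => `|u v|)) => //.
- exact: admissible_norm.
- by move=> m; case: (bcont_clamp (ler0n R m) au.1).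
- by move=> m v; exact: norm_clamp_le_norm.
- by move=> v; exact: clamp_cvg.
Qed.

Lemma gaussE_clamp_sqr_le u (M : R) : 0 <= M -> admissible u ->
  gam (fun v => clamp M (u v) ^+ 2) <= gam (fun v => u v ^+ 2).
Proof.
move=> M0 au; apply: gaussE_le.
- exact: admissibleX (bcont_admissible (bcont_clamp M0 au.1)).
- exact: admissibleX.
- by move=> v; rewrite -[leLHS]real_normK ?num_real// -[leRHS]real_normK ?num_real//;
    rewrite lerXn2r ?nnegrE// norm_clamp_le_norm.
Qed.

Lemma cvg_min (M y : R) (y_ : nat -> R) : y_ @ \oo --> y ->
  (fun m => Num.min M (y_ m)) @ \oo --> Num.min M y.
Proof.
have cM : continuous (fun z : R => Num.min M z).
  by move=> z; apply: continuous_min; [exact: cst_continuous|exact: cvg_id].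
by move=> yy; apply: (cvg_comp y_ (fun z => Num.min M z) yy); exact: cM.
Qed.

(* Truncating the summands reduces both moment bounds to the bounded case. *)
Lemma EP_min_limit u (q : R -> R) (M : R) (B : nat -> R) (b : R) : 0 <= M ->
  continuous u -> continuous q -> (forall y, 0 <= q y) ->
  (forall m, EP (fun w => q (\sum_i clamp m%:R (u (x w i)))) <= B m) -> B @ \oo --> b ->
  EP (fun w => Num.min M (q (\sum_i u (x w i)))) <= b.
Proof.
move=> M0 cu cq q0 qB Bb.
have mS (u' : 'cV[R]_d -> R) : continuous u' ->
    measurable_fun setT (fun w => q (\sum_i u' (x w i))).
  move=> cu'; apply: (measurableT_comp (continuous_measurable_fun cq)).
  by apply: measurable_sum => i; exact: (measurable_continuous_vec (Y := fun w => x w i)).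
have minM (y : R) : 0 <= y -> `|Num.min M y| <= M.
  by move=> y0; rewrite ger0_norm ?le_min ?M0//= ge_min lexx.
have bc m : continuous (fun v => clamp m%:R (u v)).
  by case: (bcont_clamp (ler0n R m) cu).
have mmin m : measurable_fun setT (fun w => Num.min M (q (\sum_i clamp m%:R (u (x w i))))).
  by apply: measurable_minr => //; exact: (mS _ (bc m)).
have [_ lim] : bmeas (fun w => Num.min M (q (\sum_i u (x w i)))) /\
    (fun m : nat => EP (fun w => Num.min M (q (\sum_i clamp m%:R (u (x w i)))))) @ \oo -->
    EP (fun w => Num.min M (q (\sum_i u (x w i)))).
  apply: (@EP_dct _ _ _ P _ _ M) => //.
  - by move=> m w; exact: minM.
  - move=> w; apply: cvg_min; apply: (cvg_comp _ q); last exact: cq.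
    by apply: cvg_sumr => i; exact: clamp_cvg.
apply: (ler_cvg_to lim Bb); near=> m.
apply: le_trans (qB m); apply: EP_le.
- by apply: bmeas_min => //; exact: (mS _ (bc m)).
- split; first exact: (mS _ (bc m)).
  (* The truncated sum lives in the compact interval [-n m, n m], on which the continuous [q] is
     bounded. *)
  have [C qC] : exists C, forall y, `|y| <= n%:R * m%:R -> `|q y| <= C.
    have [C [_ HC]] := compact_bounded (continuous_compact (continuous_subspaceT cq)
      (@segment_compact R (- (n%:R * m%:R)) (n%:R * m%:R))).
    exists (C + 1) => y yb; apply: (HC (C + 1)); first by rewrite ltrDl.
    by exists y => //=; rewrite in_itv/= -ler_norml.
  exists C => w; apply: qC; rewrite (le_trans (ler_norm_sum _ _ _))//.
  rewrite -[X in X%:R * _](card_ord n) mulr_natl -sumr_const.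
  by apply: ler_sum => i _; exact: norm_clamp_le.
- by move=> w; rewrite ge_min lexx orbT.
Unshelve. all: by end_near. Qed.

Lemma EP_min_sum_le u (M : R) : 0 <= M -> admissible u -> (forall v, 0 <= u v) ->
  (forall v, u (- v) = u v) ->
  EP (fun w => Num.min M (`|\sum_i u (x w i)|)) <= n%:R * gam u.
Proof.
move=> M0 au u0 eu.
apply: (@EP_min_limit u (fun y => `|y|) M
    (fun m : nat => n%:R * gam (fun v => clamp m%:R (u v)))) => //.
- exact: au.1.
- exact: norm_continuous.
- move=> m; have bc := bcont_clamp (ler0n R m) au.1.
  rewrite (_ : (fun w => _) = (fun w => \sum_i clamp m%:R (u (x w i)))); last first.
    apply/funext => w; rewrite ger0_norm//; apply: sumr_ge0 => i _.
    by rewrite /clamp le_max le_min u0 ler0n orbT.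
  rewrite EP_sum; last by move=> i; exact: (bmeas_row i bc).
  rewrite (eq_bigr (fun=> gam (fun v => clamp m%:R (u v)))).
    by rewrite sumr_const card_ord mulr_natl.
  by move=> i _; rewrite (EP_even1 i bc)// => v; rewrite eu.
- by apply: cvgM; [exact: cvg_cst|exact: gaussE_clamp_cvg].
Qed.

(** Even functions of distinct rows have product expectations. The truncated summands are not
    centred, so the off-diagonal terms are bounded by n^2 times the squared truncated mean, which
    tends to zero with the truncation. *)
Lemma EP_min_sqr_sum_le u (M : R) : 0 <= M -> admissible u -> gam u = 0 ->
  (forall v, u (- v) = u v) ->
  EP (fun w => Num.min M ((\sum_i u (x w i)) ^+ 2)) <= n%:R * gam (fun v => u v ^+ 2).
Proof.
move=> M0 au u0 eu.
apply: (@EP_min_limit u (fun y => y ^+ 2) M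
    (fun m : nat => n%:R * gam (fun v => u v ^+ 2)
      + n%:R ^+ 2 * (gam (fun v => clamp m%:R (u v)) * gam (fun v => clamp m%:R (u v))))) => //.
- exact: au.1.
- exact: exprn_continuous.
- by move=> y; exact: sqr_ge0.
- move=> m; have bc := bcont_clamp (ler0n R m) au.1.
  have ec v : clamp m%:R (u (- v)) = clamp m%:R (u v) by rewrite eu.
  rewrite (_ : (fun w => _) = (fun w => \sum_i \sum_j
      clamp m%:R (u (x w i)) * clamp m%:R (u (x w j)))); last first.
    by apply/funext => w; rewrite expr2 big_distrlr.
  have bm i : bmeas (fun w => clamp m%:R (u (x w i))) by exact: (bmeas_row i bc).
  rewrite EP_sum; last by move=> i; apply: bmeas_sum => j; exact: bmeasM.
  have nsum (z : R) : n%:R * z = \sum_(i < n) z by rewrite sumr_const card_ord mulr_natl.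
  rewrite expr2 -mulrA !nsum -big_split/=.
  apply: ler_sum => i _; rewrite EP_sum; last by move=> j; exact: bmeasM.
  rewrite (bigD1 i)//=; apply: lerD.
    rewrite (_ : (fun w => _) = (fun w => clamp m%:R (u (x w i)) ^+ 2))//.
    rewrite (@EP_even1 i (fun v => clamp m%:R (u v) ^+ 2)).
    + exact: gaussE_clamp_sqr_le.
    + exact: bcontM.
    + by move=> v; rewrite ec.
  rewrite [leRHS](bigD1 i)//=; apply: ler_wpDl; first by rewrite -expr2 sqr_ge0.
  apply: ler_sum => j ji; rewrite (EP_even2 (g := fun v => clamp m%:R (u v)) (h := fun v => clamp m%:R (u v)))//.
  by rewrite eq_sym.
- have e : n%:R * gam (fun v => u v ^+ 2) =
      n%:R * gam (fun v => u v ^+ 2) + n%:R ^+ 2 * (gam u * gam u).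
    by rewrite u0 !mulr0 addr0.
  rewrite [X in _ --> X]e.
  apply: cvgD; first exact: cvg_cst.
  apply: cvgM; first exact: cvg_cst.
  by apply: cvgM; exact: gaussE_clamp_cvg.
Qed.

Definition rowcos u k c w := cos (\sum_(i < n | (i < k)%N) u (x w i) + c).

(** The real part of (a + i b)^k e^(i c): lowering the phase by pi/2 yields the imaginary part, so
    that only real numbers occur. *)
Fixpoint cosrec (a b : R) k c : R :=
  if k is k'.+1 then a * cosrec a b k' c - b * cosrec a b k' (c - pi / 2) else cos c.

Lemma bcont_sin u : continuous u -> bcont (fun v => sin (u v)).
Proof.
move=> cu; split; last by exists 1 => v; exact: sin_max.
by move=> v; apply: (cvg_comp u sin (cu v)); exact: continuous_sin.
Qed.

Lemma bmeas_rowcos u k c : continuous u -> bmeas (rowcos u k c).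
Proof.
move=> cu; split; last by exists 1 => w; exact: cos_max.
apply: (measurableT_comp (continuous_measurable_fun (@continuous_cos R))).
apply: measurable_funD => //.
under eq_fun do rewrite -big_filter.
apply: measurable_sum => i; exact: (measurable_continuous_vec (Y := fun w => x w i)).
Qed.

(** Substitute for independence. The rows not yet summed carry arbitrary even test functions; the
    addition formula hands row k to them as cos u or sin u, which closes the induction. *)
Lemma EP_rowcos_prod u k c (g : 'I_n -> 'cV[R]_d -> R) : (k <= n)%N -> continuous u ->
  (forall v, u (- v) = u v) -> (forall i, bcont (g i)) -> (forall i v, g i (- v) = g i v) ->
  EP (fun w => rowcos u k c w * \prod_(i < n | (k <= i)%N) g i (x w i)) =
  cosrec (gam (fun v => cos (u v))) (gam (fun v => sin (u v))) k c
    * \prod_(i < n | (k <= i)%N) gam (g i).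
Proof.
move=> + cu eu; elim: k c g => [|k IH] c g kn bg eg.
  rewrite -even_prod//= -EPZ; last by apply: bmeas_prod => i; exact: bmeas_row.
  by apply: eq_Rintegral => w _; congr (cos _ * _); rewrite big_pred0// add0r.
pose k' := Ordinal kn.
pose upd (f : 'cV[R]_d -> R) i : 'cV[R]_d -> R := if i == k' then f else g i.
have splitk (F : 'I_n -> R) : \prod_(i < n | (k <= i)%N) F i =
    F k' * \prod_(i < n | (k.+1 <= i)%N) F i.
  rewrite (bigD1 k')//=; congr (_ * _); apply: eq_bigl => i.
  by rewrite ltn_neqAle eq_sym andbC.
have updk f w : \prod_(i < n | (k <= i)%N) upd f i (x w i) =
    f (x w k') * \prod_(i < n | (k.+1 <= i)%N) g i (x w i).
  rewrite splitk /upd eqxx; congr (_ * _); apply: eq_bigr => i ki.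
  by case: eqP => // ik; move: ki; rewrite ik/= ltnn.
have updg f : \prod_(i < n | (k <= i)%N) gam (upd f i) =
    gam f * \prod_(i < n | (k.+1 <= i)%N) gam (g i).
  rewrite splitk /upd eqxx; congr (_ * _); apply: eq_bigr => i ki.
  by case: eqP => // ik; move: ki; rewrite ik/= ltnn.
have bupd f i : bcont f -> bcont (upd f i) by rewrite /upd; case: eqP.
have eupd f i v : (forall v, f (- v) = f v) -> upd f i (- v) = upd f i v.
  by move=> ef; rewrite /upd; case: eqP.
have bcos : bcont (fun v => cos (u v)).
  by have := bcont_cos 0 cu; under eq_fun do rewrite addr0.
have bsin := bcont_sin cu.
have bm f c' : bcont f ->
    bmeas (fun w => rowcos u k c' w * \prod_(i < n | (k <= i)%N) upd f i (x w i)).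
  move=> bf; apply: bmeasM; first exact: bmeas_rowcos.
  rewrite (_ : (fun w => _) = (fun w => \prod_(i <- [seq i : 'I_n <- index_enum 'I_n | (k <= i)%N])
    upd f i (x w i))); last by apply/funext => w; rewrite big_filter.
  by apply: bmeas_prod => i; apply: bmeas_row; exact: bupd.
transitivity (EP (fun w =>
    rowcos u k c w * \prod_(i < n | (k <= i)%N) upd (fun v => cos (u v)) i (x w i) +
    (-1) * (rowcos u k (c - pi / 2) w *
      \prod_(i < n | (k <= i)%N) upd (fun v => sin (u v)) i (x w i)))).
  apply: eq_Rintegral => w _; rewrite !updk /rowcos.
  rewrite (bigD1 k') ?ltnSn//= (eq_bigl (fun i : 'I_n => (i < k)%N)); last first.
    by move=> i; rewrite ltnS [in RHS]ltn_neqAle andbC.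
  rewrite -addrA addrC cosD addrA.
  have -> (s : R) : cos (s - pi / 2) = sin s by rewrite -[in RHS](subrK (pi/2) s) sinDpihalf.
  ring.
rewrite EPD; [|exact: bm|by apply: bmeasM; [exact: bmeas_cst|exact: bm]].
rewrite EPZ; last exact: bm.
rewrite !IH ?updg//=; try exact: ltnW.
- ring.
- by move=> i; exact: bupd.
- by move=> i v; apply: eupd => v'; rewrite eu.
- by move=> i; exact: bupd.
- by move=> i v; apply: eupd => v'; rewrite eu.
Qed.

Lemma EP_rowcos u k c : (k <= n)%N -> continuous u -> (forall v, u (- v) = u v) ->
  EP (rowcos u k c) =
  cosrec (gam (fun v => cos (u v))) (gam (fun v => sin (u v))) k c.
Proof.
move=> kn cu eu.
have := @EP_rowcos_prod u k c (fun=> cst 1) kn cu eu (fun=> bcont_cst 1) (fun _ _ => erefl).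
rewrite [X in _ * X]big1 ?mulr1; last by move=> i _; exact: gaussE_cst.
move=> <-; apply: eq_Rintegral => w _.
by rewrite big1 ?mulr1.
Qed.

(** The factors a + i b are replaced by the real number [A] one at a time, and each replacement
    costs at most |a - A| + |b|. *)
Lemma EP_cos_sum_le u c (A : R) : 0 <= A <= 1 -> continuous u ->
  (forall v, u (- v) = u v) ->
  `|EP (fun w => cos (\sum_i u (x w i) + c)) - A ^+ n * cos c|
    <= n%:R * (`|gam (fun v => cos (u v)) - A| + `|gam (fun v => sin (u v))|).
Proof.
move=> /andP[A0 A1] cu eu.
rewrite (_ : (fun w => _) = rowcos u n c); last first.
  apply/funext => w; rewrite /rowcos; congr (cos (_ + c)).
  by apply: eq_bigl => i; rewrite ltn_ord.
rewrite EP_rowcos//; have := leqnn n; set a := gam _; set b := gam _.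
(* Bounded by 1 because it is the expectation of a cosine. *)
have m1 k c' : (k <= n)%N -> `|cosrec a b k c'| <= 1.
  move=> kn; rewrite /a /b -EP_rowcos//; apply: EP_norm_le; first exact: bmeas_rowcos.
  by move=> w; exact: cos_max.
elim: {1 3 4 5}n c => [|k IH] c kn; first by rewrite /= expr0 mul1r subrr normr0 mul0r.
have kn' := ltnW kn.
rewrite /= (_ : _ - _ - _ = (a - A) * cosrec a b k c + A * (cosrec a b k c - A ^+ k * cos c)
  + (- b * cosrec a b k (c - pi / 2))); last by rewrite exprS; ring.
rewrite -[k.+1%:R]natr1 [leRHS]mulrDl mul1r (le_trans (ler_normD _ _))//.
have h1 : `|(a - A) * cosrec a b k c| <= `|a - A|.
  by rewrite normrM ler_piMr// m1.
have h2 : `|- b * cosrec a b k (c - pi / 2)| <= `|b|.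
  by rewrite normrM normrN ler_piMr// m1.
have h3 : `|A * (cosrec a b k c - A ^+ k * cos c)| <= k%:R * (`|a - A| + `|b|).
  by rewrite normrM (ger0_norm A0) (le_trans _ (IH c kn'))// ler_piMl.
have h4 := ler_normD ((a - A) * cosrec a b k c) (A * (cosrec a b k c - A ^+ k * cos c)).
by clearbody a b; lra.
Qed.

(** With s = 1/sqrt n each factor is replaced at cost s^4 (m4 + v2^2) + s^3 m3, where m4, m3, v2 are
    the fourth, third absolute and second moments of [u]; n such errors leave order s. *)
Lemma EP_cos_clt u c : (0 < n)%N -> admissible u -> gam u = 0 -> (forall v, u (- v) = u v) ->
  `|EP (fun w => cos ((Num.sqrt n%:R)^-1 * (\sum_i u (x w i)) + c))
     - expR (- (gam (fun v => u v ^+ 2) / 2)) * cos c| <=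
  (gam (fun v => u v ^+ 4) + gam (fun v => u v ^+ 2) ^+ 2 + gam (fun v => `|u v| ^+ 3))
    / Num.sqrt n%:R.
Proof.
move=> n0 au u0 eu; set v2 := gam (fun v => u v ^+ 2).
have n1 : 0 < n%:R :> R by rewrite ltr0n.
set s := (Num.sqrt n%:R)^-1.
have s0 : 0 < s by rewrite invr_gt0 sqrtr_gt0.
have s2 : s ^+ 2 = n%:R^-1 by rewrite exprVn sqr_sqrtr// ler0n.
have sn : n%:R * s ^+ 2 = 1 by rewrite s2 mulfV ?gt_eqF.
have s1 : s <= 1.
  by rewrite invf_le1 ?sqrtr_gt0// -[leLHS]sqrtr1 ler_sqrt ?ler0n// ler1n.
have v20 : 0 <= v2.
  rewrite -(gaussE_cst th 1%:M 0); apply: gaussE_le; first exact: admissible_cst.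
    exact: admissibleX.
  by move=> v; rewrite sqr_ge0.
(* The n-th root of the Gaussian limit, which agrees with E cos(s u) to second order in s. *)
pose A := expR (- (s ^+ 2 * v2 / 2)).
have x0 : 0 <= s ^+ 2 * v2 / 2.
  by apply: divr_ge0 => //; apply: mulr_ge0 => //; exact: sqr_ge0.
have A01 : 0 <= A <= 1.
  by rewrite expR_ge0/= -[leRHS](expR0 R) ler_expR oppr_le0.
have An : A ^+ n = expR (- (v2 / 2)).
  rewrite /A -expRM_natl; congr expR.
  by rewrite mulrN mulrA mulrA sn mul1r.
have su_c : continuous (fun v => s * u v) by case: (admissibleZ s au).
have := @EP_cos_sum_le (fun v => s * u v) c A A01 su_c.
rewrite An => /(_ _)/le_trans - H.
have -> : (fun w => cos (s * (\sum_i u (x w i)) + c)) =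
    (fun w => cos (\sum_i s * u (x w i) + c)) by apply/funext => w; rewrite mulr_sumr.
apply: H => [v|]; first by rewrite eu.
have h1 := gaussE_cos_taylor th au s.
have h2 := gaussE_sin_taylor au u0 (ltW s0).
have h3 := expRN_taylor1 x0.
set a := gam _ in h1 *; set b := gam _ in h2 *.
set m4 := gam (fun v => u v ^+ 4) in h1 *; set m3 := gam _ in h2 *.
have m40 : 0 <= m4.
  rewrite -(gaussE_cst th 1%:M 0); apply: gaussE_le; first exact: admissible_cst.
    exact: admissibleX.
  by move=> v; rewrite -[4%N]/(2 * 2)%N exprM sqr_ge0.
have h4 : `|a - A| <= s ^+ 4 * (m4 + v2 ^+ 2).
  have -> : a - A = (a - (1 - s ^+ 2 / 2 * v2)) - (A - (1 - s ^+ 2 * v2 / 2)) by ring.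
  rewrite (le_trans (ler_normB _ _))// mulrDr lerD// (le_trans h3)//.
  rewrite (_ : (s ^+ 2 * v2 / 2) ^+ 2 = s ^+ 4 * v2 ^+ 2 / 4); last by field.
  by rewrite ler_piMr ?mulr_ge0 ?exprn_ge0 ?(ltW s0)// invf_le1 ?ler1n.
apply: (@le_trans _ _ (n%:R * (s ^+ 4 * (m4 + v2 ^+ 2) + s ^+ 3 * m3))).
  by rewrite ler_pM2l// lerD.
rewrite (_ : n%:R * _ = n%:R * s ^+ 2 * (s ^+ 2 * (m4 + v2 ^+ 2) + s * m3)); last by ring.
rewrite sn mul1r [leRHS]mulrC [leRHS]mulrDr lerD2r// ler_wpM2r//.
  by rewrite addr_ge0// sqr_ge0.
by rewrite expr2 ler_piMl// ltW.
Qed.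

End EvenRows.

(** * Fisher information *)

Section CholeskyFactor.
Context {R : realType}.

(** Block elimination on the first pivot. In the semidefinite case the pivot may vanish; then its
    column vanishes too, and with 0^-1 = 0 the same formula for the factor remains valid. *)
Lemma cholesky_factor d (S : 'M[R]_d) : S^T = S ->
  (forall v : 'cV[R]_d, 0 <= (v^T *m S *m v) ord0 ord0) ->
  exists L : 'M[R]_d, L *m L^T = S.
Proof.
elim: d S => [|d IH] S symS posS; first by exists 0; apply/matrixP => -[].
pose S' : 'M[R]_(1 + d) := S.
pose a : R := ulsubmx S' ord0 ord0; pose b : 'cV[R]_d := dlsubmx S'.
pose C : 'M[R]_d := drsubmx S'.
have SE : S' = block_mx a%:M b^T b C.
  by rewrite -[LHS]submxK -mx11_scalar /b trmx_dlsub (_ : S'^T = S').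
have symC : C^T = C by rewrite /C trmx_drsub (_ : S'^T = S').
have posS' (v : 'cV[R]_(1 + d)) : 0 <= (v^T *m S' *m v) ord0 ord0 by exact: posS.
have qE (t : R) (y : 'cV[R]_d) : 0 <= t ^+ 2 * a + 2 * t * (b^T *m y) ord0 ord0
    + (y^T *m C *m y) ord0 ord0.
  have := posS' (col_mx t%:M y); rewrite SE tr_col_mx mul_row_block mul_row_col tr_scalar_mx !mulmxDl.
  have -> : y^T *m b = (b^T *m y)^T by rewrite trmx_mul trmxK.
  rewrite !mul_mx_scalar mul_scalar_mx -scalemxAl.
  move: (b^T *m y) (y^T *m C *m y) => p q; rewrite !mxE eqxx mulr1n; congr (_ <= _).
  by ring.
have a0 : 0 <= a.
  have := qE 1 0; rewrite mulmx0 [(0^T *m _ *m _)]mulmx0 !mxE mulr0 !addr0 expr1n mul1r.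
  by [].
have b0 : a = 0 -> b = 0.
  move=> a00; have by0 (y : 'cV[R]_d) : (b^T *m y) ord0 ord0 = 0.
    set p := (b^T *m y) ord0 ord0; set q := (y^T *m C *m y) ord0 ord0.
    apply/eqP/negPn/negP => p0.
    (* With a zero pivot the form is affine in t, and this t gives it the value -1. *)
    have := qE (- (q + 1) / (2 * p)) y; rewrite a00 mulr0 add0r -/p -/q.
    have -> : 2 * (- (q + 1) / (2 * p)) * p + q = -1 by field.
    by rewrite oppr_ge0 ler10.
  apply/colP => j; have := by0 (delta_mx j ord0).
  by rewrite -colE !mxE.
pose s := Num.sqrt a.
have s2 : s * s = a by rewrite -expr2 sqr_sqrtr.
(* Induction on the Schur complement; it is nonnegative as the value of the form at the minimising t
   = -p/a, or at t = 0 if the pivot vanishes. *)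
have [|y|L' L'E] := IH (C - s^-1 ^+ 2 *: (b *m b^T)).
- by rewrite linearB/= linearZ/= trmx_mul trmxK symC.
- rewrite mulmxBr mulmxBl -scalemxAr -scalemxAl [X in 0 <= X]mxE [X in 0 <= _ + X]mxE [X in 0 <= _ - X]mxE.
  have -> : (y^T *m (b *m b^T) *m y) ord0 ord0 = (b^T *m y) ord0 ord0 ^+ 2.
    have -> : y^T *m (b *m b^T) *m y = (b^T *m y)^T *m (b^T *m y).
      by rewrite trmx_mul trmxK !mulmxA.
    by rewrite mxE big_ord1 mxE expr2.
  set p := (b^T *m y) ord0 ord0; set q := (y^T *m C *m y) ord0 ord0.
  have [a00|an0] := eqVneq a 0.
    have := qE 0 y; rewrite -/p -/q a00 /s a00 sqrtr0 invr0 !expr0n/= !(mul0r, mulr0, add0r) subr0.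
    by [].
  have := qE (- p / a) y; rewrite -/p -/q exprVn [s ^+ 2]expr2 s2; congr (_ <= _).
  by field.
pose L : 'M[R]_(1 + d) := block_mx s%:M 0 (s^-1 *: b) L'.
suff LE : L *m L^T = S' by exists L.
rewrite /L SE tr_block_mx mulmx_block L'E !mul0mx tr_scalar_mx !addr0.
rewrite trmx0 !mulmx0 addr0 linearZ/= -!scalemxAr -!scalemxAl mul_scalar_mx mul_mx_scalar.
rewrite scale_scalar_mx s2 scalerA scalerA [_ - _]addrC addrA -expr2 subrr add0r.
rewrite mul_scalar_mx scalerA.
have [a00|an0] := eqVneq a 0; first by rewrite (b0 a00) trmx0 !scaler0.
have sn0 : s != 0 by rewrite gt_eqF// sqrtr_gt0 lt_def an0.
by rewrite mulVf// !scale1r.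
Qed.

End CholeskyFactor.

(** * Moments of the score and the Fisher information *)

Section GaussianMoments.
Context {R : realType} {d : nat}.
Variable th : 'cV[R]_d.
Local Notation gam f := (gaussE th 1%:M f).
Local Notation E1 f := (\int[normal_prob (0 : R) 1]_(t in setT) f t)%R.

Lemma continuous_tanhR : continuous (@tanhR R).
Proof. exact: is_derive_continuous (@is_derive_tanhR R). Qed.

Lemma continuous_sechR2 : continuous (fun y : R => sechR y ^+ 2).
Proof. exact: is_derive_continuous (@is_derive_sechR2 R). Qed.

Lemma admissible_tanhR (a : 'cV[R]_d) : admissible (fun v => tanhR (dotv a v)).
Proof.
apply: (@admissible_bounded _ _ _ 1) => v; last exact: norm_tanhR_le1.
by apply: (cvg_comp (dotv a) tanhR (@continuous_dotv R d a v)); exact: continuous_tanhR.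
Qed.

Lemma admissible_sechR2 (a : 'cV[R]_d) : admissible (fun v => sechR (dotv a v) ^+ 2).
Proof.
apply: (@admissible_bounded _ _ _ 1) => v; last by rewrite ger0_norm ?sqr_ge0 ?sechR2_le1.
by apply: (cvg_comp (dotv a) (fun y => sechR y ^+ 2) (@continuous_dotv R d a v)); exact: continuous_sechR2.
Qed.

Lemma admissible_sechR (a : 'cV[R]_d) : admissible (fun v => sechR (dotv a v)).
Proof.
apply: (@admissible_bounded _ _ _ 1) => v; last first.
  rewrite -[leRHS]sqrtr1 -sqrtr_sqr ler_sqrt//; exact: sechR2_le1.
have -> : (fun v => sechR (dotv a v)) = (fun v => Num.sqrt (sechR (dotv a v) ^+ 2)).
  by apply/funext => w; rewrite sqrtr_sqr gtr0_norm ?sechR_gt0.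
have [c _] := admissible_sechR2 a.
by apply: (cvg_comp _ Num.sqrt (c v)); exact: sqrt_continuous.
Qed.

Lemma gaussE_coord i : gam (fun v => v i ord0) = th i ord0.
Proof.
pose h j : R -> R := if j == i then id else cst 1.
have eh j : expgrow1 (h j).
  by rewrite /h; case: eqP => _; [exact: expgrow1_id|exact: expgrow1_cst].
transitivity (gam (fun v => \prod_j h j (v j ord0))).
  apply: eq_gaussE => v; rewrite (bigD1 i)//= big1 ?mulr1 /h ?eqxx//.
  by move=> j /negbTE ->.
rewrite gaussE_prod// (bigD1 i)//= big1 ?mulr1; last first.
  by move=> j /negbTE ji; rewrite /h ji; exact: E1_cst.
rewrite /h eqxx /= E1D; [|exact: expgrow1_id|exact: expgrow1_cst].
by rewrite E1_id E1_cst add0r.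
Qed.

Lemma gaussE_coord2 i j : gam (fun v => v i ord0 * v j ord0) =
  (i == j)%:R + th i ord0 * th j ord0.
Proof.
have [<-|ij] := eqVneq i j.
  pose h j : R -> R := if j == i then fun t => t * t else cst 1.
  have esq : expgrow1 (fun t : R => t * t) by apply: expgrow1M; exact: expgrow1_id.
  have eh k : expgrow1 (h k).
    by rewrite /h; case: eqP => _ //; exact: expgrow1_cst.
  transitivity (gam (fun v => \prod_j h j (v j ord0))).
    apply: eq_gaussE => v; rewrite (bigD1 i)//= big1 ?mulr1 /h ?eqxx//.
    by move=> k /negbTE ->.
  rewrite gaussE_prod// (bigD1 i)//= big1 ?mulr1; last first.
    by move=> k /negbTE ji; rewrite /h ji; exact: E1_cst.
  rewrite /h eqxx /=; set a := th i ord0.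
  transitivity (E1 (fun t => t * t + ((2 * a) * t + a * a))).
    by apply: eq_Rintegral => t _; ring.
  have e2 : expgrow1 (fun t : R => (2 * a) * t).
    by apply: expgrow1M; [exact: expgrow1_cst|exact: expgrow1_id].
  rewrite E1D//; last by apply: expgrow1D => //; exact: expgrow1_cst.
  rewrite E1D//; last exact: expgrow1_cst.
  by rewrite E1Z ?E1_id ?E1_cst ?E1_sqr ?mulr0 ?add0r//; exact: expgrow1_id.
pose h k : R -> R := if (k == i) || (k == j) then id else cst 1.
have eh k : expgrow1 (h k).
  by rewrite /h; case: ifP => _; [exact: expgrow1_id|exact: expgrow1_cst].
have ji : j != i by rewrite eq_sym.
transitivity (gam (fun v => \prod_j h j (v j ord0))).
  apply: eq_gaussE => v; rewrite (bigD1 i)//= (bigD1 j)//= big1 ?mulr1 /h ?eqxx ?orbT//.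
  by move=> k /andP[/negbTE -> /negbTE ->].
rewrite gaussE_prod// (bigD1 i)//= (bigD1 j)//= big1 ?mulr1; last first.
  by move=> k /andP[/negbTE ki /negbTE kj]; rewrite /h ki kj; exact: E1_cst.
rewrite /h !eqxx orbT /= add0r; congr (_ * _).
  by rewrite E1D ?E1_id ?E1_cst ?add0r//; [exact: expgrow1_id|exact: expgrow1_cst].
by rewrite E1D ?E1_id ?E1_cst ?add0r//; [exact: expgrow1_id|exact: expgrow1_cst].
Qed.

(** Cameron-Martin with the shift -th, which recentres the Gaussian; the exponential is the
    likelihood ratio of N(th, I) to N(0, I). *)
Lemma gaussE_tilt f : admissible f ->
  gam f = gaussE 0 1%:M (fun v => f v * expR (dotv th v - dotv th th / 2)).
Proof.
move=> af; pose s (j : nat) : R := if insub j is Some j' then - th j' ord0 else 0.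
rewrite /gaussE (stdgauss_iter_shift s _ (leqnn d) (admissible_affine th 1%:M af)).
apply: eq_stdgauss_iter => g; congr (f _ * _).
  rewrite !mul1mx; apply/colP => j; rewrite !mxE /shiftn ltn_ord /s valK add0r addrC.
  by rewrite -addrA addNr addr0.
rewrite -expR_sum; congr expR; rewrite mul1mx add0r /dotv mulr_suml -sumrB.
by apply: eq_bigr => j _; rewrite /s valK !mxE; field.
Qed.

Lemma gaussE_odd f : admissible f -> (forall v, f (- v) = - f v) ->
  gaussE (0 : 'cV[R]_d) 1%:M f = 0.
Proof.
move=> af fN; have := gaussE_oppr (0 : 'cV[R]_d) af; rewrite oppr0.
rewrite (@eq_gaussE _ _ 0 _ (fun v => f (- v)) (fun v => -1 * f v)); last first.
  by move=> v; rewrite fN mulN1r.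
by rewrite gaussEZ// mulN1r => /eqP; rewrite -subr_eq0 opprK -mulr2n mulrn_eq0/= => /eqP.
Qed.

Lemma dotvNr (a v : 'cV[R]_d) : dotv a (- v) = - dotv a v.
Proof. by rewrite /dotv -sumrN; apply: eq_bigr => j _; rewrite mxE mulrN. Qed.

Lemma tanhRB1 (z : R) : tanhR z - 1 = - expR (- z) * sechR z.
Proof.
rewrite /tanhR /sechR; have h0 : expR z + expR (- z) != 0 by rewrite gt_eqF ?expRDN_gt0.
by field.
Qed.

(* Under the centred Gaussian the tilt exp(th.v) turns v_i (tanh(th.v) - 1) into the
   odd function - v_i sech(th.v). *)
Lemma gaussE_coord_tanh i : gam (fun v => v i ord0 * tanhR (dotv th v)) = th i ord0.
Proof.
have ai := @admissible_coord R d i; have aT := admissible_tanhR th.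
have aT1 : admissible (fun v : 'cV[R]_d => v i ord0 * (tanhR (dotv th v) - 1)).
  by apply: admissibleM => //; apply: admissibleD => //; exact: admissible_cst.
rewrite -[RHS]gaussE_coord -[RHS]addr0.
rewrite (@eq_gaussE _ _ _ _ _ (fun v => v i ord0 + v i ord0 * (tanhR (dotv th v) - 1))); last first.
  by move=> v; ring.
rewrite gaussED//; congr (_ + _).
rewrite gaussE_tilt//.
have e (v : 'cV[R]_d) :
    v i ord0 * (tanhR (dotv th v) - 1) * expR (dotv th v - dotv th th / 2) =
    - expR (- (dotv th th / 2)) * (v i ord0 * sechR (dotv th v)).
  rewrite tanhRB1 expRD.
  have : expR (- dotv th v) * expR (dotv th v) = 1 by rewrite -expRD addNr expR0.
  move: (expR (- dotv th v)) (expR (dotv th v)) => p q pq.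
  by transitivity (- (p * q * (expR (- (dotv th th / 2)) * (v i ord0 * sechR (dotv th v)))));
    [ring|rewrite pq mul1r mulNr].
rewrite (eq_gaussE _ _ e); apply: gaussE_odd.
  by apply: admissibleZ; apply: admissibleM => //; exact: admissible_sechR.
by move=> v; rewrite dotvNr sechRN mxE; ring.
Qed.

(** Score in direction [t] of the balanced mixture of N(th, I) and N(-th, I), whose log-density is
    log cosh(th.v) - |th|^2/2 up to terms free of th. *)
Definition score (t v : 'cV[R]_d) : R := \sum_j t j ord0 * (v j ord0 * tanhR (dotv th v) - th j ord0).

Lemma scoreN t v : score t (- v) = score t v.
Proof.
by apply: eq_bigr => j _; rewrite dotvNr tanhRN mxE mulrNN.
Qed.

Lemma admissible_score_coord j :
  admissible (fun v : 'cV[R]_d => v j ord0 * tanhR (dotv th v) - th j ord0).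
Proof.
apply: admissibleD; last exact: (admissible_cst (- th j ord0)).
by apply: admissibleM; [exact: admissible_coord|exact: admissible_tanhR].
Qed.

Lemma admissible_score t : admissible (score t).
Proof. by apply: admissible_sum => j; apply: admissibleZ; exact: admissible_score_coord. Qed.

Lemma gaussE_score t : gam (score t) = 0.
Proof.
rewrite /score gaussE_sum; last by move=> j; apply: admissibleZ; exact: admissible_score_coord.
apply: big1 => j _; rewrite gaussEZ; last exact: admissible_score_coord.
rewrite gaussED; first by rewrite gaussE_coord_tanh gaussE_cst subrr mulr0.
  by apply: admissibleM; [exact: admissible_coord|exact: admissible_tanhR].
exact: (admissible_cst (- th j ord0)).
Qed.

Lemma quadform_mxE (M : 'M[R]_d) (t : 'cV[R]_d) :
  (t^T *m M *m t) ord0 ord0 = \sum_i \sum_j t i ord0 * t j ord0 * M i j.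
Proof.
rewrite -mulmxA mxE; apply: eq_bigr => i _; rewrite !mxE mulr_sumr.
by apply: eq_bigr => j _; rewrite mulrA [RHS]mulrAC.
Qed.

Lemma fisher0E i j : fisher0 th i j =
  (i == j)%:R - gam (fun v => v i ord0 * v j ord0 * sechR (dotv th v) ^+ 2).
Proof.
rewrite !mxE; congr (_ - _); apply: eq_gaussE => v; congr (_ * sechR _ ^+ 2).
by rewrite mxE; apply: eq_bigr => k _; rewrite mxE.
Qed.

Lemma fisher0_sym : (fisher0 th)^T = fisher0 th.
Proof.
apply/matrixP => i j; rewrite mxE !fisher0E eq_sym; congr (_ - _).
by apply: eq_gaussE => v; rewrite [v j ord0 * _]mulrC.
Qed.

Lemma admissible_sech_coord2 i j :
  admissible (fun v : 'cV[R]_d => v i ord0 * v j ord0 * sechR (dotv th v) ^+ 2).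
Proof.
apply: admissibleM; last exact: admissible_sechR2.
by apply: admissibleM; exact: admissible_coord.
Qed.

(** Since tanh^2 = 1 - sech^2, the part th th^T of the second moment I + th th^T is removed by
    centring, and I - E v v^T sech^2 remains. *)
Lemma gaussE_score2 t : gam (fun v => score t v ^+ 2) = (t^T *m fisher0 th *m t) ord0 ord0.
Proof.
pose s j (v : 'cV[R]_d) := v j ord0 * tanhR (dotv th v) - th j ord0.
have as_ j : admissible (s j) by exact: admissible_score_coord.
have ass i j : admissible (fun v => s i v * s j v) by exact: admissibleM.
have e v : score t v ^+ 2 = \sum_i \sum_j t i ord0 * t j ord0 * (s i v * s j v).
  rewrite expr2 /score big_distrlr; apply: eq_bigr => i _; apply: eq_bigr => j _.
  by rewrite /s /=; ring.
rewrite (eq_gaussE _ _ e) gaussE_sum; last first.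
  by move=> i; apply: admissible_sum => j; exact: admissibleZ.
rewrite quadform_mxE; apply: eq_bigr => i _.
rewrite gaussE_sum; last by move=> j; exact: admissibleZ.
apply: eq_bigr => j _; rewrite gaussEZ//; congr (_ * _).
have aT := admissible_tanhR th.
have acT k : admissible (fun v : 'cV[R]_d => v k ord0 * tanhR (dotv th v)).
  by apply: admissibleM => //; exact: admissible_coord.
have acc : admissible (fun v : 'cV[R]_d => v i ord0 * v j ord0).
  by apply: admissibleM; exact: admissible_coord.
have asc := admissible_sech_coord2 i j.
have e2 v : s i v * s j v = (v i ord0 * v j ord0 + -1 * (v i ord0 * v j ord0 * sechR (dotv th v) ^+ 2))
   + (- th j ord0 * (v i ord0 * tanhR (dotv th v)) + (- th i ord0 * (v j ord0 * tanhR (dotv th v))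
   + th i ord0 * th j ord0)).
  by rewrite sechR2E /s; ring.
have ac := @admissible_cst R d (th i ord0 * th j ord0).
rewrite (eq_gaussE _ _ e2) gaussED; last 2 first.
- by apply: admissibleD => //; exact: admissibleZ.
- apply: admissibleD; first exact: admissibleZ.
  by apply: admissibleD => //; exact: admissibleZ.
rewrite gaussED//; last exact: admissibleZ.
rewrite gaussED; last 2 first.
- exact: admissibleZ.
- by apply: admissibleD => //; exact: admissibleZ.
rewrite gaussED//; last exact: admissibleZ.
rewrite gaussE_cst !gaussEZ// !gaussE_coord_tanh gaussE_coord2 fisher0E.
ring.
Qed.

(** Mean of the quadratic Taylor term; its |t|^2 cancels against the increment of n |th|^2 / 2 and
    leaves the Fisher term. *)
Lemma gaussE_sech_dotv2 t : gam (fun v => dotv t v ^+ 2 * sechR (dotv th v) ^+ 2) =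
  dotv t t - (t^T *m fisher0 th *m t) ord0 ord0.
Proof.
have e v : dotv t v ^+ 2 * sechR (dotv th v) ^+ 2 = \sum_i \sum_j
    t i ord0 * t j ord0 * (v i ord0 * v j ord0 * sechR (dotv th v) ^+ 2).
  rewrite expr2 /dotv big_distrlr mulr_suml; apply: eq_bigr => i _.
  by rewrite mulr_suml; apply: eq_bigr => j _ /=; ring.
have asc i j := admissible_sech_coord2 i j.
rewrite (eq_gaussE _ _ e) gaussE_sum; last first.
  by move=> i; apply: admissible_sum => j; exact: admissibleZ.
rewrite quadform_mxE [dotv t t]/dotv -sumrB; apply: eq_bigr => i _.
rewrite gaussE_sum; last by move=> j; exact: admissibleZ.
apply/eqP; rewrite eq_sym subr_eq -big_split/=; apply/eqP.
rewrite (bigD1 i)//= big1 ?addr0; last first.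
  by move=> j /negbTE ji; rewrite (gaussEZ _ _ _ (asc i j)) fisher0E [i == j]eq_sym ji sub0r mulrN subrr.
by rewrite (gaussEZ _ _ _ (asc i i)) fisher0E eqxx mulrBr mulr1 addrC subrK.
Qed.

(** A factor has to exist, otherwise [xget] returns its default 0. The Fisher information is
    positive semidefinite because its quadratic form is a second moment of the score. *)
Lemma normal_covE_fisher0 : exists L : 'M[R]_d, L *m L^T = fisher0 th /\
  forall f, normal_covE (fisher0 th) f = gaussE 0 L f.
Proof.
have [L LE] : exists L : 'M[R]_d, L *m L^T = fisher0 th.
  apply: cholesky_factor fisher0_sym _ => t; rewrite -gaussE_score2 -(gaussE_cst th 1%:M 0); apply: gaussE_le.
  - exact: admissible_cst.
  - exact: admissibleX (admissible_score t).
  - by move=> v; exact: sqr_ge0.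
exists (xget 0 [set L : 'M[R]_d | L *m L^T = fisher0 th]); split => //.
exact: (xgetPex (P := [set L : 'M[R]_d | L *m L^T = fisher0 th]) 0 (ex_intro _ L LE)).
Qed.

End GaussianMoments.

(** * Convergence in probability *)

Section ConvergenceInProbability.
Context {R : realType} {dd : measure_display} {Omega : nat -> measurableType dd}.
Variable P : forall n, probability (Omega n) R.
Implicit Types (Y Z : forall n, Omega n -> R) (B : nat -> R).
Local Notation EP n Y := (\int[P n]_(w in setT) Y w)%R.

Lemma cvg_cst_div_sqrt (C : R) : (fun n : nat => C / Num.sqrt n%:R) @ \oo --> (0 : R).
Proof.
rewrite -(mulr0 C); apply: cvgM; first exact: cvg_cst.
rewrite -cvg_shiftS/=.
have -> : (fun n : nat => (Num.sqrt n.+1%:R)^-1) = (fun n => Num.sqrt (harmonic n) : R).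
  by apply/funext => n; rewrite /harmonic/= sqrtrV.
have := cvg_comp (@harmonic R) Num.sqrt (@cvg_harmonic R) (@sqrt_continuous R 0).
by rewrite sqrtr0.
Qed.

Lemma cvg_cst_div (C : R) : (fun n : nat => C / n%:R) @ \oo --> (0 : R).
Proof.
rewrite -(mulr0 C); apply: cvgM; first exact: cvg_cst.
rewrite -cvg_shiftS; exact: cvg_harmonic.
Qed.

Lemma fine_prob_ge0 n (A : set (Omega n)) : 0 <= fine (P n A).
Proof. by apply: fine_ge0; exact: measure_ge0. Qed.

Lemma fine_prob_le n (A A' : set (Omega n)) : measurable A -> measurable A' -> A `<=` A' ->
  fine (P n A) <= fine (P n A').
Proof.
move=> mA mA' AA'; apply: fine_le; [exact: fin_num_measure|exact: fin_num_measure|].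
by apply: le_measure; rewrite ?inE.
Qed.

Lemma cvg_in_prob_moment2 Y B : (forall n, measurable_fun setT (Y n)) ->
  (forall n (M : R), (0 < n)%N -> 0 <= M -> EP n (fun w => Num.min M (Y n w ^+ 2)) <= B n) ->
  B @ \oo --> (0 : R) -> cvg_in_prob P Y.
Proof.
move=> mY YB B0 e e0; have e2 : 0 < e ^+ 2 by rewrite exprn_gt0.
apply: (@squeeze_cvgr _ _ _ _ (fun=> 0) (fun n => (e ^+ 2)^-1 * B n)); last 2 first.
- exact: cvg_cst.
- by rewrite -(mulr0 (e ^+ 2)^-1); apply: cvgM => //; exact: cvg_cst.
near=> n; rewrite fine_prob_ge0/=.
have n0 : (0 < n)%N by near: n; exact: nbhs_infty_gt.
apply: (le_trans (prob_gt_le (P n) e0 (mY n))).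
by rewrite ler_pM2l ?invr_gt0// YB// ltW.
Unshelve. all: by end_near. Qed.

Lemma cvg_in_prob_moment1 Y B : (forall n, measurable_fun setT (Y n)) ->
  (forall n (M : R), (0 < n)%N -> 0 <= M -> EP n (fun w => Num.min M `|Y n w|) <= B n) ->
  B @ \oo --> (0 : R) -> cvg_in_prob P Y.
Proof.
move=> mY YB B0 e e0.
have sq n w : Num.sqrt `|Y n w| ^+ 2 = `|Y n w| by rewrite sqr_sqrtr.
(* The first moment of |Y| is the second moment of its square root. *)
have /(_ (Num.sqrt e)) : cvg_in_prob P (fun n w => Num.sqrt `|Y n w|).
  apply: (cvg_in_prob_moment2 (B := B)) => // [n|n M n0 M0].
    apply: (measurableT_comp (continuous_measurable_fun (@sqrt_continuous R))).
    by apply: measurableT_comp => //; exact: normr_measurable.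
  by under eq_Rintegral do rewrite sq; exact: YB.
rewrite sqrtr_gt0 => /(_ e0).
rewrite (_ : (fun n => fine (P n [set w | Num.sqrt e < `|Num.sqrt `|Y n w| |])) =
  (fun n => fine (P n [set w | e < `|Y n w|])))//.
apply/funext => n; congr (fine (P n _)); apply/funext => w /=.
rewrite ger0_norm ?sqrtr_ge0//; congr is_true.
apply/idP/idP => [|ew]; last by rewrite ltr_sqrt// (lt_trans e0).
by apply: contraTT; rewrite -!leNgt; exact: ler_wsqrtr.
Qed.

(** Monotonicity of the probability requires both events to be measurable; this is what forces the
    measurability of [approx_err]. *)
Lemma cvg_in_prob_le Y Z : (forall n, measurable_fun setT (Y n)) ->
  (forall n, measurable_fun setT (Z n)) ->
  (\forall n \near \oo, forall w, `|Y n w| <= `|Z n w|) ->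
  cvg_in_prob P Z -> cvg_in_prob P Y.
Proof.
move=> mY mZ YZ Z0 e e0.
apply: (@squeeze_cvgr _ _ _ _ (fun=> 0) (fun n => fine (P n [set w | e < `|Z n w|]))); last 2 first.
- exact: cvg_cst.
- exact: Z0.
near=> n; rewrite fine_prob_ge0/=; apply: fine_prob_le.
- exact: measurable_norm_gt.
- exact: measurable_norm_gt.
- move=> w /= /lt_le_trans; apply; have : forall w, `|Y n w| <= `|Z n w| by near: n.
  exact.
Unshelve. all: by end_near. Qed.

Lemma cvg_in_probD Y Z : (forall n, measurable_fun setT (Y n)) ->
  (forall n, measurable_fun setT (Z n)) ->
  cvg_in_prob P Y -> cvg_in_prob P Z -> cvg_in_prob P (fun n w => Y n w + Z n w).
Proof.
move=> mY mZ Y0 Z0 e e0; have e20 : 0 < e / 2 by rewrite divr_gt0.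
pose p n := fine (P n [set w | e / 2 < `|Y n w|]) + fine (P n [set w | e / 2 < `|Z n w|]).
apply: (@squeeze_cvgr _ _ _ _ (fun=> 0) p); last 2 first.
- exact: cvg_cst.
- by rewrite -(addr0 (0 : R)); apply: cvgD; [exact: Y0|exact: Z0].
near=> n; rewrite fine_prob_ge0/=.
have m1 := measurable_norm_gt (e / 2) (mY n).
have m2 := measurable_norm_gt (e / 2) (mZ n).
have m3 : measurable [set w | e < `|Y n w + Z n w|].
  by apply: measurable_norm_gt; exact: measurable_funD.
apply: (@le_trans _ _ (fine (P n ([set w | e / 2 < `|Y n w|] `|` [set w | e / 2 < `|Z n w|])))).
  apply: fine_prob_le => //; first exact: measurableU.
  move=> w /= ew; apply/orP; apply/negPn/negP; rewrite negb_or -!leNgt => /andP[y z].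
  by have := lt_le_trans ew (le_trans (ler_normD _ _) (lerD y z)); rewrite -splitr ltxx.
rewrite /p -fineD; [|exact: fin_num_measure|exact: fin_num_measure].
apply: fine_le; [by apply: fin_num_measure; exact: measurableU| |exact: measureU2].
by rewrite fin_numD; apply/andP; split; exact: fin_num_measure.
Unshelve. all: by end_near. Qed.

Lemma cvg_in_probZ (k : R) Y :
  cvg_in_prob P Y -> cvg_in_prob P (fun n w => k * Y n w).
Proof.
move=> Y0 e e0; have [->|k0] := eqVneq k 0.
  rewrite (_ : (fun n => _) = fun=> 0); first exact: cvg_cst.
  apply/funext => n; rewrite (_ : [set w | _] = set0) ?measure0//.
  by apply/seteqP; split => // w /=; rewrite mul0r normr0 ltNge (ltW e0).
have := Y0 (e / `|k|); rewrite divr_gt0 ?normr_gt0// => /(_ isT).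
rewrite (_ : (fun n => fine (P n [set w | e / `|k| < `|Y n w|])) =
  (fun n => fine (P n [set w | e < `|k * Y n w|])))//.
apply/funext => n; congr (fine (P n _)); apply/seteqP; split => w /=.
  by rewrite normrM ltr_pdivrMr ?normr_gt0// mulrC.
by rewrite normrM ltr_pdivrMr ?normr_gt0// mulrC.
Qed.

Lemma cvg_in_prob_norm Y :
  cvg_in_prob P Y -> cvg_in_prob P (fun n w => `|Y n w|).
Proof. by move=> Y0 e e0; under eq_fun do under eq_set do rewrite normr_id; exact: Y0. Qed.

End ConvergenceInProbability.

(** * The log-likelihood ratio *)

Section IsingMixture.
Context {R : realType} {n d : nat}.
Variables (beta : R) (A : 'M[R]_n).
Implicit Types (th h : 'cV[R]_d) (x : 'M[R]_(n, d)).

Lemma sumr_gt0_cst (I : finType) (i0 : I) (f : I -> R) : (forall i, 0 < f i) ->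
  0 < \sum_i f i.
Proof.
move=> f0; rewrite (bigD1 i0)//= ltr_wpDr//.
by apply: sumr_ge0 => i _; exact: ltW.
Qed.

Lemma sum_isingQ : \sum_(z : {ffun 'I_n -> bool}) isingQ beta A z = 1.
Proof.
rewrite -mulr_suml mulfV// gt_eqF//; apply: (sumr_gt0_cst [ffun=> true]) => w.
exact: expR_gt0.
Qed.

Definition postZ th x : R := \sum_(w : {ffun 'I_n -> bool}) post_weight beta A th x w.

Lemma postZ_gt0 th x : 0 < postZ th x.
Proof. by apply: (sumr_gt0_cst [ffun=> true]) => w; exact: expR_gt0. Qed.

Lemma spin_sqr b : spin b * spin b = 1 :> R.
Proof. by case: b; rewrite /spin ?mulr1// mulrNN mulr1. Qed.

(** Expanding the squares: since s^2 = 1 for a spin, |th|^2 s^2 does not depend on the spins and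
    comes out of the sum. What is free of th is collected in [K], which may depend on [x]. *)
Lemma mixdens_postZ x : exists2 K : R, 0 < K &
  forall th, mixdens beta A th x = K * (expR (- (n%:R * dotv th th / 2)) * postZ th x).
Proof.
pose W := \sum_(w : {ffun 'I_n -> bool}) ising_weight beta A w.
have W0 : 0 < W by apply: (sumr_gt0_cst [ffun=> true]) => w; exact: expR_gt0.
pose k i j : R := normal_peak 1 * expR (- (x i j) ^+ 2 / 2).
have k0 i j : 0 < k i j by rewrite mulr_gt0 ?expR_gt0// normal_peak_gt0// oner_eq0.
exists (W^-1 * \prod_i \prod_j k i j).
  rewrite mulr_gt0 ?invr_gt0//; apply: prodr_gt0 => i _.
  by apply: prodr_gt0 => j _; exact: k0.
move=> th; rewrite /mixdens /postZ mulrA mulr_sumr; apply: eq_bigr => z _.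
have e i j : normal_pdf (th j ord0 * spin (z i)) 1 (x i j) =
    k i j * expR (th j ord0 * x i j * spin (z i) - th j ord0 * th j ord0 / 2).
  rewrite normal_pdf1E /k -[RHS]mulrA -expRD; congr (_ * expR _).
  have := spin_sqr (z i); move: (spin (z i)) (x i j) (th j ord0) => s y t s2.
  transitivity (- y ^+ 2 / 2 + (t * y * s - t * t * (s * s) / 2)); first by field.
  by rewrite s2 mulr1.
transitivity (isingQ beta A z * ((\prod_i \prod_j k i j) * \prod_(i < n) \prod_(j < d)
    expR (th j ord0 * x i j * spin (z i) - th j ord0 * th j ord0 / 2))).
  congr (_ * _); rewrite -big_split; apply: eq_bigr => i _ /=.
  by rewrite -big_split; apply: eq_bigr => j _; exact: e.
rewrite /isingQ -/W /post_weight.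
have -> : \prod_(i < n) \prod_(j < d)
    expR (th j ord0 * x i j * spin (z i) - th j ord0 * th j ord0 / 2) =
    expR (\sum_i dotrow th x i * spin (z i)) * expR (- (n%:R * dotv th th / 2)).
  rewrite -expRD.
  under eq_bigr => i _ do rewrite -expR_sum; rewrite -expR_sum; congr expR.
  have -> : n%:R * dotv th th / 2 = \sum_(i < n) dotv th th / 2.
    by rewrite sumr_const card_ord -(mulr_natl (dotv th th / 2) n) mulrA.
  rewrite -sumrB; apply: eq_bigr => i _; rewrite /dotrow /dotv !mulr_suml -sumrB.
  by apply: eq_bigr.
rewrite expRD /ising_weight; move: (\prod_i _) => p; ring.
Qed.

Lemma loglik_ratioE th th' x : loglik_ratio beta A th th' x =
  ln (postZ th x) - ln (postZ th' x) - n%:R * (dotv th th - dotv th' th') / 2.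
Proof.
have [K K0 mE] := mixdens_postZ x.
rewrite /loglik_ratio !mE !lnM ?posrE ?expR_gt0 ?mulr_gt0 ?expR_gt0 ?postZ_gt0// !expRK.
by field.
Qed.

Lemma is_derive_bigsum (I : Type) (s : seq I) (f df : I -> R -> R) (y : R) :
  (forall i, is_derive y 1 (f i) (df i y)) ->
  is_derive y 1 (fun z => \sum_(i <- s) f i z) (\sum_(i <- s) df i y).
Proof.
move=> fd; elim: s => [|i s IH].
  by under eq_fun do rewrite big_nil; rewrite big_nil; exact: is_derive_cst.
by under eq_fun do rewrite big_cons; rewrite big_cons; exact: is_deriveD.
Qed.

Lemma is_derive_affine (b g y : R) : is_derive y 1 (fun z : R => b + z * g) g.
Proof.
have := is_deriveD (is_derive_cst b y (1 : R)) (is_deriveZ g (is_derive_id y (1 : R))).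
rewrite add0r => hh.
have -> : (fun z : R => b + z * g) = cst b + g \*: id.
  by apply/funext => z; rewrite !fctE /GRing.scale/= mulrC.
by apply: is_derive_eq; rewrite /GRing.scale/= mulr1.
Qed.

Lemma is_derive_comp_affine (f : R -> R) (b g y df : R) : is_derive (b + y * g) 1 f df ->
  is_derive y 1 (fun z => f (b + z * g)) (df * g).
Proof.
move=> fd; have := @is_derive1_comp R f _ y _ _ fd (is_derive_affine b g y).
by move=> h; apply: is_derive_eq.
Qed.

Lemma is_derive_log_sum_exp (I : finType) (i0 : I) (b g : I -> R) (y : R) :
  is_derive y 1 (fun z => ln (\sum_i expR (b i + z * g i)))
    ((\sum_i expR (b i + y * g i) * g i) / \sum_i expR (b i + y * g i)).
Proof.
have h := @is_derive_bigsum I (index_enum I) (fun i z => expR (b i + z * g i))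
  (fun i z => expR (b i + z * g i) * g i) y (fun i => is_derive_comp_affine (is_derive_expR _)).
have S0 : 0 < \sum_i expR (b i + y * g i).
  by apply: (sumr_gt0_cst i0) => i; exact: expR_gt0.
have := @is_derive1_comp R (@ln R) _ y _ _ (is_derive1_ln S0) h.
by move=> hh; apply: is_derive_eq => //; rewrite mulrC.
Qed.

(** Difference, along a segment of parameters, between the log-normaliser and its product-form
    surrogate. *)
Definition segment_gap th h x (s : R) : R :=
  ln (postZ (th + s *: h) x) - \sum_i lcosh (dotrow (th + s *: h) x i).

Lemma dotrowD th h x (s : R) i : dotrow (th + s *: h) x i = dotrow th x i + s * dotrow h x i.
Proof.
rewrite /dotrow mulr_sumr -big_split/=; apply: eq_bigr => j _; rewrite !mxE.
by rewrite mulrDl mulrA.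
Qed.

(** On the segment the posterior weight has the form exp(b + s g), so the derivative of the
    log-sum-exp is the posterior mean of g = sum_i (h.X_i) W_i. *)
Lemma is_derive_segment_gap th h x (s : R) :
  is_derive s 1 (segment_gap th h x)
    (dotv h (postE beta A (th + s *: h) x - tanh_sum (th + s *: h) x)).
Proof.
pose b (w : {ffun 'I_n -> bool}) := beta / 2 * quadform A w + \sum_(i < n) dotrow th x i * spin (w i).
pose g (w : {ffun 'I_n -> bool}) := \sum_(i < n) dotrow h x i * spin (w i).
have pwE s' w : post_weight beta A (th + s' *: h) x w = expR (b w + s' * g w).
  rewrite /post_weight /b /g -addrA; congr expR; congr (_ + _).
  rewrite mulr_sumr -big_split/=; apply: eq_bigr => i _.
  by rewrite dotrowD mulrDl mulrA.
have h1 := is_derive_log_sum_exp [ffun=> true] b g s.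
have h2 := @is_derive_bigsum 'I_n (index_enum _) (fun i z => lcosh (dotrow th x i + z * dotrow h x i))
  (fun i z => tanhR (dotrow th x i + z * dotrow h x i) * dotrow h x i) s
  (fun i => is_derive_comp_affine (is_derive_lcosh _)).
have h3 := is_deriveB h1 h2.
rewrite (_ : segment_gap th h x = (fun z => ln (\sum_i expR (b i + z * g i))) -
    (fun z => \sum_i lcosh (dotrow th x i + z * dotrow h x i))); last first.
  apply/funext => z; rewrite /segment_gap /postZ fctE; congr (ln _ - _).
    by apply: eq_bigr => w _; rewrite pwE.
  by apply: eq_bigr => i _; rewrite dotrowD.
apply: is_derive_eq; rewrite /dotv.
transitivity (\sum_j (h j ord0 * postE beta A (th + s *: h) x j ord0
    - h j ord0 * tanh_sum (th + s *: h) x j ord0)); last first.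
  by apply: eq_bigr => j _; rewrite !mxE mulrBr.
rewrite sumrB; congr (_ - _).
  under [RHS]eq_bigr => j _ do rewrite mxE mulrA mulr_sumr.
  rewrite -mulr_suml exchange_big/=.
  rewrite (_ : \sum_w expR (b w + s * g w) = \sum_w post_weight beta A (th + s *: h) x w); last first.
    by apply: eq_bigr => w _; rewrite pwE.
  congr (_ / _); apply: eq_bigr => w _; rewrite -pwE.
  under eq_bigr => j _ do rewrite mulrCA; rewrite -mulr_sumr; congr (_ * _).
  rewrite /g; under [RHS]eq_bigr => j _ do rewrite mulr_sumr.
  rewrite exchange_big/=; apply: eq_bigr => i _; rewrite /dotrow mulr_suml.
  by apply: eq_bigr => j _; rewrite mulrA.
under [RHS]eq_bigr => j _ do rewrite mxE mulr_sumr.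
rewrite exchange_big/=; apply: eq_bigr => i _; rewrite -dotrowD mulrC {2}/dotrow mulr_suml.
by apply: eq_bigr => j _; rewrite mulrA.
Qed.

(** Each coordinate is at most the Euclidean norm; compared with Cauchy-Schwarz only the constant is
    larger. *)
Lemma norm_dotv_le (u v : 'cV[R]_d) : `|dotv u v| <= l1 u * vnorm v.
Proof.
rewrite mulr_suml (le_trans (ler_norm_sum _ _ _))//; apply: ler_sum => j _.
rewrite normrM ler_wpM2l// -sqrtr_sqr ler_sqrt; last by apply: sumr_ge0 => k _; exact: sqr_ge0.
by rewrite (bigD1 j)//= lerDl; apply: sumr_ge0 => k _; exact: sqr_ge0.
Qed.

Lemma norm_postE_tanh_sum_le th x j :
  `|(postE beta A th x - tanh_sum th x) j ord0| <= 2 * \sum_i `|x i j|.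
Proof.
rewrite !mxE (le_trans (ler_normB _ _))// mulr2n mulrDl mul1r lerD//.
  rewrite normrM normfV (gtr0_norm (postZ_gt0 th x)) ler_pdivrMr ?postZ_gt0//.
  rewrite (le_trans (ler_norm_sum _ _ _))// mulr_sumr; apply: ler_sum => w _.
  rewrite normrM (gtr0_norm (expR_gt0 _)) mulrC ler_wpM2r ?expR_ge0//.
  rewrite (le_trans (ler_norm_sum _ _ _))//; apply: ler_sum => i _.
  by rewrite normrM /spin; case: (w i); rewrite ?normrN normr1 mulr1.
rewrite (le_trans (ler_norm_sum _ _ _))//; apply: ler_sum => i _.
by rewrite normrM ler_piMr// norm_tanhR_le1.
Qed.

Lemma vnorm_postE_tanh_sum_le th x : vnorm (postE beta A th x - tanh_sum th x) <=
  Num.sqrt (\sum_j (2 * \sum_i `|x i j|) ^+ 2).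
Proof.
rewrite ler_sqrt; last by apply: sumr_ge0 => j _; exact: sqr_ge0.
apply: ler_sum => j _; rewrite -[leLHS]real_normK ?num_real// lerXn2r ?nnegrE//.
  by rewrite mulr_ge0// sumr_ge0.
exact: norm_postE_tanh_sum_le.
Qed.

(** For fixed [x] both tanh and the spins are bounded by 1, which bounds the error uniformly in th;
    without it [sup] would not dominate its set. *)
Lemma approx_err_ub x : has_ubound [set r | exists th, th != 0 /\
  r = vnorm (postE beta A th x - tanh_sum th x)].
Proof.
exists (Num.sqrt (\sum_j (2 * \sum_i `|x i j|) ^+ 2)) => _ [th [_ ->]].
exact: vnorm_postE_tanh_sum_le.
Qed.

(** The nonvanishing is asked for all |s| <= 1, since [MVT_any] locates its point only by its
    distance to 0. *)
Lemma segment_gap_le th h x : (forall s : R, `|s| <= 1 -> th + s *: h != 0) ->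
  `|segment_gap th h x 1 - segment_gap th h x 0| <= l1 h * approx_err beta A x.
Proof.
move=> thn0.
have [c c1 ->] := MVT_any 0 1 (fun s => is_derive_segment_gap th h x s).
rewrite subr0 mulr1 (le_trans (norm_dotv_le _ _))//.
rewrite ler_wpM2l ?sumr_ge0//; apply: ub_le_sup; first exact: approx_err_ub.
exists (th + c *: h); split => //; apply: thn0.
by move: c1; rewrite !subr0 normr1.
Qed.

End IsingMixture.

(** * Measurability of the supremum over the parameters *)

Section ApproxErrMeasurable.
Context {R : realType} {n d : nat} {dd : measure_display} {T : measurableType dd}.
Variables (beta : R) (A : 'M[R]_n) (X : T -> 'M[R]_(n, d)).
Hypothesis mX : forall i j, measurable_fun setT (fun w => X w i j).
Implicit Types (th : 'cV[R]_d).

Lemma measurable_dotrow th i : measurable_fun setT (fun w => dotrow th (X w) i).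
Proof. by apply: measurable_sum => j; apply: measurable_funM. Qed.

Lemma measurable_post_weight th z : measurable_fun setT (fun w => post_weight beta A th (X w) z).
Proof.
apply: measurableT_comp => //; apply: measurable_funD => //.
by apply: measurable_sum => i; apply: measurable_funM => //; exact: measurable_dotrow.
Qed.

Lemma measurable_ln_postZ th : measurable_fun setT (fun w => ln (postZ beta A th (X w))).
Proof.
apply: (measurableT_comp (@measurable_ln R)).
by apply: measurable_sum => z; exact: measurable_post_weight.
Qed.

Definition post_err th (x : 'M[R]_(n, d)) : R := vnorm (postE beta A th x - tanh_sum th x).

Lemma measurable_post_err th : measurable_fun setT (fun w => post_err th (X w)).
Proof.
apply: (measurableT_comp (continuous_measurable_fun (@sqrt_continuous R))).
apply: measurable_sum => j; apply: measurable_funX.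
under eq_fun do rewrite !mxE; apply: measurable_funB; last first.
  apply: measurable_sum => i; apply: measurable_funM => //.
  apply: (measurableT_comp (continuous_measurable_fun (@continuous_tanhR R))).
  exact: measurable_dotrow.
(* Division by the positive normaliser is written as a factor exp(-ln Z), a composition of
   measurable functions. *)
have -> : (fun w => (\sum_z post_weight beta A th (X w) z * (\sum_i X w i j * spin (z i))) /
    \sum_z post_weight beta A th (X w) z) =
    (fun w => (\sum_z post_weight beta A th (X w) z * (\sum_i X w i j * spin (z i))) *
    expR (- ln (postZ beta A th (X w)))).
  by apply/funext => w; rewrite expRN lnK// posrE postZ_gt0.
apply: measurable_funM.
  apply: measurable_sum => z; apply: measurable_funM; first exact: measurable_post_weight.
  by apply: measurable_sum => i; apply: measurable_funM.
apply: measurableT_comp => //; apply: measurableT_comp => //.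
exact: measurable_ln_postZ.
Qed.

Lemma cvg_dotrow (x : 'M[R]_(n, d)) (F : nat -> 'cV[R]_d) th i :
  (forall j, (fun m => F m j ord0) @ \oo --> th j ord0) ->
  (fun m => dotrow (F m) x i) @ \oo --> dotrow th x i.
Proof. by move=> Fth; apply: cvg_sumr => j; apply: cvgM; [exact: Fth|exact: cvg_cst]. Qed.

Lemma cvg_post_err (x : 'M[R]_(n, d)) (F : nat -> 'cV[R]_d) th :
  (forall j, (fun m => F m j ord0) @ \oo --> th j ord0) ->
  (fun m => post_err (F m) x) @ \oo --> post_err th x.
Proof.
move=> Fth; have cd i := cvg_dotrow (x := x) (i := i) Fth.
have cpw z : (fun m => post_weight beta A (F m) x z) @ \oo --> post_weight beta A th x z.
  apply: (cvg_comp _ expR _ (@continuous_expR R _)).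
  apply: cvgD; first exact: cvg_cst.
  by apply: cvg_sumr => i; apply: cvgM; [exact: cd|exact: cvg_cst].
apply: (cvg_comp _ Num.sqrt _ (@sqrt_continuous R _)).
apply: cvg_sumr => j; rewrite expr2; under eq_fun do rewrite expr2.
suff H : (fun m => (postE beta A (F m) x - tanh_sum (F m) x) j ord0) @ \oo -->
    (postE beta A th x - tanh_sum th x) j ord0 by apply: cvgM.
rewrite !mxE; under eq_fun do rewrite !mxE.
apply: cvgB; last first.
  apply: cvg_sumr => i; apply: cvgM; first exact: cvg_cst.
  exact: (cvg_comp _ tanhR (cd i) (@continuous_tanhR R _)).
apply: cvgM.
  by apply: cvg_sumr => z; apply: cvgM; [exact: cpw|exact: cvg_cst].
apply: cvgV; first by rewrite gt_eqF//; exact: (postZ_gt0 beta A th x).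
by apply: cvg_sumr => z; exact: cpw.
Qed.

Lemma rat_seq_cvg th : exists F : nat -> 'cV[rat]_d, forall j,
  (fun m => ratr (F m j ord0) : R) @ \oo --> th j ord0.
Proof.
have /choice[F FP] m : exists q : 'cV[rat]_d, forall j,
    th j ord0 < ratr (q j ord0) < th j ord0 + m.+1%:R^-1.
  have /choice[q qP] j : exists q : rat, th j ord0 < ratr q < th j ord0 + m.+1%:R^-1.
    have h : th j ord0 < th j ord0 + m.+1%:R^-1 by rewrite ltrDl invr_gt0 ltr0n.
    by have [q] := rat_in_itvoo h; rewrite in_itv/= => qP; exists q.
  by exists (\col_j q j) => j; rewrite mxE.
exists F => j; apply: (@squeeze_cvgr _ _ _ _ (fun=> th j ord0)
    (fun m => th j ord0 + m.+1%:R^-1)).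
- by near=> m; have /andP[/ltW -> /ltW ->] := FP m j.
- exact: cvg_cst.
- rewrite -[X in _ --> X]addr0; apply: cvgD; first exact: cvg_cst.
  exact: cvg_harmonic.
Unshelve. all: by end_near. Qed.

Variable th0 : 'cV[R]_d.
Hypothesis th00 : th0 != 0.

(* Nonzero rational parameters suffice, which makes the supremum over Theta a countable one. *)
Definition rat_param (k : nat) : 'cV[R]_d :=
  if (unpickle k : option 'cV[rat]_d) is Some q then
    if map_mx (@ratr R) q == 0 then th0 else map_mx (@ratr R) q
  else th0.

Lemma rat_param_neq0 k : rat_param k != 0.
Proof. by rewrite /rat_param; case: unpickle => // q; case: ifPn. Qed.

Lemma rat_param_pickle (q : 'cV[rat]_d) : map_mx (@ratr R) q != 0 ->
  exists k, rat_param k = map_mx (@ratr R) q.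
Proof. by move=> /negbTE q0; exists (pickle q); rewrite /rat_param pickleK q0. Qed.

Lemma approx_errE (x : 'M[R]_(n, d)) :
  approx_err beta A x = sups (fun k => post_err (rat_param k) x) 0.
Proof.
have ubS := approx_err_ub beta A x.
have ubR : has_ubound (sdrop (fun k => post_err (rat_param k) x) 0).
  have [M SM] := ubS; exists M => _ [k _ <-]; apply: SM.
  by exists (rat_param k); split => //; exact: rat_param_neq0.
apply/le_anti/andP; split; apply: ge_sup.
- by exists (post_err th0 x), th0.
- move=> _ [th [thn0 ->]]; have [F Fth] := rat_seq_cvg th.
  have Fth' j : (fun m => map_mx (@ratr R) (F m) j ord0) @ \oo --> th j ord0.
    by under eq_fun do rewrite mxE; exact: Fth.
  have lim := @cvg_post_err x (fun m => map_mx (@ratr R) (F m)) th Fth'.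
  (* A nonzero coordinate of [th] stays nonzero along the approximation, which keeps the rational
     points in Theta. *)
  have [j thj] : exists j, th j ord0 != 0.
    apply/not_existsP => h; move/eqP: thn0; apply; apply/colP => j.
    by rewrite mxE; apply/eqP/negPn/negP; exact: h.
  apply: (ler_cvg_to lim (@cvg_cst _ _ _ _ _)).
  near=> m; have mn0 : map_mx (@ratr R) (F m) j ord0 != 0.
    by near: m; exact: (cvgr_neq0 _ (Fth' j) thj).
  have [|k <-] := @rat_param_pickle (F m).
    by apply: contra mn0 => /eqP ->; rewrite mxE.
  by apply: (ub_le_sup ubR); exists k.
- by exists (post_err (rat_param 0) x), 0%N.
- move=> _ [k _ <-]; apply: ub_le_sup => //.
  by exists (rat_param k); split => //; exact: rat_param_neq0.
Unshelve. all: by end_near. Qed.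

Lemma measurable_approx_err : measurable_fun setT (fun w => approx_err beta A (X w)).
Proof.
under eq_fun do rewrite approx_errE.
apply: measurable_fun_sups => [w _|k]; last exact: measurable_post_err.
have [M SM] := approx_err_ub beta A (X w); exists M => _ [k _ <-]; apply: SM.
by exists (rat_param k); split => //; exact: rat_param_neq0.
Qed.

Lemma measurable_loglik_ratio th : measurable_fun setT (fun w => loglik_ratio beta A th th0 (X w)).
Proof.
under eq_fun do rewrite loglik_ratioE.
by do 2! apply: measurable_funB => //; exact: measurable_ln_postZ.
Qed.

End ApproxErrMeasurable.

(** * The law of Delta and the LAN expansion *)

Section LocalAsymptoticNormality.
Context {R : realType} {d : nat} (th0 : 'cV[R]_d).
Context {dd : measure_display} {Omega : nat -> measurableType dd}.
Variables (P : forall n, probability (Omega n) R) (X : forall n, Omega n -> 'M[R]_(n, d)).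
Arguments X : clear implicits.
Hypothesis mX : forall n i j, measurable_fun setT (fun w => X n w i j).
Local Notation EP n Y := (\int[P n]_(w in setT) Y w)%R.
Local Notation gam f := (gaussE th0 1%:M f).
Local Notation x n := (xrow (X n)).
Hypothesis even_prod : forall n (g : 'I_n -> 'cV[R]_d -> R),
  (forall i, bcont (g i)) -> (forall i v, g i (- v) = g i v) ->
  EP n (fun w => \prod_i g i (x n w i)) = \prod_i gam (g i).

Lemma measurable_xrow n i j : measurable_fun setT (fun w => x n w i j ord0).
Proof. by under eq_fun do rewrite mxE; exact: mX. Qed.

Lemma dotrow_xrow n (th : 'cV[R]_d) w i : dotrow th (X n w) i = dotv th (x n w i).
Proof. by apply: eq_bigr => j _; rewrite mxE. Qed.

Lemma dotv_Delta n w t : (0 < n)%N ->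
  dotv t (Delta th0 (X n w)) = (Num.sqrt n%:R)^-1 * \sum_i score th0 t (x n w i).
Proof.
move=> n0; have n1 : 0 < n%:R :> R by rewrite ltr0n.
have sn : Num.sqrt n%:R != 0 :> R by rewrite gt_eqF// sqrtr_gt0.
have s2 : n%:R = Num.sqrt n%:R ^+ 2 :> R by rewrite sqr_sqrtr// ltW.
rewrite exchange_big/= mulr_sumr; apply: eq_bigr => j _; rewrite !mxE -mulr_sumr sumrB.
rewrite sumr_const card_ord -(mulr_natl (th0 j ord0) n).
under [in RHS]eq_bigr do rewrite mxE -dotrow_xrow.
have gen (N s S a b : R) : s != 0 -> N = s ^+ 2 ->
    a * (s * (N^-1 * S - b)) = s^-1 * (a * (S - N * b)).
  by move=> s0 ->; field.
exact: gen.
Qed.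

Lemma measurable_rowfun n i (f : 'cV[R]_d -> R) : continuous f ->
  measurable_fun setT (fun w => f (x n w i)).
Proof.
move=> cf; apply: (measurable_continuous_vec (Y := fun w => x n w i)) => // j.
exact: measurable_xrow.
Qed.

Lemma measurable_Delta n j : measurable_fun setT (fun w => Delta th0 (X n w) j ord0).
Proof.
under eq_fun do rewrite !mxE; apply: measurable_funM => //; apply: measurable_funB => //.
apply: measurable_funM => //; apply: measurable_sum => i.
have [c _] := admissibleM (@admissible_coord R d j) (admissible_tanhR th0).
rewrite (_ : (fun w => _) = (fun w => x n w i j ord0 * tanhR (dotv th0 (x n w i)))).
  exact: (measurable_rowfun i c).
by apply/funext => w; rewrite dotrow_xrow mxE.
Qed.

Lemma dotv_delta (v : 'cV[R]_d) j : dotv (delta_mx j ord0) v = v j ord0.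
Proof.
rewrite /dotv (bigD1 j)//= big1 ?addr0 ?mxE ?eqxx ?mul1r// => k /negbTE kj.
by rewrite mxE kj mul0r.
Qed.

Lemma EP_tail_Delta n (K : R) : (0 < n)%N -> 0 < K ->
  EP n (fun w => tail K (Delta th0 (X n w))) <=
  (\sum_j gam (fun v => score th0 (delta_mx j ord0) v ^+ 2)) / K ^+ 2.
Proof.
move=> n0 K0; have K2 : 0 < K ^+ 2 by rewrite exprn_gt0.
have n1 : 0 < n%:R :> R by rewrite ltr0n.
pose S j w := \sum_i score th0 (delta_mx j ord0) (x n w i).
have mS j : measurable_fun setT (S j).
  by apply: measurable_sum => i; apply: measurable_rowfun; case: (admissible_score th0 (delta_mx j ord0)).
have nK : 0 < n%:R * K ^+ 2 by rewrite mulr_gt0.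
have bm j : bmeas (fun w => Num.min (n%:R * K ^+ 2) (S j w ^+ 2)).
  apply: bmeas_min; [exact: measurable_funX|exact: ltW|by move=> w; exact: sqr_ge0].
(* As Delta_j = S_j / sqrt n, each summand of the tail is a rescaled truncated second moment of
   S_j. *)
rewrite (_ : (fun w => _) =
    (fun w => \sum_j (n%:R * K ^+ 2)^-1 * Num.min (n%:R * K ^+ 2) (S j w ^+ 2))); last first.
  apply/funext => w; apply: eq_bigr => j _.
  rewrite minr_pMr ?invr_ge0 ?(ltW nK)// mulVf ?gt_eqF//; congr Num.min.
  rewrite -dotv_delta dotv_Delta// exprMn exprVn sqr_sqrtr ?(ltW n1)// invfM.
  rewrite /S; move: (\sum_i _) => s; rewrite invfM [K ^+ 2]expr2 invfM; ring.
rewrite EP_sum; last by move=> j; apply: bmeasM => //; exact: bmeas_cst.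
rewrite mulr_suml; apply: ler_sum => j _; rewrite EPZ//.
rewrite invfM [_^-1 * _^-1]mulrC -mulrA mulrC ler_pM2r ?invr_gt0// mulrC ler_pdivrMr//.
rewrite [leRHS]mulrC; apply: EP_min_sqr_sum_le.
- exact: measurable_xrow.
- exact: even_prod.
- exact: ltW.
- exact: admissible_score.
- exact: gaussE_score.
- exact: scoreN.
Qed.

Lemma cvg_law_Delta f : continuous f -> (exists M : R, forall v, `|f v| <= M) ->
  (fun n => EP n (fun w => f (Delta th0 (X n w)))) @ \oo --> (normal_covE (fisher0 th0) f : R).
Proof.
move=> cf bf; have [L [LE ->]] := normal_covE_fisher0 th0.
(* The sum of the two families of second moments bounds the tails of the sequence and of the limit
   at once. *)
pose B := \sum_j gam (fun v => score th0 (delta_mx j ord0) v ^+ 2)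
  + \sum_j gaussE 0 L (fun v : 'cV[R]_d => v j ord0 ^+ 2).
have sq0 mu M (u : 'cV[R]_d -> R) : admissible u -> 0 <= gaussE mu M (fun v => u v ^+ 2).
  move=> au; rewrite -(gaussE_cst mu M 0); apply: gaussE_le; first exact: admissible_cst.
    exact: admissibleX.
  by move=> v; rewrite sqr_ge0.
have ac j := @admissible_coord R d j.
apply: (@cvg_mean R d (fun n f => EP n (fun w => f (Delta th0 (X n w)))) (gaussE 0 L) B) => //.
- move=> n; exact: (mean_pushforward (@measurable_Delta n)).
- exact: mean_gaussE.
- move=> n K n0 K0; rewrite (le_trans (EP_tail_Delta n0 K0))// ler_pM2r ?invr_gt0 ?exprn_gt0//.
  by rewrite /B lerDl; apply: sumr_ge0 => j _; exact: (sq0 0 L (fun v => v j ord0)).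
- move=> K K0; have K2 : 0 < K ^+ 2 by rewrite exprn_gt0.
  apply: (@le_trans _ _ (gaussE 0 L (fun v : 'cV[R]_d => \sum_j (K ^+ 2)^-1 * v j ord0 ^+ 2))).
    apply: gaussE_le; first by apply: bcont_admissible; exact: bcont_tail.
      by apply: admissible_sum => j; apply: admissibleZ; exact: admissibleX.
    by move=> v; apply: ler_sum => j _; rewrite mulrC ge_min lexx orbT.
  rewrite gaussE_sum; last by move=> j; apply: admissibleZ; exact: admissibleX.
  rewrite (eq_bigr (fun j => gaussE 0 L (fun v : 'cV[R]_d => v j ord0 ^+ 2) / K ^+ 2)); last first.
    by move=> j _; rewrite gaussEZ; [rewrite mulrC|exact: admissibleX].
  rewrite -mulr_suml ler_pM2r ?invr_gt0// /B lerDr.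
  by apply: sumr_ge0 => j _; apply: sq0; exact: admissible_score.
(* The exponent of the limit is the variance of the score, so [EP_cos_clt] applies with the explicit
   rate C / sqrt n. *)
- move=> t c; rewrite gaussE_cos LE -gaussE_score2.
  set l := expR _ * _.
  set C : R := gam (fun v => score th0 t v ^+ 4) + gam (fun v => score th0 t v ^+ 2) ^+ 2
    + gam (fun v => `|score th0 t v| ^+ 3).
  apply/cvgrPdist_le => e e0; have /cvgrPdist_le/(_ _ e0) := cvg_cst_div_sqrt C.
  move=> H; near=> n.
  have n0 : (0 < n)%N by near: n; exact: nbhs_infty_gt.
  have := EP_cos_clt (P := P n) (@measurable_xrow n) (@even_prod n) c n0 (admissible_score th0 t)
    (gaussE_score th0 t) (scoreN th0 t).
  rewrite distrC => h; rewrite (_ : l = expR (- (gam (fun v => score th0 t v ^+ 2) / 2)) * cos c).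
    rewrite (_ : (fun w => _) = (fun w => cos ((Num.sqrt n%:R)^-1 * \sum_i score th0 t (x n w i) + c))).
      apply: (le_trans h); rewrite -/C.
      have : `|0 - C / Num.sqrt n%:R| <= e by near: n.
      by rewrite sub0r normrN; exact: le_trans (ler_norm _).
    by apply/funext => w; rewrite dotv_Delta.
  by rewrite /l mulNr.
Unshelve. all: by end_near. Qed.

Variables (beta : R) (A : forall n, 'M[R]_n).
Hypothesis th0pos : lexpos th0.
Hypothesis approx : cvg_in_prob P (fun n w => approx_err beta (A n) (X n w) / Num.sqrt n%:R).
Variable h : 'cV[R]_d.
Local Notation rate n := ((Num.sqrt n%:R)^-1 : R).
Local Notation qh := ((h^T *m fisher0 th0 *m h) ord0 ord0).

Lemma lexpos_neq0 : th0 != 0.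
Proof.
have [k [_ k0]] := th0pos; apply/eqP => th00.
by move: k0; rewrite th00 mxE ltxx.
Qed.

Lemma scoreE (v : 'cV[R]_d) : score th0 h v = dotv h v * tanhR (dotv th0 v) - dotv h th0.
Proof.
rewrite /score {1}/dotv mulr_suml [dotv h th0]/dotv -sumrB; apply: eq_bigr => j _.
by rewrite mulrBr mulrA.
Qed.

Lemma dotv_sqrD (c : R) : dotv (th0 + c *: h) (th0 + c *: h) - dotv th0 th0 =
  2 * c * dotv h th0 + c ^+ 2 * dotv h h.
Proof.
rewrite /dotv -sumrB !mulr_sumr -big_split/=; apply: eq_bigr => j _.
by rewrite !mxE; ring.
Qed.

Definition taylor_rest (a y : R) : R :=
  lcosh (a + y) - lcosh a - y * tanhR a - y ^+ 2 / 2 * sechR a ^+ 2.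

(** An exact identity with three remainders: the gap controlled by the assumption, the third-order
    Taylor term, and the quadratic term centred at its mean. *)
Lemma LAN_decomposition n w : (0 < n)%N ->
  loglik_ratio beta (A n) (th0 + rate n *: h) th0 (X n w)
    - ((h^T *m Delta th0 (X n w)) ord0 ord0 - 2^-1 * qh) =
  (segment_gap beta (A n) th0 (rate n *: h) (X n w) 1
     - segment_gap beta (A n) th0 (rate n *: h) (X n w) 0)
  + \sum_i taylor_rest (dotv th0 (x n w i)) (rate n * dotv h (x n w i))
  + \sum_i rate n ^+ 2 / 2 * (dotv h (x n w i) ^+ 2 * sechR (dotv th0 (x n w i)) ^+ 2
      - (dotv h h - qh)).
Proof.
move=> n0; have n1 : 0 < n%:R :> R by rewrite ltr0n.
set c := rate n; set q := qh.
have c2 : n%:R * c ^+ 2 = 1 by rewrite exprVn sqr_sqrtr ?(ltW n1)// mulfV ?gt_eqF.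
have cn1 (z : R) : \sum_(i < n) z = n%:R * z by rewrite sumr_const card_ord mulr_natl.
rewrite loglik_ratioE dotv_sqrD.
have -> : (h^T *m Delta th0 (X n w)) ord0 ord0 = dotv h (Delta th0 (X n w)).
  by rewrite mxE; apply: eq_bigr => j _; rewrite mxE.
rewrite dotv_Delta// -/c.
rewrite /segment_gap scale1r scale0r addr0.
set s1 := \sum_i lcosh (dotrow (_ + _) _ _); set s0 := \sum_i lcosh (dotrow th0 _ _).
set s2 := \sum_i score _ _ _.
set r := \sum_i taylor_rest _ _; set g := (X in _ = _ + X).
suff rg : r + g = s1 - s0 - c * s2 - n%:R * (c * dotv h th0) - n%:R * (c ^+ 2 / 2 * (dotv h h - q)).
  rewrite -[RHS]addrA rg; transitivity (ln (postZ beta (A n) (th0 + c *: h) (X n w))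
    - ln (postZ beta (A n) th0 (X n w)) - n%:R * c * dotv h th0 - (n%:R * c ^+ 2) * dotv h h / 2
    - c * s2 + (n%:R * c ^+ 2) * q / 2).
    by rewrite c2; field: c2.
  by field.
rewrite /r /g -big_split/=.
transitivity (\sum_i (lcosh (dotrow (th0 + c *: h) (X n w) i) - lcosh (dotrow th0 (X n w) i)
  - c * score th0 h (x n w i) - c * dotv h th0 - c ^+ 2 / 2 * (dotv h h - q))).
  apply: eq_bigr => i _; rewrite dotrowD !dotrow_xrow scoreE /taylor_rest.
  by field.
by rewrite !sumrB -mulr_sumr !cn1.
Qed.

Lemma LAN_rest1_le n w : (0 < n)%N -> (forall s : R, `|s| <= 1 -> th0 + s *: (rate n *: h) != 0) ->
  `|segment_gap beta (A n) th0 (rate n *: h) (X n w) 1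
     - segment_gap beta (A n) th0 (rate n *: h) (X n w) 0| <=
  `|l1 h * (approx_err beta (A n) (X n w) / Num.sqrt n%:R)|.
Proof.
move=> n0 hs; apply: le_trans (ler_norm _); apply: (le_trans (segment_gap_le beta (A n) (X n w) hs)).
have -> : l1 (rate n *: h) = rate n * l1 h.
  rewrite /l1 mulr_sumr; apply: eq_bigr => j _.
  by rewrite mxE normrM ger0_norm// invr_ge0 sqrtr_ge0.
by rewrite le_eqVlt; apply/orP; left; apply/eqP; ring.
Qed.

(** There are n nonnegative terms with means of order n^(-3/2), so the first moment is of order
    1/sqrt n. *)
Lemma cvg_LAN_rest2 :
  cvg_in_prob P (fun n w => \sum_i 2 * rate n ^+ 3 * `|dotv h (x n w i)| ^+ 3).
Proof.
have ac : admissible (fun v => `|dotv h v| ^+ 3).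
  by apply: admissibleX; apply: admissible_norm; exact: admissible_dotv.
have ac2 n : admissible (fun v => 2 * rate n ^+ 3 * `|dotv h v| ^+ 3) by exact: admissibleZ.
apply: (@cvg_in_prob_moment1 _ _ _ P _
  (fun n => (2 * gam (fun v => `|dotv h v| ^+ 3)) / Num.sqrt n%:R)).
- by move=> n; apply: measurable_sum => i; exact: (measurable_rowfun i (ac2 n).1).
- move=> n M n0 M0.
  have n1 : 0 < n%:R :> R by rewrite ltr0n.
  have c2 : n%:R * rate n ^+ 2 = 1 by rewrite exprVn sqr_sqrtr ?(ltW n1)// mulfV ?gt_eqF.
  apply: (le_trans (EP_min_sum_le (@measurable_xrow n) (@even_prod n) M0 (ac2 n) _ _)).
  + by move=> v; rewrite mulr_ge0 ?mulr_ge0 ?exprn_ge0 ?invr_ge0 ?sqrtr_ge0.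
  + by move=> v; rewrite dotvNr normrN.
  rewrite gaussEZ//; move: (gam _) => m.
  by rewrite (_ : n%:R * _ = (n%:R * rate n ^+ 2) * (2 * m * rate n)); [rewrite c2 mul1r|ring].
- exact: cvg_cst_div_sqrt.
Qed.

Definition sech_gap (v : 'cV[R]_d) : R :=
  dotv h v ^+ 2 * sechR (dotv th0 v) ^+ 2 - (dotv h h - qh).

Lemma admissible_sech_gap : admissible sech_gap.
Proof.
apply: admissibleD; last exact: (admissible_cst (- (dotv h h - qh))).
by apply: admissibleM; [apply: admissibleX; exact: admissible_dotv|exact: admissible_sechR2].
Qed.

Lemma gaussE_sech_gap : gam sech_gap = 0.
Proof.
rewrite /sech_gap gaussED; first by rewrite gaussE_sech_dotv2 gaussE_cst subrr.
  by apply: admissibleM; [apply: admissibleX; exact: admissible_dotv|exact: admissible_sechR2].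
exact: (admissible_cst (- (dotv h h - qh))).
Qed.

(** The terms are centred and of size 1/n, so the second moment of their sum is of order 1/n. *)
Lemma cvg_LAN_rest3 :
  cvg_in_prob P (fun n w => \sum_i rate n ^+ 2 / 2 * sech_gap (x n w i)).
Proof.
have ac := admissible_sech_gap.
have ac2 n : admissible (fun v => rate n ^+ 2 / 2 * sech_gap v) by exact: admissibleZ.
apply: (@cvg_in_prob_moment2 _ _ _ P _
  (fun n => (gam (fun v => sech_gap v ^+ 2) / 4) / n%:R)).
- by move=> n; apply: measurable_sum => i; exact: (measurable_rowfun i (ac2 n).1).
- move=> n M n0 M0.
  have n1 : 0 < n%:R :> R by rewrite ltr0n.
  have c2 : rate n ^+ 2 = n%:R^-1 by rewrite exprVn sqr_sqrtr ?(ltW n1).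
  apply: (le_trans (EP_min_sqr_sum_le (@measurable_xrow n) (@even_prod n) M0 (ac2 n) _ _)).
  + by rewrite gaussEZ// gaussE_sech_gap mulr0.
  + by move=> v; rewrite /sech_gap !dotvNr sechRN sqrrN.
  under eq_gaussE do rewrite exprMn.
  rewrite gaussEZ; last exact: admissibleX.
  rewrite c2; move: (gam _) => m.
  have n10 : n%:R != 0 :> R by rewrite gt_eqF.
  by rewrite le_eqVlt; apply/orP; left; apply/eqP; move: (n%:R) n10 => N N0; field.
- exact: cvg_cst_div.
Qed.

Lemma LAN_expansion : cvg_in_prob P (fun n w =>
  loglik_ratio beta (A n) (th0 + rate n *: h) th0 (X n w)
    - ((h^T *m Delta th0 (X n w)) ord0 ord0 - 2^-1 * qh)).
Proof.
pose Z1 n w := l1 h * (approx_err beta (A n) (X n w) / Num.sqrt n%:R).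
pose Z2 n w := \sum_i 2 * rate n ^+ 3 * `|dotv h (x n w i)| ^+ 3.
pose Z3 n w := \sum_i rate n ^+ 2 / 2 * sech_gap (x n w i).
have mnorm n (Y : Omega n -> R) : measurable_fun setT Y -> measurable_fun setT (fun w => `|Y w|).
  by move=> mY; apply: measurableT_comp => //; exact: normr_measurable.
have m1 n : measurable_fun setT (fun w => `|Z1 n w|).
  apply: mnorm; apply: measurable_funM => //; apply: measurable_funM => //.
  exact: (measurable_approx_err beta (A n) (@mX n) lexpos_neq0).
have m2 n : measurable_fun setT (fun w => `|Z2 n w|).
  apply: mnorm; apply: measurable_sum => i; apply: (measurable_rowfun i
    (admissibleZ (2 * rate n ^+ 3) (admissibleX 3 (admissible_norm (admissible_dotv h)))).1).
have m3 n : measurable_fun setT (fun w => `|Z3 n w|).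
  apply: mnorm; apply: measurable_sum => i.
  exact: (measurable_rowfun i (admissibleZ (rate n ^+ 2 / 2) admissible_sech_gap).1).
apply: (@cvg_in_prob_le _ _ _ P _ (fun n w => `|Z1 n w| + `|Z2 n w| + `|Z3 n w|)).
- move=> n; apply: measurable_funB; first exact: (measurable_loglik_ratio beta (A n) (@mX n)).
  apply: measurable_funB => //; under eq_fun do rewrite mxE.
  apply: measurable_sum => j; apply: measurable_funM => //; exact: (@measurable_Delta n j).
- by move=> n; do 2! apply: measurable_funD => //.
(* The leading positive coordinate k keeps the segment away from the origin: once |h_k| / sqrt n <
   th0_k, the k-th coordinate cannot vanish for |s| <= 1. *)
- have [k [_ k0]] := th0pos.
  have /cvgrPdist_lt/(_ _ k0) H := cvg_cst_div_sqrt `|h k ord0|.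
  near=> n; have n0 : (0 < n)%N by near: n; exact: nbhs_infty_gt.
  have hk : `|h k ord0| * rate n < th0 k ord0.
    have : `|0 - `|h k ord0| / Num.sqrt n%:R| < th0 k ord0 by near: n.
    by rewrite sub0r normrN ger0_norm// mulr_ge0// invr_ge0 sqrtr_ge0.
  have hs (s : R) : `|s| <= 1 -> th0 + s *: (rate n *: h) != 0.
    move=> s1; apply/eqP => /matrixP/(_ k ord0); rewrite !mxE => /eqP.
    rewrite addr_eq0 => /eqP e; move: hk; apply/negP; rewrite -leNgt e.
    apply: (le_trans (ler_norm _)); rewrite normrN normrM normrM mulrA.
    rewrite (ger0_norm (x := rate n)) ?invr_ge0 ?sqrtr_ge0//.
    by rewrite [leRHS]mulrC -mulrA ler_piMl// mulr_ge0// invr_ge0 sqrtr_ge0.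
  move=> w; rewrite LAN_decomposition// [leRHS]ger0_norm; last by rewrite !addr_ge0.
  apply: (le_trans (ler_normD _ _)); apply: lerD => //.
  apply: (le_trans (ler_normD _ _)); apply: lerD; first exact: LAN_rest1_le.
  apply: le_trans (ler_norm _); apply: (le_trans (ler_norm_sum _ _ _)); apply: ler_sum => i _.
  apply: (le_trans (lcosh_taylor2 _ _)).
  by rewrite normrM exprMn mulrA ger0_norm// invr_ge0 sqrtr_ge0.
- apply: cvg_in_probD => //; first by move=> n; exact: measurable_funD.
    apply: cvg_in_probD => //; last by apply: cvg_in_prob_norm; exact: cvg_LAN_rest2.
    by apply: cvg_in_prob_norm; exact: cvg_in_probZ.
  by apply: cvg_in_prob_norm; exact: cvg_LAN_rest3.
Unshelve. all: by end_near. Qed.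

End LocalAsymptoticNormality.

Unset Implicit Arguments.
Set Strict Implicit.

Theorem mainTheorem4 (R : realType) (d : nat) (th0 : 'cV[R]_d)
  (beta : R) (A : forall n : nat, 'M[R]_n)
  (dd : measure_display) (Omega : nat -> measurableType dd)
  (P : forall n, probability (Omega n) R)
  (X : forall n, Omega n -> 'M[R]_(n, d)) :
  lexpos th0 ->
  0 <= beta ->
  (forall n, (A n)^T = A n) ->
  (forall n (i j : 'I_n), 0 <= A n i j) ->
  (forall n (i : 'I_n), A n i i = 0) ->
  (* X^n ~ P_{th0, Q_{0,beta,A_n}} : measurable, with the mixture law on rectangles *)
  (forall n (i : 'I_n) (j : 'I_d), measurable_fun setT (fun w => X n w i j)) ->
  (forall n (B : 'I_n -> 'I_d -> set R), (forall i j, measurable (B i j)) ->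
     P n [set w | forall i j, B i j (X n w i j)] =
     ((\sum_(z : {ffun 'I_n -> bool}) isingQ beta (A n) z *
        \prod_(i < n) \prod_(j < d)
          fine (normal_prob (th0 j ord0 * spin (z i)) 1 (B i j)))%:E)%E) ->
  (* assumption (ast): sup_theta || ... || = o_p(sqrt n) *)
  cvg_in_prob P (fun n w => approx_err beta (A n) (X n w) / Num.sqrt n%:R) ->
  (* LAN expansion, for each h *)
  (forall h : 'cV[R]_d,
     cvg_in_prob P (fun n w =>
       loglik_ratio beta (A n) (th0 + (Num.sqrt n%:R)^-1 *: h) th0 (X n w)
       - ((h^T *m Delta th0 (X n w)) ord0 ord0
          - 2^-1 * (h^T *m fisher0 th0 *m h) ord0 ord0)))
  /\
  (* Delta_{n,th0} converges in distribution to N_d(0, I_0(th0)) *)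
  (forall f : 'cV[R]_d -> R, continuous f -> (exists M : R, forall v, `|f v| <= M) ->
     (fun n => (\int[P n]_(w in setT) f (Delta th0 (X n w)))%R) @ \oo
       --> (normal_covE (fisher0 th0) f : R)).
Proof.
move=> th0pos _ _ _ _ mX lawX approx.
have even_prod n (g : 'I_n -> 'cV[R]_d -> R) : (forall i, bcont (g i)) ->
    (forall i v, g i (- v) = g i v) ->
    (\int[P n]_(w in setT) \prod_i g i (xrow (X n) w i))%R = \prod_i gaussE th0 1%:M (g i).
  by move=> bg eg; exact: (EP_even_prod (mX n) (lawX n) (sum_isingQ beta (A n)) bg eg).
split=> [h|f cf bf].
  exact: (LAN_expansion mX even_prod th0pos approx h).
exact: (cvg_law_Delta mX even_prod cf bf).
Qed.
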